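(* Let $n\ge3$, $k\ge2$, and let $u$ be a positive smooth function on $S^n\setminus\{k\text{ points}\}$ such that $u^{\frac{4}{n-2}}g_0$ is a complete metric of constant scalar curvature $n(n-1)$ on the complement of these $k$ points. Using a stereographic projection from a point which is not one of the singular points, regard the metric as $U^{\frac{4}{n-2}}\delta$ on $\mathbb{R}^n\setminus\{p_1,\dots,p_k\}$, and let $\varepsilon_j\in(0,\varepsilon_0]$ and $a_j\in\mathbb{R}^n$ be the Fowler and translation parameters of $U$ at $p_j$. Then the following hold: $$\sum_{j=1}^kH(\varepsilon_j)\,a_j=0,$$ $$\sum_{j=1}^kH(\varepsilon_j)\Big(p_j\cdot a_j+\tfrac12\Big)=0,$$ $$\sum_{j=1}^kH(\varepsilon_j)\Big((b\cdot p_j)(c\cdot a_j)-(c\cdot p_j)(b\cdot a_j)\Big)=0\quad\text{for all }b,c\in\mathbb{R}^n,$$ $$\sum_{j=1}^kH(\varepsilon_j)\Big((b\cdot p_j)\big(a_j\cdot p_j+\tfrac12\big)-\tfrac12|p_j|^2(b\cdot a_j)\Big)=0\quad\text{for all }b\in\mathbb{R}^n.$$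
   Context: $g_0$ is the standard metric on $S^n$ and $\delta$ the Euclidean metric on $\mathbb{R}^n$. Put $\varepsilon_0=\left(\frac{n-2}{n}\right)^{\frac{n-2}{4}}$. For $\varepsilon\in(0,\varepsilon_0]$, $v_\varepsilon:\mathbb{R}\to(0,\infty)$ is the positive periodic solution of $v''-\frac{(n-2)^2}{4}v+\frac{n(n-2)}{4}v^{\frac{n+2}{n-2}}=0$ with $v_\varepsilon(0)=\min v_\varepsilon=\varepsilon$, $v_\varepsilon'(0)=0$, and $H(\varepsilon)=\frac{(n-2)^2}{4}\big(\varepsilon^{\frac{2n}{n-2}}-\varepsilon^2\big)$. The function $U>0$ solves $\Delta U+\frac{n(n-2)}{4}U^{\frac{n+2}{n-2}}=0$ on $\mathbb{R}^n\setminus\{p_1,\dots,p_k\}$, is singular at each $p_j$, and extends smoothly (in the sense of the conformal metric on $S^n$) across $\infty$. The Fowler parameter $\varepsilon_j$ and translation parameter $a_j$ of $U$ at $p_j$ are those for which, for some $T_j\in\mathbb{R}$ and some $\beta>1$, as $y=x-p_j\to0$, $$U(x)=|y|^{\frac{2-n}{2}}\Big(v_{\varepsilon_j}(s)+(a_j\cdot y)\big(-v_{\varepsilon_j}'(s)+\tfrac{n-2}{2}v_{\varepsilon_j}(s)\big)+O(|y|^{\beta})\Big),\qquad s=-\log|y|+T_j.$$ (Such an expansion exists at every isolated singularity of a positive solution, with $\varepsilon_j$ and $a_j$ uniquely determined.) *)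

(* Defs.v *)
From mathcomp Require Export all_boot all_order all_algebra.
From mathcomp Require Export all_classical all_reals all_analysis.

Set Implicit Arguments.
Unset Strict Implicit.
Unset Printing Implicit Defensive.

Export Order.TTheory GRing.Theory Num.Theory.
Export numFieldNormedType.Exports.

#[global] Open Scope classical_set_scope.
#[global] Open Scope ring_scope.

(* The norm `|x| that MathComp-Analysis puts on 'rV[R]_n is the sup norm, so
   the Euclidean structure is defined here.  The topology, and hence limits,
   continuity and derivatives, are the same for both norms. *)
Definition dotp (R : realType) (m : nat) (x y : 'rV[R]_m) : R :=
  \sum_(i < m) x 0 i * y 0 i.

Definition enorm (R : realType) (m : nat) (x : 'rV[R]_m) : R :=
  Num.sqrt (dotp x x).

Definition partial (R : realType) (m : nat) (V : normedModType R) (i : 'I_m)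
    (f : 'rV[R]_m -> V) : 'rV[R]_m -> V :=
  fun x => 'D_(delta_mx 0 i) f x.

(* C^oo on an open set D: all iterated partial derivatives exist and are
   continuous at the points of D. *)
Definition smooth_on (R : realType) (m : nat) (D : set 'rV[R]_m)
    (f : 'rV[R]_m -> R) : Prop :=
  forall (l : seq 'I_m) (x : 'rV[R]_m), D x ->
    let g := foldr (@partial R m R) f l in
    {for x, continuous g} /\ forall i : 'I_m, derivable g x (delta_mx 0 i).

(* Scalar curvature of a Riemannian metric given in coordinates by
   g = (g_ij), with the sign for which round spheres are positive. *)
Section ScalarCurvature.
Variables (R : realType) (m : nat) (g : 'rV[R]_m -> 'M[R]_m).

(* Gamma^l_(ij) *)
Definition christoffel (l i j : 'I_m) (x : 'rV[R]_m) : R :=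
  2^-1 * \sum_(s < m) invmx (g x) l s *
    (partial i (fun y => g y j s) x + partial j (fun y => g y i s) x
     - partial s (fun y => g y i j) x).

Definition ricci (i j : 'I_m) (x : 'rV[R]_m) : R :=
  \sum_(l < m) (partial l (christoffel l i j) x
                - partial j (christoffel l i l) x
    + \sum_(s < m) (christoffel l l s x * christoffel s i j x
                    - christoffel l j s x * christoffel s i l x)).

Definition scalar_curvature (x : 'rV[R]_m) : R :=
  \sum_(i < m) \sum_(j < m) invmx (g x) i j * ricci i j x.

End ScalarCurvature.

(* S^n is the unit sphere of R^(n+1), and a metric on an open subset of it is
   represented by bilinear forms g x v w, of which only the values at x in the
   subset and v, w tangent to the sphere at x matter. *)
Section Sphere.
Variables (R : realType) (n : nat).

Definition sphere : set 'rV[R]_n.+1 := [set x | dotp x x = 1].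

Definition punctured_sphere (k : nat) (q : 'I_k -> 'rV[R]_n.+1) :
  set 'rV[R]_n.+1 := sphere `\` range q.

Definition round_metric (x v w : 'rV[R]_n.+1) : R := dotp v w.

(* u^(4/(n-2)) g_0 *)
Definition conformal_metric (u : 'rV[R]_n.+1 -> R) (x v w : 'rV[R]_n.+1) : R :=
  u x `^ (4 / (n%:R - 2)) * round_metric x v w.

(* N is a unit vector (the centre of a stereographic projection) and the rows
   of E are an orthonormal basis of the hyperplane orthogonal to N, which is
   thereby identified with R^n. *)
Definition stereo_frame (N : 'rV[R]_n.+1) (E : 'M[R]_(n, n.+1)) : Prop :=
  [/\ dotp N N = 1, E *m E^T = 1%:M & E *m N^T = 0].

Definition stereo (N : 'rV[R]_n.+1) (E : 'M[R]_(n, n.+1))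
    (z : 'rV[R]_n.+1) : 'rV[R]_n :=
  (1 - dotp z N)^-1 *: (z *m E^T).

(* The inverse of stereo N E, a parametrization of the sphere minus N. *)
Definition stereo_inv (N : 'rV[R]_n.+1) (E : 'M[R]_(n, n.+1))
    (x : 'rV[R]_n) : 'rV[R]_n.+1 :=
  (1 + dotp x x)^-1 *: (2 *: (x *m E) + (dotp x x - 1) *: N).

Definition pullback (g : 'rV[R]_n.+1 -> 'rV[R]_n.+1 -> 'rV[R]_n.+1 -> R)
    (psi : 'rV[R]_n -> 'rV[R]_n.+1) (x : 'rV[R]_n) : 'M[R]_n :=
  \matrix_(i, j) g (psi x) (partial i psi x) (partial j psi x).

Definition sphere_smooth (M : set 'rV[R]_n.+1) (u : 'rV[R]_n.+1 -> R) : Prop :=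
  forall N E, stereo_frame N E ->
    smooth_on (stereo_inv N E @^-1` M) (u \o stereo_inv N E).

Definition constant_scalar_curvature (M : set 'rV[R]_n.+1)
    (g : 'rV[R]_n.+1 -> 'rV[R]_n.+1 -> 'rV[R]_n.+1 -> R) (c : R) : Prop :=
  forall N E, stereo_frame N E ->
    forall x, M (stereo_inv N E x) ->
      scalar_curvature (pullback g (stereo_inv N E)) x = c.

(* Curves are parametrized by [0, 1] and are required to be differentiable on
   the whole line for convenience: a C^1 curve on [0, 1] extends.  Piecewise
   C^1 curves give the same set of lengths, since one can reparametrize so as
   to stop at the corners. *)
Definition C1_curve (M : set 'rV[R]_n.+1) (x y : 'rV[R]_n.+1)
    (c : R -> 'rV[R]_n.+1) : Prop :=
  [/\ forall t, derivable c t 1, continuous (derive1 c),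
      forall t, 0 <= t <= 1 -> M (c t), c 0 = x & c 1 = y].

Definition curve_length
    (g : 'rV[R]_n.+1 -> 'rV[R]_n.+1 -> 'rV[R]_n.+1 -> R)
    (c : R -> 'rV[R]_n.+1) : \bar R :=
  (\int[lebesgue_measure]_(t in `[0%R, 1%R])
     (Num.sqrt (g (c t) (derive1 c t) (derive1 c t)))%:E)%E.

Definition riem_dist (M : set 'rV[R]_n.+1)
    (g : 'rV[R]_n.+1 -> 'rV[R]_n.+1 -> 'rV[R]_n.+1 -> R)
    (x y : 'rV[R]_n.+1) : \bar R :=
  ereal_inf [set curve_length g c | c in C1_curve M x y].

Definition complete_metric (M : set 'rV[R]_n.+1)
    (g : 'rV[R]_n.+1 -> 'rV[R]_n.+1 -> 'rV[R]_n.+1 -> R) : Prop :=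
  forall z : nat -> 'rV[R]_n.+1, (forall i, M (z i)) ->
    (forall e : R, 0 < e -> exists K : nat, forall i j : nat,
       (K <= i)%N -> (K <= j)%N -> (riem_dist M g (z i) (z j) < e%:E)%E) ->
    exists2 l, M l & forall e : R, 0 < e -> exists K : nat, forall i : nat,
       (K <= i)%N -> (riem_dist M g (z i) l < e%:E)%E.

End Sphere.

Section Fowler.
Variables (R : realType) (n : nat).

Definition eps0 : R := ((n%:R - 2) / n%:R) `^ ((n%:R - 2) / 4).

Definition fowler_solution (eps : R) (v : R -> R) : Prop :=
  [/\ forall t, [/\ 0 < v t, derivable v t 1 & derivable (derive1 v) t 1],
      forall t, derive1 (derive1 v) t - (n%:R - 2) ^+ 2 / 4 * v t
        + n%:R * (n%:R - 2) / 4 * v t `^ ((n%:R + 2) / (n%:R - 2)) = 0,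
      exists2 T, 0 < T & forall t, v (t + T) = v t,
      v 0 = eps /\ (forall t, eps <= v t)
    & derive1 v 0 = 0].

Definition fowlerH (eps : R) : R :=
  (n%:R - 2) ^+ 2 / 4 * (eps `^ (2 * n%:R / (n%:R - 2)) - eps ^+ 2).

(* eps and a are the Fowler and translation parameters of U at p; the
   O(|y|^beta) is spelled out, with the factor |y|^((2-n)/2) outside. *)
Definition fowler_parameters (U : 'rV[R]_n -> R) (p : 'rV[R]_n)
    (eps : R) (a : 'rV[R]_n) : Prop :=
  0 < eps <= eps0 /\
  exists (v : R -> R) (T beta C : R),
    [/\ fowler_solution eps v, 1 < beta
      & \forall y \near (0 : 'rV[R]_n)^',
          let s := - ln (enorm y) + T in
          exists2 r : R, `|r| <= C * enorm y `^ beta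
            & U (p + y) = enorm y `^ ((2 - n%:R) / 2) *
                (v s + dotp a y * (- derive1 v s + (n%:R - 2) / 2 * v s) + r)].

End Fowler.

(* Main.v *)
Require Import Defs.
From mathcomp Require Import ring lra zify.

Set Implicit Arguments.
Unset Strict Implicit.
Unset Printing Implicit Defensive.

(* A conformal Killing field X of R^n, with div X = n lam, turns the equation
   for U into a divergence-free (Pohozaev) field quadratic in (U, DU).  By the
   Fowler expansion its flux through a small sphere around p_j is a positive
   constant, the same for all j, times H(eps_j) (X(p_j).a_j + lam(p_j)/2), and
   its flux at infinity vanishes because U decays like |x|^(2-n).  Translations,
   the dilation, rotations and special conformal fields give the four
   identities.

   The expansion controls U but not DU.  Fluxes are therefore averaged over the
   annuli r^2 < |x - p_j|^2 < 4 r^2, rescaled to 1 < |y|^2 < 4, where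
   Caccioppoli's inequality bounds the gradient of the remainder in L^2.  Only
   bounded functions with bounded support are integrated, and the integral may
   be any positive translation-invariant functional on these. *)

(** * C^1 calculus by partial derivatives *)

(** No change of variables is available for [I] beyond translations. Averages over rotations are
    replaced by integration by parts of rotation fields, and an integral dilated by r is a new
    functional of the same kind as [I]. The constant of the local flux is the integral of
    [newton_weight]; that it is the same at every scale is a divergence identity.

    The local flux carries a prefactor 1/r, while the part of X that is constant near p_j gives an
    integrand of order 1, so everything is needed up to o(r). The term of order 1 is odd and
    averages to zero; the term linear in r a_j survives. The L^2 bound on the gradient error is the
    geometric mean of the size r^beta of the remainder and of the bound O(r) on its Laplacian, hence
    o(r) because beta > 1.

    At infinity U is rescaled differently: the nonlinearity gets the factor kap = s^-2, which tends
    to 0, and the limit profile is the harmonic function A0 |x|^(2-n), whose averaged flux vanishes.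
    In dimension 3 no power of s is left over, so convergence to this profile is needed and not only
    a bound. *)

Section DirectionalDerivative.
Variables (R : realType) (V : normedModType R).
Implicit Types (f g : V -> R) (x v : V).

(** Reduces directional derivatives to ordinary ones along a line, where the chain rule and the mean
    value theorem of one variable apply. *)
Lemma is_derive_lineP f x v t d :
  is_derive (x + t *: v) v f d <-> is_derive t 1 (fun s => f (x + s *: v)) d.
Proof.
have E : (fun h : R => h^-1 *: ((f \o shift (x + t *: v)) (h *: v) - f (x + t *: v)))
   = (fun h : R => h^-1 *: (((fun s => f (x + s *: v)) \o shift t) (h *: 1) - f (x + t *: v))).
  apply/funext => h /=; congr (_ *: (f _ - _)).
  by rewrite [h *: 1]mulr1 scalerDl addrCA.
by split => -[H1 H2]; split; move: H1 H2;
  rewrite /derivable /derive ?E -?E.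
Qed.

Lemma is_derive_comp1 (h : R -> R) f x v d e :
  is_derive x v f d -> is_derive (f x) 1 h e ->
  is_derive x v (fun y => h (f y)) (e * d).
Proof.
move=> Df Dh.
have := (@is_derive_lineP (fun y => h (f y)) x v 0 (e * d)).2.
rewrite scale0r addr0; apply.
have Df0 : is_derive (x + 0 *: v) v f d by rewrite scale0r addr0.
have D1 := (is_derive_lineP f x v 0 d).1 Df0.
have Dh0 : is_derive ((fun s => f (x + s *: v)) 0) 1 h e by rewrite scale0r addr0.
have -> : (fun s => h (f (x + s *: v))) = h \o (fun s => f (x + s *: v)) by [].
exact: is_derive1_comp.
Qed.

Lemma is_derive_add f g x v a b : is_derive x v f a -> is_derive x v g b ->
  is_derive x v (fun y => f y + g y) (a + b).
Proof. by move=> ? ?; apply: is_deriveD. Qed.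

Lemma is_derive_mul f g x v a b : is_derive x v f a -> is_derive x v g b ->
  is_derive x v (fun y => f y * g y) (a * g x + f x * b).
Proof.
move=> Df Dg; have := @is_deriveM _ _ f g x v a b Df Dg.
by rewrite addrC /= [g x *: a]mulrC.
Qed.

Lemma is_derive_affine f x (p v : V) (c d : R) :
  is_derive (p + c *: x) v f d -> is_derive x v (fun y => f (p + c *: y)) (c * d).
Proof.
move=> Df.
have := (@is_derive_lineP (fun y => f (p + c *: y)) x v 0 (c * d)).2.
rewrite scale0r addr0; apply.
have Df0 : is_derive ((p + c *: x) + (c * 0) *: v) v f d.
  by rewrite mulr0 scale0r addr0.
have D1 := (is_derive_lineP f (p + c *: x) v (c * 0) d).1 Df0.
have -> : (fun s => f (p + c *: (x + s *: v))) =
    (fun s => f ((p + c *: x) + s *: v)) \o (fun s => c * s).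
  by apply/funext => s /=; rewrite scalerDr scalerA addrA.
rewrite mulrC; apply: is_derive1_comp => //.
have := @is_deriveZ _ _ _ (@id R) c 0 1 1 (is_derive_id _ _).
by rewrite [c *: 1]mulr1.
Qed.

Lemma is_derive_ext f g x v a b : (forall y, f y = g y) -> a = b ->
  is_derive x v f a -> is_derive x v g b.
Proof. by move=> /funext -> ->. Qed.

End DirectionalDerivative.

Section C1.
Variables (R : realType) (n : nat).
Notation V := 'rV[R]_n.
Implicit Types (D : set V) (f : V -> R) (g : 'I_n -> V -> R).

(** The partial derivatives are an explicit argument, so that sums and products come with their
    derivatives as formulas and integrands can be compared by [ring]. *)
Definition C1 D f g := forall x, D x ->
  {for x, continuous f} /\
  forall i, is_derive x (delta_mx 0 i) f (g i x) /\ {for x, continuous (g i)}.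

Lemma C1_sub D D' f g : D' `<=` D -> C1 D f g -> C1 D' f g.
Proof. by move=> sD Cf x /sD /Cf. Qed.

Lemma C1_cont D f g x : C1 D f g -> D x -> {for x, continuous f}.
Proof. by move=> Cf /Cf[]. Qed.

Lemma C1_der D f g x i : C1 D f g -> D x -> is_derive x (delta_mx 0 i) f (g i x).
Proof. by move=> Cf /Cf[_ /(_ i)[]]. Qed.

Lemma C1_dcont D f g x i : C1 D f g -> D x -> {for x, continuous (g i)}.
Proof. by move=> Cf /Cf[_ /(_ i)[]]. Qed.

Lemma C1_eq D f f' g g' : C1 D f g ->
  (forall x, f x = f' x) -> (forall i x, g i x = g' i x) -> C1 D f' g'.
Proof.
move=> C /funext <- E.
by have <- : g = g' by apply/funext => i; apply/funext => x; exact: E.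
Qed.

Lemma open_near_eq D (f h : V -> R) x : open D -> D x ->
  (forall y, D y -> f y = h y) -> \near x, f x = h x.
Proof.
move=> oD Dx E; near=> y; apply: E; near: y; exact: open_nbhs_nbhs.
Unshelve. all: by end_near. Qed.

Lemma continuous_near_eq f h x : (\near x, f x = h x) ->
  {for x, continuous f} -> {for x, continuous h}.
Proof.
move=> E cf; rewrite /prop_for /continuous_at -(nbhs_singleton E).
exact: cvg_trans (near_eq_cvg E) cf.
Qed.

Lemma C1_eq_on D f f' g g' : open D -> C1 D f g ->
  (forall x, D x -> f x = f' x) -> (forall i x, D x -> g i x = g' i x) ->
  C1 D f' g'.
Proof.
move=> oD Cf Ef Eg x Dx; have [cf H] := Cf x Dx.
have nf := open_near_eq oD Dx Ef.
split; first exact: continuous_near_eq cf.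
move=> i; have [d c] := H i; split.
  by apply: near_eq_is_derive nf _; rewrite -Eg.
by apply: continuous_near_eq c; apply: (open_near_eq oD Dx) => y; exact: Eg.
Qed.

Lemma C1_cst D (c : R) : C1 D (fun=> c) (fun _ _ => 0).
Proof.
move=> x _; split; first exact: cst_continuous.
by move=> i; split; [exact: is_derive_cst|exact: cst_continuous].
Qed.

Lemma C1_add D f f' g g' : C1 D f g -> C1 D f' g' ->
  C1 D (fun x => f x + f' x) (fun i x => g i x + g' i x).
Proof.
move=> C C' x Dx; have [c H] := C x Dx; have [c' H'] := C' x Dx.
split; first exact: continuousD.
move=> i; have [d e] := H i; have [d' e'] := H' i.
by split; [exact: is_derive_add|exact: continuousD].
Qed.

Lemma C1_mul D f f' g g' : C1 D f g -> C1 D f' g' ->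
  C1 D (fun x => f x * f' x) (fun i x => g i x * f' x + f x * g' i x).
Proof.
move=> C C' x Dx; have [c H] := C x Dx; have [c' H'] := C' x Dx.
split; first exact: continuousM.
move=> i; have [d e] := H i; have [d' e'] := H' i.
split; first exact: is_derive_mul.
by apply: continuousD; exact: continuousM.
Qed.

Lemma C1_scale D (c : R) f g : C1 D f g ->
  C1 D (fun x => c * f x) (fun i x => c * g i x).
Proof.
move=> Cf; refine (C1_eq (C1_mul (@C1_cst D c) Cf) _ _) => //.
by move=> i x; rewrite mul0r add0r.
Qed.

Lemma C1_sub_fun D f f' g g' : C1 D f g -> C1 D f' g' ->
  C1 D (fun x => f x - f' x) (fun i x => g i x - g' i x).
Proof.
move=> C /(@C1_scale _ (-1) _ _) C'; refine (C1_eq (C1_add C C') _ _).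
  by move=> x; rewrite mulN1r.
by move=> i x; rewrite mulN1r.
Qed.

Lemma C1_sum D (I : finType) (f : I -> V -> R) (g : I -> 'I_n -> V -> R) :
  (forall j, C1 D (f j) (g j)) ->
  C1 D (fun x => \sum_j f j x) (fun i x => \sum_j g j i x).
Proof.
move=> C.
have -> : (fun x => \sum_j f j x) = (fun x => \sum_(j <- enum I) f j x).
  by apply/funext => x; rewrite big_enum.
have -> : (fun i x => \sum_j g j i x) = (fun i x => \sum_(j <- enum I) g j i x).
  by apply/funext => i; apply/funext => x; rewrite big_enum.
elim: (enum I) => [|j s IH].
  refine (C1_eq (@C1_cst D 0) _ _); first by move=> x; rewrite big_nil.
  by move=> i x; rewrite big_nil.
refine (C1_eq (C1_add (C j) IH) _ _); first by move=> x; rewrite big_cons.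
by move=> i x; rewrite big_cons.
Qed.

Lemma C1_coord D j : C1 D (fun x => x 0 j) (fun i _ => (i == j)%:R).
Proof.
move=> x _; split; first exact: coord_continuous.
move=> i; split; last exact: cst_continuous.
have := (@is_derive_lineP _ _ (fun y : V => y 0 j) x (delta_mx 0 i) 0 (i == j)%:R).2.
rewrite scale0r addr0; apply.
apply: (@is_derive_ext _ _ (fun s : R => x 0 j + s * (i == j)%:R) _ _ _
  (0 + (1 * (i == j)%:R + 0 * 0))).
- by move=> s; rewrite !mxE eqxx eq_sym.
- by rewrite mul0r addr0 add0r mul1r.
exact: (is_derive_add (is_derive_cst _ _ _)
  (is_derive_mul (is_derive_id _ _) (is_derive_cst _ _ _))).
Qed.

Lemma C1_comp D (h h' : R -> R) f g : C1 D f g ->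
  (forall x, D x -> is_derive (f x) 1 h (h' (f x)) /\ {for f x, continuous h'}) ->
  C1 D (fun x => h (f x)) (fun i x => h' (f x) * g i x).
Proof.
move=> C H x Dx; have [c K] := C x Dx; have [dh ch'] := H x Dx.
have ch : {for f x, continuous h}.
  by apply: differentiable_continuous; apply/derivable1_diffP; case: dh.
split; first exact: continuous_comp.
move=> i; have [d e] := K i; split; first exact: is_derive_comp1.
by apply: continuousM => //; apply: continuous_comp.
Qed.

Lemma C1_affine D (p : V) (c : R) f g : C1 D f g ->
  C1 [set x | D (p + c *: x)] (fun x => f (p + c *: x))
    (fun i x => c * g i (p + c *: x)).
Proof.
move=> C x Dx; have [cf K] := C _ Dx.
have ca : {for x, continuous (fun y : V => p + c *: y)}.
  by apply: continuousD; [exact: cst_continuous|exact: scaler_continuous].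
split; first exact: (continuous_comp ca cf).
move=> i; have [d e] := K i; split; first exact: is_derive_affine.
by apply: continuousM; [exact: cst_continuous|exact: (continuous_comp ca e)].
Qed.

(** Extension by zero: off [D] nothing is known about [f], but there [w] vanishes in a whole
    neighbourhood. This makes functions that are regular only on a shell, or off the singular
    points, accessible to integration by parts over the whole space. *)
Lemma C1_ext0 D f g (w : V -> R) dw : C1 D f g -> C1 setT w dw ->
  (forall x, ~ D x -> \near x, w x = 0) ->
  C1 setT (fun x => w x * f x) (fun i x => dw i x * f x + w x * g i x).
Proof.
move=> C Cw w0 x _; have [Dx|nDx] := pselect (D x).
  exact: (C1_mul (C1_sub (@subsetT _ _) Cw) C).
have nw := w0 x nDx.
have ndw i : \near x, dw i x = 0.
  (* [w] vanishes near every point close to [x], so its derivatives vanish near [x] and not only at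
     [x]. *)
  have nn : \near x, \near x, w x = 0 by apply/near_join.
  near=> y; have [_ /(_ i)[dy _]] := Cw y I.
  have ny : \near y, w y = (fun=> 0) y by near: y; exact: nn.
  have := near_eq_derive (delta_mx 0 i) ny.
  by rewrite derive_cst (@derive_val _ _ _ _ _ _ _ dy).
have Z h : \near x, (0 : R) = w x * h x.
  by near=> y; rewrite (_ : w y = 0) ?mul0r //; near: y.
have Z' i : \near x, (0 : R) = dw i x * f x + w x * g i x.
  near=> y; rewrite (_ : w y = 0); last by near: y.
  by rewrite (_ : dw i y = 0) ?mul0r ?addr0 //; near: y; exact: ndw.
split; first by apply: continuous_near_eq (Z f) _; exact: cst_continuous.
move=> i; split; last by apply: continuous_near_eq (Z' i) _; exact: cst_continuous.
apply: near_eq_is_derive (Z f) _.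
rewrite -(nbhs_singleton (Z' i)); exact: is_derive_cst.
Unshelve. all: by end_near. Qed.

Lemma C1_rho D : C1 D (fun x => dotp x x) (fun i x => 2 * x 0 i).
Proof.
rewrite /dotp.
refine (C1_eq (C1_sum (fun j => C1_mul (@C1_coord D j) (@C1_coord D j))) _ _) => // i x.
rewrite (bigD1 i) //= big1 => [|j ji].
  by rewrite !eqxx /=; ring.
by rewrite (negbTE (_ : i != j)) ?mulr0 ?mul0r ?addr0 // eq_sym.
Qed.

End C1.

(** * An integral for bounded functions with bounded support *)

Section Counting.
Variable R : realType.

Lemma count_le (M : nat) (lo hi : R) :
  \sum_(k < M) ((lo <= k%:R <= hi)%R : nat)%:R <= Num.max 0 (hi - lo + 1) :> R.
Proof.
elim: M hi => [|M IH] hi; first by rewrite big_ord0 le_max lexx.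
rewrite big_ord_recr /=.
have [/andP[loM Mhi]|] := boolP (lo <= M%:R <= hi); last by rewrite addr0 IH.
(* All earlier indices are at most M - 1, so the induction hypothesis is used with [hi] replaced by
   M - 1; the index M then adds 1 to M - lo, which stays below hi - lo + 1. *)
have : \sum_(k < M) ((lo <= k%:R <= hi)%R : nat)%:R <= Num.max 0 (M%:R - lo) :> R.
  apply: le_trans (_ : \sum_(k < M) ((lo <= k%:R <= (M%:R - 1 : R))%R : nat)%:R <= _).
    apply: ler_sum => k _; rewrite ler_nat.
    have kM : (k : nat)%:R <= M%:R - 1 :> R by rewrite lerBrDr natr1 ler_nat ltn_ord.
    by rewrite kM andbT; case: (lo <= _); case: (_ <= hi).
  by apply: le_trans (IH _) _; rewrite addrAC subrK.
rewrite (max_idPr _) ?subr_ge0 // => H.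
rewrite le_max; apply/orP; right; rewrite /=; lra.
Qed.

Lemma count_ge (M : nat) (lo hi : R) : 0 <= lo ->
  Num.min hi M%:R - lo - 1 <= \sum_(k < M) ((lo <= k%:R <= hi)%R : nat)%:R :> R.
Proof.
move=> lo0; elim: M => [|M IH].
  rewrite big_ord0; have : Num.min hi 0%:R <= 0 :> R by rewrite ge_min lexx orbT.
  lra.
rewrite big_ord_recr /=.
have [hM|Mh] := lerP hi M%:R.
  have E : Num.min hi M.+1%:R = Num.min hi M%:R.
    rewrite !min_l //; apply: le_trans hM _; by rewrite ler_nat.
  by rewrite E; apply: le_trans IH _; rewrite lerDl ler0n.
move: IH; rewrite (min_r (ltW Mh)) (ltW Mh) andbT.
have mM : Num.min hi M.+1%:R <= M%:R + 1 :> R by rewrite natr1 ge_min lexx orbT.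
case: (lerP lo M%:R) => [l|l] IH /=; first by lra.
apply: le_trans (_ : 0 <= _); first by lra.
by rewrite addr0; apply: sumr_ge0.
Qed.

End Counting.

(** * Grid sums and their limit along an ultrafilter *)

Section Grid.
Variables (R : realType) (n : nat).
Notation V := 'rV[R]_n.
Implicit Types (f g : V -> R) (a t x : V).

(** One constant bounds both the values and the coordinates of the support; boxes rather than balls,
    because grid sums over boxes factor over the coordinates. *)
Definition bsupp f := exists K : R, forall x,
  `|f x| <= K /\ forall i, K <= `|x 0 i| -> f x = 0.

Definition box a (r : R) x : R :=
  \prod_(i < n) ((`|x 0 i - a 0 i| <= r)%R : nat)%:R.

(** The grid has mesh 1/(m+1) and fills the cube of half-side m+1. The indices of a coordinate run
    from 0 to [gsize m] and are read as a cyclic group when the grid is translated. *)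
Definition gsize (m : nat) : nat := (2 * m.+1 ^ 2)%N.
Definition gpos (m k : nat) : R := k%:R / m.+1%:R - m.+1%:R.
Definition gpt (m : nat) (z : {ffun 'I_n -> 'I_(gsize m).+1}) : V :=
  \row_i gpos m (z i).
Definition gsum (m : nat) f : R :=
  (m.+1%:R ^+ n)^-1 * \sum_(z : {ffun 'I_n -> 'I_(gsize m).+1}) f (gpt z).

Lemma gsizeE m : (gsize m)%:R = 2 * m.+1%:R * m.+1%:R :> R.
Proof. by rewrite /gsize natrM natrX expr2 mulrA. Qed.

Lemma box_ge0 a r x : 0 <= box a r x.
Proof. by apply: prodr_ge0. Qed.

Lemma box_le1 a r x : box a r x <= 1.
Proof.
rewrite /box -[leRHS](_ : \prod_(i < n) 1 = 1); last by rewrite big1.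
by apply: ler_prod => i _; rewrite ler0n lern1 leq_b1.
Qed.

Lemma box_in a r x : (forall i, `|x 0 i - a 0 i| <= r) -> box a r x = 1.
Proof. by move=> H; rewrite /box big1 // => i _; rewrite H. Qed.

Lemma box_out a r x i : r < `|x 0 i - a 0 i| -> box a r x = 0.
Proof. by move=> H; rewrite /box (bigD1 i) //= leNgt H /= mul0r. Qed.

Lemma box_bsupp a r : bsupp (box a r).
Proof.
exists (1 + \sum_i `|a 0 i| + `|r|) => x.
have S0 : 0 <= \sum_i `|a 0 i| by apply: sumr_ge0.
split.
  rewrite ger0_norm ?box_ge0 //; apply: le_trans (box_le1 _ _ _) _.
  by rewrite -addrA lerDl addr_ge0.
move=> i H; apply: (@box_out _ _ _ i).
have Ha : `|a 0 i| <= \sum_i `|a 0 i|.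
  by rewrite (bigD1 i) //= lerDl sumr_ge0.
have := ler_normD (x 0 i - a 0 i) (a 0 i); rewrite subrK.
have := ler_norm r; lra.
Qed.

Lemma bsupp_box f : bsupp f -> exists2 K, 0 < K & forall x, `|f x| <= K * box 0 K x.
Proof.
case=> K H; exists (`|K| + 1); first by rewrite ltr_wpDl.
move=> x; have [fK f0] := H x.
have [[i Hi]|nH] := pselect (exists i, `|K| + 1 < `|x 0 i|).
  rewrite (f0 i) ?normr0 ?mulr_ge0 ?box_ge0 ?addr_ge0 //.
  by apply: le_trans (ltW Hi); have := ler_norm K; lra.
rewrite box_in ?mulr1; first by have := ler_norm K; lra.
move=> i; rewrite mxE subr0 leNgt; apply/negP => h; apply: nH; by exists i.
Qed.

(** The indicator of a box is a product over the coordinates, so the sum over the grid is a product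
    of one-dimensional counts. *)
Lemma gsum_box m a r :
  gsum m (box a r) = \prod_(i < n) (m.+1%:R^-1 *
    \sum_(k < (gsize m).+1) (((a 0 i - r + m.+1%:R) * m.+1%:R <= k%:R
       <= (a 0 i + r + m.+1%:R) * m.+1%:R)%R : nat)%:R).
Proof.
have m0 : 0 < m.+1%:R :> R by [].
rewrite big_split /= prodr_const card_ord exprVn /gsum; congr (_ * _).
rewrite bigA_distr_bigA /=; apply: eq_bigr => z _; apply: eq_bigr => i _.
rewrite mxE /gpos; congr (_ : bool)%:R.
rewrite ler_distl -(ler_pdivlMr _ _ m0) -(ler_pdivrMr _ _ m0).
by rewrite lerBrDr lerBlDr.
Qed.

Lemma gsum_box_le m a r : 0 <= r -> gsum m (box a r) <= (2 * r + m.+1%:R^-1) ^+ n.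
Proof.
move=> r0; have m0 : 0 < m.+1%:R :> R by [].
rewrite gsum_box -[in leRHS](card_ord n) -prodr_const; apply: ler_prod => i _.
rewrite mulr_ge0 ?sumr_ge0 //= mulrC ler_pdivrMr //.
apply: le_trans (count_le _ _ _) _.
have -> : (2 * r + m.+1%:R^-1) * m.+1%:R = 2 * r * m.+1%:R + 1.
  by rewrite mulrDl mulVf ?lt0r_neq0.
rewrite ge_max; apply/andP; split; first by rewrite addr_ge0 // !mulr_ge0.
by rewrite [leLHS](_ : _ = 2 * r * m.+1%:R + 1) //; ring.
Qed.

Lemma gsum_box_ge m a r : 0 < r -> m.+1%:R^-1 <= r ->
  (forall i, `|a 0 i| + r <= m.+1%:R) -> r ^+ n <= gsum m (box a r).
Proof.
move=> r0 mr am; have m0 : 0 < m.+1%:R :> R by [].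
rewrite gsum_box -[in leLHS](card_ord n) -prodr_const; apply: ler_prod => i _.
rewrite (ltW r0) /= mulrC ler_pdivlMr //.
have h1 := ler_norm (a 0 i); have h2 := ler_norm (- a 0 i); rewrite normrN in h2.
have h3 := am i.
have lo0 : 0 <= (a 0 i - r + m.+1%:R) * m.+1%:R.
  by apply: mulr_ge0 => //; lra.
apply: le_trans (count_ge _ _ lo0).
rewrite min_l; last first.
  apply: le_trans (_ : (gsize m)%:R <= _); last by rewrite ler_nat.
  by rewrite gsizeE ler_wpM2r //; lra.
rewrite -mulrBl.
(* The count is at least 2 r (m+1) - 1, and the lost 1 is at most r (m+1). *)
have : 1 <= r * m.+1%:R by rewrite -ler_pdivrMr // div1r.
nra.
Qed.

Lemma gsum_linear m c f g :
  gsum m (fun x => c * f x + g x) = c * gsum m f + gsum m g.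
Proof.
by rewrite /gsum big_split /= -mulr_sumr mulrDr mulrCA.
Qed.

Lemma gsum_le m f g : (forall x, f x <= g x) -> gsum m f <= gsum m g.
Proof.
move=> H; rewrite /gsum ler_wpM2l ?invr_ge0 ?exprn_ge0 //.
by apply: ler_sum.
Qed.

Lemma gsum_norm m f g : (forall x, `|f x| <= g x) -> `|gsum m f| <= gsum m g.
Proof.
move=> H; rewrite ler_norml; apply/andP; split; last first.
  by apply: gsum_le => x; apply: le_trans (ler_norm _) (H x).
rewrite -[leLHS]addr0 -mulN1r.
have -> : (0:R) = gsum m (fun=> 0) by rewrite /gsum big1 ?mulr0.
rewrite -gsum_linear; apply: gsum_le => x.
by rewrite mulN1r addr0 lerNl; apply: le_trans (H x); rewrite -normrN ler_norm.
Qed.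

Lemma gsum_bounded f : bsupp f -> exists K, forall m, `|gsum m f| <= K.
Proof.
move=> /bsupp_box[K K0 H].
exists (K * (2 * K + 1) ^+ n) => m.
apply: le_trans (gsum_norm m H) _.
have -> : (fun x => K * box 0 K x) = (fun x => K * box 0 K x + (fun=> 0) x).
  by apply/funext => x; rewrite addr0.
rewrite gsum_linear [gsum m (fun=> 0)](_ : _ = 0) ?addr0; last first.
  by rewrite /gsum big1 ?mulr0.
rewrite ler_wpM2l ?(ltW K0) //; apply: le_trans (gsum_box_le _ _ (ltW K0)) _.
apply: lerXn2r; rewrite ?nnegrE ?addr_ge0 ?mulr_ge0 ?invr_ge0 ?(ltW K0) //.
by rewrite lerD2l invf_le1 // ler1n.
Qed.

(** Adding a fixed index is a bijection of the cyclic index group. Where it wraps around, both the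
    translated point and the wrapped grid point lie outside the support of [f], so there is no
    boundary term. *)
Lemma gsum_shift m f (K : R) (k : 'I_n -> nat) :
  (forall x i, K <= `|x 0 i| -> f x = 0) ->
  (forall i, K + (k i)%:R / m.+1%:R < m.+1%:R) ->
  (forall i, (k i <= gsize m)%N) -> 0 <= K ->
  gsum m (fun x => f (x + \row_i ((k i)%:R / m.+1%:R))) = gsum m f.
Proof.
move=> f0 kK ks K0; have m0 : 0 < m.+1%:R :> R by [].
rewrite /gsum; congr (_ * _).
pose s : {ffun 'I_n -> 'I_(gsize m).+1} := [ffun i => inord (k i)].
rewrite [RHS](reindex_inj (@addIr _ s)) /=.
apply: eq_bigr => z _.
have [[i Hi]|nH] := pselect (exists i, (gsize m < z i + k i)%N).
  have gsE : (gsize m)%:R / m.+1%:R = m.+1%:R + m.+1%:R :> R.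
    rewrite /gsize natrM natrX expr2 -!mulrA mulfV ?lt0r_neq0 // mulr1.
    by rewrite mulr_natl mulr2n.
  have kge0 : 0 <= (k i)%:R / m.+1%:R :> R by rewrite divr_ge0.
  rewrite (f0 _ i) ?(f0 _ i) // !mxE.
    rewrite ler_normr; apply/orP; right.
    rewrite !ffunE /= inordK ?ltnS // /gpos.
    have E : ((z i + k i) %% (gsize m).+1 = z i + k i - (gsize m).+1)%N.
      rewrite -[in LHS](subnK Hi) modnDr modn_small //.
      by have := ltn_ord (z i); have := ks i; lia.
    rewrite E natrB // natrD mulrBl mulrDl.
    have zm : (z i)%:R / m.+1%:R <= m.+1%:R + m.+1%:R :> R.
      by rewrite -gsE ler_pM2r ?invr_gt0 // ler_nat -ltnS.
    have : (gsize m).+1%:R / m.+1%:R >= m.+1%:R + m.+1%:R :> R.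
      by rewrite -gsE ler_pM2r ?invr_gt0 // ler_nat.
    have aux (A B G M K' : R) : K' + B < M -> A <= M + M -> M + M <= G ->
      K' <= - (A + B - G - M) by lra.
    exact: (aux _ _ _ _ _ (kK i) zm).
  rewrite ler_normr; apply/orP; left; rewrite /gpos.
  have : (gsize m)%:R / m.+1%:R <= (z i + k i)%:R / m.+1%:R :> R.
    by rewrite ler_pM2r ?invr_gt0 // ler_nat ltnW.
  rewrite gsE natrD mulrDl.
  have aux (A B M K' : R) : K' + B < M -> 0 <= B -> M + M <= A + B ->
    K' <= A - M + B by lra.
  exact: (aux _ _ _ _ (kK i) kge0).
congr f; apply/rowP => i; rewrite !mxE !ffunE /= inordK ?ltnS // modn_small.
  by rewrite /gpos natrD mulrDl addrAC.
by rewrite ltnS leqNgt; apply/negP => h; apply: nH; exists i.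
Qed.

Lemma norm_leP (v : V) (d : R) : 0 <= d -> reflect (forall i, `|v 0 i| <= d) (`|v| <= d).
Proof.
move=> d0; rewrite [`|v|]mx_normrE; apply: (iffP idP) => [H i|H].
  by apply: le_trans H; rewrite (le_bigmax _ (fun i => `|v i.1 i.2|) (0, i)).
by apply/bigmax_leP; split => // -[j i] _ /=; rewrite ord1.
Qed.

(** Compactness gives uniformity on a cube one unit larger than the support; outside this cube both
    values vanish as soon as the displacement is at most 1. *)
Lemma bsupp_unif_continuous f : bsupp f -> continuous f ->
  forall e : R, 0 < e -> exists2 d : R, 0 < d &
    forall x v : V, (forall i, `|v 0 i| <= d) -> `|f (x + v) - f x| <= e.
Proof.
move=> [K0 H] cf e e0.
pose K := `|K0|; have f0 x i : K <= `|x 0 i| -> f x = 0.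
  by move=> h; apply: (H x).2; apply: le_trans h; exact: ler_norm.
pose B := [set x : V | `|x| <= K + 1].
have cB : compact B.
  apply: bounded_closed_compact.
    by exists (K + 1); split; [exact: num_real|move=> M /ltW h x /= /le_trans]; apply.
  have -> : B = (fun x : V => `|x|) @^-1` [set y | y <= K + 1] by [].
  by apply: closed_comp; [move=> ? _; exact: norm_continuous|exact: closed_le].
have /compact_near_coveringP cov := cB.
have := cov V (nbhs (0 : V)) (fun v x => `|f (x + v) - f x| <= e) _.
case.
  move=> x _.
  have c1 : (fun p : V * V => f (p.1 + p.2) - f p.1) @ (x, 0 : V) --> f (x + 0) - f x.
    apply: cvgB; last by apply: (cvg_comp _ _ cvg_fst); exact: cf.
    have : (fun p : V * V => p.1 + p.2) @ (x, 0 : V) --> x + 0.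
      by apply: cvgD; [exact: cvg_fst|exact: cvg_snd].
    by move/(cvg_comp _ f); apply; exact: cf.
  move: c1; rewrite addr0 subrr => /cvgr0Pnorm_le /(_ _ e0).
  by case=> -[P Q] [/= P1 Q1] PQ; exists (P, Q).
move=> A A0 AP.
have /nbhs_normP[d /= d0 dP] : nbhs (0 : V) (fun v => B `<=` (fun x => `|f (x + v) - f x| <= e)).
  by exists A.
exists (Num.min (d / 2) 1); first by rewrite lt_min divr_gt0 //=.
move=> x v hv.

have nv : `|v| < d.
  have d2 : 0 < d / 2 by rewrite divr_gt0.
  apply: le_lt_trans (_ : `|v| <= d / 2) _; last by lra.
  apply/norm_leP; first exact: ltW.
  by move=> i; apply: le_trans (hv i) _; rewrite ge_min lexx.
have [xB|xB] := pselect (B x); first by apply: dP xB; rewrite /ball_ /= sub0r normrN.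
have /existsNP[i] : ~ forall i, `|x 0 i| <= K + 1.
  by move=> h; apply: xB; apply/norm_leP; first exact: addr_ge0 (normr_ge0 K0) ler01.
move=> /negP; rewrite -ltNge => xi.
have vi : `|v 0 i| <= 1 by apply: le_trans (hv i) _; rewrite ge_min lexx orbT.
rewrite (f0 _ i) ?(f0 x i) ?subrr ?normr0 ?(ltW e0) //; first by lra.
have := ler_normD (x 0 i + v 0 i) (- v 0 i); rewrite addrK normrN mxE; lra.
Qed.

(** The vector [t] is rounded down to a multiple of the mesh, for which the sum is exactly
    invariant, and uniform continuity pays for the rounding. Grid shifts are by natural numbers,
    hence the sign condition on [t]. *)
Lemma gsum_translation f (t : V) : bsupp f -> continuous f -> (forall i, 0 <= t 0 i) ->
  forall e : R, 0 < e -> \forall m \near \oo,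
    `|gsum m (fun x => f (x + t)) - gsum m f| <= e.
Proof.
move=> bf cf t0 e e0.
have [K1 H] := bf.
pose T := \sum_i t 0 i; have T0 : 0 <= T by apply: sumr_ge0.
have tT i : t 0 i <= T by rewrite /T (bigD1 i) //= lerDl sumr_ge0.
have [K K0 f0] : exists2 K : R, 0 < K & forall x i, K <= `|x 0 i| -> f x = 0.
  exists (`|K1| + 1); first by rewrite ltr_wpDl.
  by move=> x i h; apply: (H x).2; apply: le_trans h; have := ler_norm K1; lra.
(* Both translates of [f] vanish outside the box of half-side [L], whose grid volume is at most [c];
   a pointwise accuracy of [e / c] is therefore enough. *)
pose L := K + T + 1; have L0 : 0 < L by rewrite /L; lra.
pose c := (2 * L + 1) ^+ n; have c0 : 0 < c by rewrite exprn_gt0 //; lra.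
have [d d0 Hd] := bsupp_unif_continuous bf cf (divr_gt0 e0 c0).
near=> m.
have m0 : 0 < m.+1%:R :> R by [].
have md : m.+1%:R^-1 <= d.
  rewrite -[leRHS]invrK lef_pV2 ?posrE ?invr_gt0 //.
  by apply: le_trans (_ : m%:R <= _); [near: m; exact: nbhs_infty_ger|rewrite ler_nat].
have mL : L <= m.+1%:R.
  by apply: le_trans (_ : m%:R <= _); [near: m; exact: nbhs_infty_ger|rewrite ler_nat].
pose k i := Num.truncn (t 0 i * m.+1%:R).
have kP i : (k i)%:R / m.+1%:R <= t 0 i < (k i)%:R / m.+1%:R + m.+1%:R^-1.
  have := @truncn_itv _ (t 0 i * m.+1%:R); rewrite mulr_ge0 // => /(_ isT)/andP[k1 k2].
  by rewrite ler_pdivrMr // k1 -[X in _ + X]div1r -mulrDl natr1 ltr_pdivlMr.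
pose s : V := \row_i ((k i)%:R / m.+1%:R).
have sT i : (k i)%:R / m.+1%:R <= T by have /andP[h _] := kP i; exact: le_trans h (tT i).
rewrite -(gsum_shift (k := k) f0 _ _ (ltW K0)).
- rewrite -mulN1r addrC -gsum_linear.
  apply: le_trans (gsum_norm (g := fun x => e / c * box 0 L x + (fun=> 0) x) _ _) _.
    move=> x; rewrite addr0 mulN1r addrC.
    have [[i Hi]|nH] := pselect (exists i, L < `|x 0 i|).
      have tri (a : R) : 0 <= a -> a <= T -> K <= `|x 0 i + a|.
        move=> a0 aT; have := ler_normD (x 0 i + a) (- a).
        by rewrite addrK normrN (ger0_norm a0); rewrite /L in Hi; lra.
      have Z1 : f (x + s) = 0 by apply: (f0 _ i); rewrite !mxE tri ?divr_ge0.
      have Z2 : f (x + t) = 0 by apply: (f0 _ i); rewrite mxE tri.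
      by rewrite Z2 Z1 subrr normr0 mulr_ge0 ?box_ge0 ?(ltW (divr_gt0 e0 c0)).
    rewrite box_in ?mulr1; last first.
      by move=> i; rewrite mxE subr0 leNgt; apply/negP => h; apply: nH; exists i.
    have -> : x + t = (x + s) + (t - s) by rewrite -addrA [s + _]addrC subrK.
    apply: Hd => i; rewrite !mxE /=; have /andP[h1 h2] := kP i.
    by rewrite ger0_norm ?subr_ge0 //; apply: le_trans md; rewrite lerBlDl ltW.
  rewrite gsum_linear [gsum m (fun=> 0)](_ : _ = 0) ?addr0; last first.
    by rewrite /gsum big1 ?mulr0.
  rewrite mulrAC ler_pdivrMr // ler_wpM2l ?(ltW e0) //.
  apply: le_trans (gsum_box_le _ _ (ltW L0)) _.
  apply: lerXn2r; rewrite ?nnegrE ?addr_ge0 ?mulr_ge0 ?invr_ge0 ?(ltW L0) //.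
  by rewrite lerD2l invf_le1 // ler1n.
- by move=> i; apply: lt_le_trans mL; rewrite /L; move: (sT i); move: (_ / _) => y; lra.
- move=> i; rewrite -(ler_nat R) gsizeE -ler_pdivrMr //.
  have TL : T <= L by rewrite /L; lra.
  apply: le_trans (sT i) _; apply: le_trans TL _; apply: le_trans mL _.
  by rewrite ler_peMl // ler1n.
Unshelve. all: by end_near. Qed.

(* A finitely additive stand-in for the Lebesgue integral, defined on all
   bounded functions with bounded support; as the last four properties are all
   that is used, no measurability ever has to be checked. *)
Definition integral_like (I : (V -> R) -> R) :=
  [/\ forall c f g, bsupp f -> bsupp g ->
        I (fun x => c * f x + g x) = c * I f + I g,
      forall f g, bsupp f -> bsupp g -> (forall x, f x <= g x) -> I f <= I g,
      forall a r, 0 < r -> r ^+ n <= I (box a r) <= (3 * r) ^+ n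
    & forall f t, bsupp f -> continuous f -> I (fun x => f (x + t)) = I f].

Lemma ultrafilter_bounded_cvg (F : set_system nat) (u : nat -> R) (K : R) :
  UltraFilter F -> (forall m, `|u m| <= K) -> exists l : R, u @ F --> l.
Proof.
move=> FF uK.
have cB : compact `[- K, K] by exact: segment_compact.
have [l [_ cl]] : `[- K, K]%classic `&` cluster (u @ F) !=set0.
  apply: (cB (u @ F) (fmap_proper_filter u (@ultra_proper _ F FF))).
  apply: (@filterE _ F) => m /=; by rewrite in_itv /= -ler_norml.
exists l => A Al.
have [//|nA] := in_ultra_setVsetC (u @^-1` A) FF.
have nA' : (u @ F) (~` A) by [].
by have [y [/(_ _)]] := cl _ _ nA' Al.
Qed.

(** Along an ultrafilter finer than [\oo] every bounded sequence converges, so the grid sums of each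
    bounded function with bounded support have a limit. Linearity, monotonicity and whatever holds
    for all large [m] pass to it. *)
Lemma exists_integral_like : exists I, integral_like I.
Proof.
have [F [FF sF]] : exists F : set_system nat, UltraFilter F /\ \oo `<=` F.
  exact: ultraFilterLemma.
have cI f : bsupp f -> gsum ^~ f @ F --> lim (gsum ^~ f @ F).
  move=> /gsum_bounded[K H].
  by have [l Hl] := ultrafilter_bounded_cvg FF H; apply/cvg_ex; exists l.
have bscale c f g : bsupp f -> bsupp g -> bsupp (fun x => c * f x + g x).
  move=> [K H] [L G]; exists (`|c| * `|K| + `|K| + `|L|) => x; split.
    apply: le_trans (ler_normD _ _) _; rewrite normrM lerD //; last first.
      by apply: le_trans (G x).1 (ler_norm _).
    rewrite ler_wpDr // ler_wpM2l //; exact: le_trans (H x).1 (ler_norm _).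
  have cK : 0 <= `|c| * `|K| by rewrite mulr_ge0.
  have := ler_norm K; have := ler_norm L; have := normr_ge0 K; have := normr_ge0 L.
  move=> l1 l2 l3 l4 i h.
  by rewrite ((H x).2 i) ?((G x).2 i) ?mulr0 ?addr0 //; lra.
have btrans t f : bsupp f -> bsupp (fun x => f (x + t)).
  move=> [K H]; exists (`|K| + \sum_i `|t 0 i|) => x; split.
    apply: le_trans (H _).1 _; rewrite ler_wpDr ?ler_norm //.
    by apply: sumr_ge0.
  move=> i h; apply: ((H _).2 i); rewrite mxE.
  have := ler_normD (x 0 i + t 0 i) (- t 0 i); rewrite addrK normrN.
  have : `|t 0 i| <= \sum_i `|t 0 i| by rewrite (bigD1 i) //= lerDl sumr_ge0.
  have := ler_norm K; lra.
exists (fun f => lim (gsum ^~ f @ F)); split.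
- move=> c f g bf bg; apply: cvg_lim => //.
  rewrite (_ : gsum ^~ _ = fun m => c * gsum m f + gsum m g); last first.
    by apply/funext => m; rewrite gsum_linear.
  by apply: cvgD (cI _ bg); apply: cvgMr; exact: cI.
- move=> f g bf bg fg; apply: ler_cvg_to (cI _ bf) (cI _ bg) _.
  by apply: filterE => m; exact: gsum_le.
- move=> a r r0; apply/andP; split.
    apply: limr_ge; first by apply/cvg_ex; eexists; exact: cI (box_bsupp a r).
    apply: sF; near=> m; apply: gsum_box_ge => //.
      rewrite -[leRHS]invrK lef_pV2 ?posrE ?invr_gt0 //.
      by apply: le_trans (_ : m%:R <= _); [near: m; exact: nbhs_infty_ger|rewrite ler_nat].
    move=> i; apply: le_trans (_ : \sum_i `|a 0 i| + r <= _).
      by rewrite lerD2r (bigD1 i) //= lerDl sumr_ge0.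
    by apply: le_trans (_ : m%:R <= _); [near: m; exact: nbhs_infty_ger|rewrite ler_nat].
  apply: limr_le; first by apply/cvg_ex; eexists; exact: cI (box_bsupp a r).
  apply: sF; near=> m; apply: le_trans (gsum_box_le _ _ (ltW r0)) _.
  apply: lerXn2r; rewrite ?nnegrE ?addr_ge0 ?mulr_ge0 ?invr_ge0 ?(ltW r0) //.
  suff : m.+1%:R^-1 <= r by move: (_^-1) => y; lra.
  rewrite -[leRHS]invrK lef_pV2 ?posrE ?invr_gt0 //.
  by apply: le_trans (_ : m%:R <= _); [near: m; exact: nbhs_infty_ger|rewrite ler_nat].
- have pos f (t : V) : bsupp f -> continuous f -> (forall i, 0 <= t 0 i) ->
      lim (gsum ^~ (fun x => f (x + t)) @ F) = lim (gsum ^~ f @ F).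
    move=> bf cf t0; apply/eqP; rewrite -subr_eq0 -normr_le0; apply/ler_addgt0Pr => e e0.
    rewrite add0r.
    have c1 : (fun m => `|gsum m (fun x => f (x + t)) - gsum m f|) @ F -->
      `|lim (gsum ^~ (fun x => f (x + t)) @ F) - lim (gsum ^~ f @ F)|.
      by apply: cvg_norm; apply: cvgB; [exact: cI (btrans t f bf)|exact: cI].
    apply: (ler_cvg_to c1 (cvg_cst e)).
    by apply: sF; exact: gsum_translation.
  move=> f t bf cf.
  (* Any [t] equals [tp - tm] with both vectors nonnegative; invariance under [tp] and under [tm]
     gives invariance under [t]. *)
  pose tp : V := \row_i Num.max (t 0 i) 0; pose tm : V := \row_i Num.max (- t 0 i) 0.
  have E : t + tm = tp.
    by apply/rowP => i; rewrite !mxE; case: (lerP (t 0 i) 0); case: (lerP (- t 0 i) 0); lra.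
  have ct (s : V) : continuous (fun x => f (x + s)).
    move=> x; apply: (@continuous_comp _ _ _ (fun x => x + s) f); last exact: cf.
    by apply: continuousD; [exact: cvg_id|exact: cst_continuous].
  rewrite -(pos f tp bf cf); last by move=> i; rewrite mxE le_max lexx orbT.
  rewrite -[LHS](pos _ tm (btrans t f bf) (ct t)); last first.
    by move=> i; rewrite mxE le_max lexx orbT.
  congr (lim (_ @ F)); apply/funext => m; congr gsum; apply/funext => x.
  by rewrite -E -!addrA [tm + t]addrC.
Unshelve. all: by end_near. Qed.

End Grid.

(** * Integration by parts and rescaling *)

Section BoundedSupport.
Variables (R : realType) (n : nat).
Notation V := 'rV[R]_n.
Implicit Types (f g : V -> R) (a t x : V).

Lemma bsupp_ext f g : (forall x, f x = g x) -> bsupp f -> bsupp g.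
Proof. by move=> /funext ->. Qed.

Lemma bsupp_scale_add c f g : bsupp f -> bsupp g -> bsupp (fun x => c * f x + g x).
Proof.
move=> [K H] [L G]; exists (`|c| * `|K| + `|K| + `|L|) => x; split.
  apply: le_trans (ler_normD _ _) _; rewrite normrM lerD //; last first.
    by apply: le_trans (G x).1 (ler_norm _).
  rewrite ler_wpDr // ler_wpM2l //; exact: le_trans (H x).1 (ler_norm _).
have cK : 0 <= `|c| * `|K| by rewrite mulr_ge0.
have := ler_norm K; have := ler_norm L; have := normr_ge0 K; have := normr_ge0 L.
move=> l1 l2 l3 l4 i h.
by rewrite ((H x).2 i) ?((G x).2 i) ?mulr0 ?addr0 //; lra.
Qed.

Lemma bsupp0 : bsupp (fun _ : V => 0).
Proof. by exists 0 => x; rewrite normr0. Qed.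

Lemma bsupp_scale c f : bsupp f -> bsupp (fun x => c * f x).
Proof.
by move=> bf; apply: bsupp_ext (bsupp_scale_add c bf bsupp0) => x; rewrite addr0.
Qed.

Lemma bsupp_add f g : bsupp f -> bsupp g -> bsupp (fun x => f x + g x).
Proof.
by move=> bf bg; apply: bsupp_ext (bsupp_scale_add 1 bf bg) => x; rewrite mul1r.
Qed.

Lemma bsupp_sum (J : finType) (f : J -> V -> R) :
  (forall j, bsupp (f j)) -> bsupp (fun x => \sum_j f j x).
Proof.
move=> bf; apply: (@bsupp_ext (fun x => \sum_(j <- enum J) f j x)).
  by move=> x; rewrite big_enum.
elim: (enum J) => [|j s IH].
  by apply: (bsupp_ext _ bsupp0) => x; rewrite big_nil.
by apply: (bsupp_ext _ (bsupp_add (bf j) IH)) => x; rewrite big_cons.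
Qed.

Lemma bsupp_dominated f g (c : R) : bsupp f -> (forall x, `|g x| <= c * `|f x|) -> bsupp g.
Proof.
move=> [K H] G; exists (`|K| + `|c| * `|K|) => x; split.
  apply: le_trans (G x) _; apply: le_trans (_ : `|c| * `|K| <= _); last by rewrite lerDr.
  apply: le_trans (ler_wpM2r (normr_ge0 _) (ler_norm c)) _.
  rewrite ler_wpM2l //; exact: le_trans (H x).1 (ler_norm _).
move=> i h; apply/eqP; rewrite -normr_le0; apply: le_trans (G x) _.
rewrite ((H x).2 i) ?normr0 ?mulr0 //.
by apply: le_trans h; apply: le_trans (ler_norm K) _; rewrite lerDl mulr_ge0.
Qed.

Lemma bsupp_trans t f : bsupp f -> bsupp (fun x => f (x + t)).
Proof.
move=> [K H]; exists (`|K| + \sum_i `|t 0 i|) => x; split.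
  apply: le_trans (H _).1 _; rewrite ler_wpDr ?ler_norm //.
  by apply: sumr_ge0.
move=> i h; apply: ((H _).2 i); rewrite mxE.
have := ler_normD (x 0 i + t 0 i) (- t 0 i); rewrite addrK normrN.
have : `|t 0 i| <= \sum_i `|t 0 i| by rewrite (bigD1 i) //= lerDl sumr_ge0.
have := ler_norm K; lra.
Qed.

Lemma bsupp_affine t (c : R) f : 0 < c -> bsupp f -> bsupp (fun x => f (t + c *: x)).
Proof.
move=> c0 [K H]; pose S := (`|K| + \sum_i `|t 0 i|).
have S0 : 0 <= S by rewrite addr_ge0 // sumr_ge0.
exists (S + c^-1 * S) => x; split.
  apply: le_trans (H _).1 _; apply: le_trans (ler_norm _) _.
  rewrite ler_wpDr ?mulr_ge0 ?invr_ge0 ?(ltW c0) //.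
  by rewrite lerDl sumr_ge0.
move=> i h; apply: ((H _).2 i); rewrite !mxE.
have h1 : c^-1 * S <= `|x 0 i| by apply: le_trans h; rewrite lerDr.
have h2 : S <= `|c * x 0 i| by rewrite normrM (gtr0_norm c0) -ler_pdivrMl.
have := ler_normD (t 0 i + c * x 0 i) (- t 0 i); rewrite addrAC subrr add0r normrN.
have : `|t 0 i| <= \sum_i `|t 0 i| by rewrite (bigD1 i) //= lerDl sumr_ge0.
have := ler_norm K; move: h2; rewrite /S; lra.
Qed.

Lemma continuous_bsupp f (K : R) : continuous f ->
  (forall x i, K <= `|x 0 i| -> f x = 0) -> bsupp f.
Proof.
move=> cf f0.
pose B := [set x : V | `|x| <= `|K|].
have cB : compact B.
  apply: bounded_closed_compact.
    by exists `|K|; split; [exact: num_real|move=> M /ltW h x /= /le_trans]; apply.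
  have -> : B = (fun x : V => `|x|) @^-1` [set y | y <= `|K|] by [].
  by apply: closed_comp; [move=> ? _; exact: norm_continuous|exact: closed_le].
have [M [_ HM]] : bounded_set (f @` B).
  apply: compact_bounded; apply: continuous_compact cB.
  exact: continuous_subspaceT.
exists (`|K| + `|M| + 1) => x; split.
  have [xB|xB] := pselect (B x).
    have := HM (`|M| + 1); rewrite ltr_pwDr ?ler_norm // => /(_ isT (f x)).
    move=> /(_ (ex_intro2 _ _ x xB erefl)) /= h; apply: le_trans h _.
    by rewrite -addrA lerDr.
  have /existsNP[i] : ~ forall i, `|x 0 i| <= `|K|.
    by move=> h; apply: xB; apply/norm_leP.
  move=> /negP; rewrite -ltNge => xi.
  rewrite (f0 _ i) ?normr0 ?addr_ge0 ?normr_ge0 //.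
  exact: le_trans (ler_norm _) (ltW xi).
move=> i h; apply: (f0 _ i); apply: le_trans h.
have := ler_norm K; have := normr_ge0 M; lra.
Qed.

Lemma near_coord_gt (K : R) x j : K < `|x 0 j| -> \forall y \near x, K < `|(y : V) 0 j|.
Proof.
move=> h; have c : {for x, continuous (fun y : V => `|y 0 j|)}.
  by apply: continuous_comp; [exact: coord_continuous|exact: norm_continuous].
exact: cvgr_gt c _ h.
Qed.

Lemma C1_der_out f (g : 'I_n -> V -> R) i (K : R) x j : C1 setT f g ->
  (forall x i, K <= `|x 0 i| -> f x = 0) -> K < `|x 0 j| -> g i x = 0.
Proof.
move=> Cf f0 h; have D := C1_der i Cf (I : setT x).
have n0 : \near x, f x = (fun=> 0) x.
  by apply: filterS (near_coord_gt h) => y /ltW; exact: f0.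
have := near_eq_derive (delta_mx 0 i) n0.
by rewrite derive_cst (@derive_val _ _ _ _ _ _ _ D).
Qed.

Lemma C1_bsupp f (g : 'I_n -> V -> R) i : C1 setT f g -> bsupp f -> bsupp (g i).
Proof.
move=> Cf [K H]; apply: (@continuous_bsupp _ (K + 1)).
  by move=> x; exact: C1_dcont Cf I.
move=> x j h; apply: (C1_der_out i Cf (fun x => (H x).2) (j := j)).
by apply: lt_le_trans h; rewrite ltrDl.
Qed.

Lemma MVT_line D (f : V -> R) (g : 'I_n -> V -> R) x i (h : R) : 0 <= h -> C1 D f g ->
  (forall t : R, 0 <= t <= h -> D (x + t *: delta_mx 0 i)) ->
  exists2 t : R, 0 <= t <= h & f (x + h *: delta_mx 0 i) - f x = g i (x + t *: delta_mx 0 i) * h.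
Proof.
move=> h0 Cf sD.
have DL (t : R) : 0 <= t <= h -> is_derive t 1 (fun s => f (x + s *: delta_mx 0 i)) (g i (x + t *: delta_mx 0 i)).
  by move=> ht; apply: (is_derive_lineP _ _ _ _ _).1 (C1_der i Cf (sD t ht)).
have oc (t : R) : t \in `]0, h[ -> 0 <= t <= h by rewrite in_itv /= => /andP[/ltW -> /ltW ->].
have cc (t : R) : t \in `[0, h] -> 0 <= t <= h by rewrite in_itv.
have [t] := @MVT_segment _ (fun s => f (x + s *: delta_mx 0 i)) (fun s => g i (x + s *: delta_mx 0 i)) 0 h h0
  (fun (t : R) ht => DL t (oc t ht)) (derivable_within_continuous
  (fun (t : R) ht => @ex_derive _ _ _ _ _ _ _ (DL t (cc t ht)))).
rewrite in_itv /= subr0 scale0r addr0 => t1 t2.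
by exists t.
Qed.

End BoundedSupport.

Section Functional.
Variables (R : realType) (n : nat).
Notation V := 'rV[R]_n.
Implicit Types (f g : V -> R) (I J : (V -> R) -> R).

Lemma functional0 J : (forall c f g, bsupp f -> bsupp g ->
    J (fun x => c * f x + g x) = c * J f + J g) -> J (fun=> 0) = 0.
Proof.
move=> lin; have := lin (-1) _ _ (@bsupp0 R n) (@bsupp0 R n).
rewrite (_ : (fun=> _) = (fun=> 0)); last by apply/funext => x; rewrite mulr0 addr0.
by rewrite mulN1r addNr.
Qed.

Lemma functionalZ J : (forall c f g, bsupp f -> bsupp g ->
    J (fun x => c * f x + g x) = c * J f + J g) ->
  forall c f, bsupp f -> J (fun x => c * f x) = c * J f.
Proof.
move=> lin c f bf; rewrite -[RHS]addr0 -(functional0 lin) -lin //; last exact: bsupp0.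
by congr J; apply/funext => x; rewrite addr0.
Qed.

Lemma functional_norm_le J : (forall c f g, bsupp f -> bsupp g ->
    J (fun x => c * f x + g x) = c * J f + J g) ->
  (forall f g, bsupp f -> bsupp g -> (forall x, f x <= g x) -> J f <= J g) ->
  forall f g, bsupp f -> bsupp g -> (forall x, `|f x| <= g x) -> `|J f| <= J g.
Proof.
move=> lin mono f g bf bg H; rewrite ler_norml lerNl; apply/andP; split.
  rewrite -mulN1r -(functionalZ lin) //; apply: mono => //; first exact: bsupp_scale.
  by move=> x; rewrite mulN1r; apply: le_trans (H x); rewrite -normrN ler_norm.
by apply: mono => // x; exact: le_trans (ler_norm _) (H x).
Qed.

(** The properties used by the estimates on annuli; they survive dilations with one [A] for all
    scales. The box of half-side 2 contains the region 1 < |y|^2 < 4. *)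
Definition ibp_functional (A : R) J :=
  [/\ forall c f g, bsupp f -> bsupp g ->
        J (fun x => c * f x + g x) = c * J f + J g,
      forall f g, bsupp f -> bsupp g -> (forall x, f x <= g x) -> J f <= J g,
      forall i f (g : 'I_n -> V -> R), C1 setT f g -> bsupp f -> J (g i) = 0
    & J (box 0 2) <= A].

(** By translation invariance the difference quotients of [f] in direction [i] integrate to zero,
    and by the mean value theorem they converge uniformly to [g i], with supports in a fixed box. *)
Lemma integral_like_ibp I i f (g : 'I_n -> V -> R) : integral_like I -> C1 setT f g -> bsupp f ->
  I (g i) = 0.
Proof.
case=> lin mono vol trans Cf bf.
have bg := C1_bsupp i Cf bf.
have cg : continuous (g i) by move=> x; exact: C1_dcont Cf Logic.I.
have cf : continuous f by move=> x; exact: C1_cont Cf Logic.I.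
have [K H] := bf.
pose L := `|K| + 1.
apply/eqP; rewrite -normr_le0; apply/ler_addgt0Pr => e e0; rewrite add0r.
have c0 : 0 < (3 * (L + 1)) ^+ n :> R.
  by rewrite exprn_gt0 // mulr_gt0 // /L; have := normr_ge0 K; lra.
have [d d0 Hd] := bsupp_unif_continuous bg cg (divr_gt0 e0 c0).
pose h := Num.min d 1; have h0 : 0 < h by rewrite lt_min d0 ltr01.
pose t : V := h *: delta_mx 0 i.
have bt := bsupp_trans t bf.
have E : I (g i) = I (fun x => - h^-1 * (- 1 * f x + f (x + t)) + g i x).
  rewrite lin //; last exact: bsupp_scale_add.
  by rewrite lin // trans // mulN1r addNr mulr0 add0r.
have bD : bsupp (fun x => - h^-1 * (- 1 * f x + f (x + t)) + g i x).
  by apply: bsupp_scale_add => //; exact: bsupp_scale_add.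
pose e' := e / (3 * (L + 1)) ^+ n; have e'0 : 0 < e' by exact: divr_gt0.
have bb := @box_bsupp R n 0 (L + 1).
have bnd x : `|- h^-1 * (- 1 * f x + f (x + t)) + g i x| <= e' * box 0 (L + 1) x.
  have [[j Hj]|nH] := pselect (exists j, L + 1 < `|x 0 j|).
    have KL : K <= L by rewrite /L; have := ler_norm K; lra.
    have z1 : f x = 0 by apply: ((H x).2 j); lra.
    have z2 (s : R) : 0 <= s -> s <= 1 -> f (x + s *: delta_mx 0 i) = 0.
      move=> s0 s1; apply: ((H _).2 j); rewrite !mxE.
      have := ler_normD (x 0 j + s * (delta_mx 0 i : V) 0 j) (- (s * (delta_mx 0 i : V) 0 j)).
      rewrite addrK normrN !mxE eqxx /=.
      have : `|s * (j == i)%:R| <= 1.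
        by rewrite normrM (ger0_norm s0); case: (j == i); rewrite ?normr1 ?normr0 ?mulr1 ?mulr0.
      move: KL; lra.
    have z3 : g i x = 0.
      by apply: (C1_der_out i Cf (fun x => (H x).2) (j := j)); lra.
    have z4 : f (x + t) = 0 by apply: z2; [exact: ltW|rewrite ge_min lexx orbT].
    rewrite z1 z3 z4 (_ : _ + 0 = 0); last by ring.
    by rewrite normr0 mulr_ge0 ?box_ge0 ?ltW.
  rewrite box_in ?mulr1; last first.
    by move=> j; rewrite mxE subr0 leNgt; apply/negP => k; apply: nH; exists j.
  have [c /andP[c1 c2] Ec] := MVT_line (x := x) (i := i) (ltW h0) Cf (fun _ _ => Logic.I).
  have -> : - h^-1 * (- 1 * f x + f (x + t)) + g i x = - (g i (x + c *: delta_mx 0 i) - g i x).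
    rewrite mulN1r [- f x + _]addrC /t Ec mulNr [_ * h]mulrC mulrA mulVf ?lt0r_neq0 //.
    by rewrite mul1r opprB addrC.
  rewrite normrN; apply: Hd => j; rewrite !mxE eqxx /=.
  have ch : c <= d by apply: le_trans c2 _; rewrite ge_min lexx.
  rewrite normrM (ger0_norm c1).
  by case: (j == i); rewrite ?normr1 ?normr0 ?mulr1 ?mulr0 ?(ltW d0).
have L1 : 0 < L + 1 by rewrite /L; have := normr_ge0 K; lra.
rewrite E; apply: le_trans (functional_norm_le lin mono bD (bsupp_scale e' bb) bnd) _.
rewrite (functionalZ lin) // /e' mulrAC ler_pdivrMr // ler_wpM2l ?(ltW e0) //.
by have /andP[] := vol 0 (L + 1) L1.
Qed.

Definition rescaled I (q : V) (c : R) : (V -> R) -> R :=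
  fun f => c ^+ n * I (fun x => f (q + c *: x)).

(** The preimage of the box of half-side 2 has half-side 2/c, hence integral at most (6/c)^n, and
    the factor c^n leaves a bound free of the scale. *)
Lemma rescaled_ibp_functional I q c : 0 < c -> integral_like I ->
  ibp_functional (6 ^+ n) (rescaled I q c).
Proof.
move=> c0 HI; have [lin mono vol trans] := HI.
split.
- move=> d f g bf bg; rewrite /rescaled lin ?mulrDr; last 2 first.
  + exact: bsupp_affine.
  + exact: bsupp_affine.
  by rewrite mulrCA.
- move=> f g bf bg fg; rewrite /rescaled ler_wpM2l ?exprn_ge0 ?(ltW c0) //.
  by apply: mono => //; exact: bsupp_affine.
- move=> i f g Cf bf; rewrite /rescaled.
  have C2 : C1 setT _ _ := @C1_affine R n setT q c f g Cf.
  have b2 := bsupp_affine q c0 bf.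
  have := integral_like_ibp i HI C2 b2.
  have b3 : bsupp (fun x => g i (q + c *: x)) by apply: bsupp_affine => //; exact: C1_bsupp Cf bf.
  rewrite (functionalZ lin) //.
  move=> /eqP; rewrite mulf_eq0 (gt_eqF c0) /= => /eqP ->.
  by rewrite mulr0.
rewrite /rescaled.
have -> : (fun x => box 0 2 (q + c *: x)) = box (- (c^-1 *: q)) (2 / c).
  apply/funext => x; apply: eq_bigr => i _; congr (_ : bool)%:R.
  rewrite !mxE subr0 opprK ler_pdivlMr //.
  have -> : q 0 i + c * x 0 i = (x 0 i + c^-1 * q 0 i) * c.
    by rewrite mulrDl mulrAC mulVf ?lt0r_neq0 // mul1r [x 0 i * c]mulrC addrC.
  by rewrite normrM (gtr0_norm c0).
have /andP[_ h] := vol (- (c^-1 *: q)) (2 / c) (divr_gt0 (ltr0n _ 2) c0).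
apply: le_trans (ler_wpM2l (exprn_ge0 _ (ltW c0)) h) _.
rewrite -exprMn (_ : c * (3 * (2 / c)) = 6) //.
by rewrite mulrCA [c * _]mulrC divfK ?lt0r_neq0 //; ring.
Qed.

End Functional.

(** * Cutoff functions *)

Section Cutoff.
Variable R : realType.
Implicit Types (s t : R).

Definition pospart s : R := Num.max 0 s.

Lemma pospart_ge0 s : 0 <= pospart s.
Proof. by rewrite le_max lexx. Qed.

Lemma pospart_continuous : continuous pospart.
Proof.
by move=> s; apply: (@continuous_max _ _ (fun=> 0) id); [exact: cst_continuous|exact: cvg_id].
Qed.

(** At the corner the difference quotient is at most |h|^(k+1), which tends to 0 because the
    exponent is at least 2. *)
Lemma is_derive_pospartX k s :
  is_derive s 1 (fun t => pospart t ^+ k.+2) (k.+2%:R * pospart s ^+ k.+1).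
Proof.
have [s0|s0|<-] := ltgtP 0 s.
- apply: (@near_eq_is_derive _ _ _ (fun t : R => t ^+ k.+2)).
    near=> t; rewrite /pospart max_r //; apply/ltW; near: t; exact: lt_nbhsr.
  rewrite /pospart (max_r (ltW s0)).
  have := @is_deriveX _ _ id k.+2 s 1 1 (is_derive_id _ _); rewrite exprfctE.
  by rewrite [_ *: 1]mulr1.
- apply: (@near_eq_is_derive _ _ _ (fun t : R => 0)).
    near=> t; rewrite /pospart max_l ?expr0n //; apply/ltW; near: t; exact: lt_nbhsl.
  rewrite /pospart (max_l (ltW s0)) expr0n mulr0.
  exact: is_derive_cst.
rewrite [pospart 0]/pospart maxxx expr0n mulr0.
have L : (fun h : R => h^-1 *: (((fun t => pospart t ^+ k.+2) \o shift 0) (h *: 1)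
   - pospart 0 ^+ k.+2)) @ 0^' --> (0 : R).
  apply/cvgr0Pnorm_le => e e0; near=> h.
  have h0 : h != 0 by near: h; exact: nbhs_dnbhs_neq.
  rewrite /= [h *: 1]mulr1 addr0 [pospart 0]/pospart maxxx expr0n subr0.
  rewrite normrM normrX normfV ler_pdivrMl ?normr_gt0 //.
  have ph : `|pospart h| <= `|h|.
    rewrite ger0_norm ?pospart_ge0 // ge_max normr_ge0; exact: ler_norm.
  have h1 : `|h| <= 1.
    by near: h; exact: dnbhs0_le.
  have h2 : `|h| <= e.
    by near: h; exact: dnbhs0_le.
  apply: le_trans (_ : `|h| ^+ k.+2 <= _); first by rewrite lerXn2r ?nnegrE.
  rewrite exprS ler_wpM2l // exprS; apply: le_trans h2.
  by rewrite ler_piMr // exprn_ile1.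
by split; [apply/cvg_ex; exists 0|exact: cvg_lim L].
Unshelve. all: by end_near. Qed.

(** Two nested truncated fourth powers: the inner one makes the cutoff constant beyond 4, the outer
    one before 1, and the exponent 4 leaves three continuous derivatives. *)
Definition cut_in s : R := pospart ((4 - s) / 3).
Definition cut_out s : R := pospart (1 - cut_in s ^+ 4).

(* A C^3 cutoff: 1 on ]-oo, 1] and 0 on [4, +oo[. *)
Definition cutoff s : R := 1 - cut_out s ^+ 4.
(* bump is minus the derivative of cutoff; bump1 and bump2 are its first two
   derivatives. *)
Definition bump s : R := 16 / 3 * (cut_out s ^+ 3 * cut_in s ^+ 3).
Definition bump1 s : R :=
  16 / 3 * (4 * (cut_out s ^+ 2 * cut_in s ^+ 6) - cut_out s ^+ 3 * cut_in s ^+ 2).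
Definition bump2 s : R :=
  16 / 3 * (4 * (8 / 3 * (cut_out s * cut_in s ^+ 9) - 2 * (cut_out s ^+ 2 * cut_in s ^+ 5))
   - (4 * (cut_out s ^+ 2 * cut_in s ^+ 5) - 2 / 3 * (cut_out s ^+ 3 * cut_in s))).

Lemma is_derive_cut_in k s :
  is_derive s 1 (fun t => cut_in t ^+ k.+2) (k.+2%:R * cut_in s ^+ k.+1 * (- 3^-1)).
Proof.
rewrite /cut_in.
have D : is_derive s 1 (fun t : R => (4 - t) / 3) (- 3^-1).
  apply: (@is_derive_ext _ _ (fun t : R => 4 / 3 + - 3^-1 * t) _ _ _ (0 + (- 3^-1) *: 1)).
  - by move=> t; field.
  - by rewrite add0r [_ *: 1]mulr1.
exact: is_derive1_comp (is_derive_pospartX _ _) D.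
Qed.

Lemma is_derive_cut_out k s :
  is_derive s 1 (fun t => cut_out t ^+ k.+2)
    (k.+2%:R * cut_out s ^+ k.+1 * (4 / 3 * cut_in s ^+ 3)).
Proof.
rewrite /cut_out.
have D : is_derive s 1 (fun t : R => 1 - cut_in t ^+ 4) (4 / 3 * cut_in s ^+ 3).
  apply: (@is_derive_ext _ _ (fun t : R => 1 + (-1) *: cut_in t ^+ 4) _ _ _
    (0 + (-1) *: (4 * cut_in s ^+ 3 * (- 3^-1)))).
  - by move=> t; rewrite scaleN1r.
  - by rewrite add0r scaleN1r; field.
  exact: (is_derive_add (is_derive_cst _ _ _)
    (@is_deriveZ _ _ _ _ _ _ _ _ (is_derive_cut_in 2 s))).
exact: is_derive1_comp (is_derive_pospartX _ _) D.
Qed.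

Lemma is_derive_cutoff s : is_derive s 1 cutoff (- bump s).
Proof.
apply: (@is_derive_ext _ _ (fun t : R => 1 + (-1) *: cut_out t ^+ 4) _ _ _
    (0 + (-1) *: (4 * cut_out s ^+ 3 * (4 / 3 * cut_in s ^+ 3)))).
- by move=> t; rewrite scaleN1r.
- by rewrite add0r scaleN1r /bump; field.
exact: (is_derive_add (is_derive_cst _ _ _)
  (@is_deriveZ _ _ _ _ _ _ _ _ (is_derive_cut_out 2 s))).
Qed.

Lemma is_derive_bump s : is_derive s 1 bump (bump1 s).
Proof.
apply: (@is_derive_ext _ _ (fun t : R => (16 / 3) *: (cut_out t ^+ 3 * cut_in t ^+ 3)) _ _ _
    ((16 / 3) *: ((3 * cut_out s ^+ 2 * (4 / 3 * cut_in s ^+ 3)) * cut_in s ^+ 3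
     + cut_out s ^+ 3 * (3 * cut_in s ^+ 2 * (- 3^-1))))).
- by [].
- by rewrite /bump1 -[_ *: _]/(_ * _); field.
exact: (@is_deriveZ _ _ _ _ _ _ _ _
  (is_derive_mul (is_derive_cut_out 1 s) (is_derive_cut_in 1 s))).
Qed.

Lemma is_derive_bump1 s : is_derive s 1 bump1 (bump2 s).
Proof.
apply: (@is_derive_ext _ _ (fun t : R => (16 / 3) *: (4 *: (cut_out t ^+ 2 * cut_in t ^+ 6)
    + (-1) *: (cut_out t ^+ 3 * cut_in t ^+ 2))) _ _ _
    ((16 / 3) *: (4 *: ((2 * cut_out s ^+ 1 * (4 / 3 * cut_in s ^+ 3)) * cut_in s ^+ 6
     + cut_out s ^+ 2 * (6 * cut_in s ^+ 5 * (- 3^-1)))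
     + (-1) *: ((3 * cut_out s ^+ 2 * (4 / 3 * cut_in s ^+ 3)) * cut_in s ^+ 2
     + cut_out s ^+ 3 * (2 * cut_in s ^+ 1 * (- 3^-1)))))).
- by move=> t; rewrite scaleN1r.
- by rewrite /bump2 scaleN1r -![_ *: _]/(_ * _); field.
exact: (@is_deriveZ _ _ _ _ _ _ _ _ (is_derive_add
  (@is_deriveZ _ _ _ _ _ _ _ _
    (is_derive_mul (is_derive_cut_out 0 s) (is_derive_cut_in 4 s)))
  (@is_deriveZ _ _ _ _ _ _ _ _
    (is_derive_mul (is_derive_cut_out 1 s) (is_derive_cut_in 0 s))))).
Qed.

Lemma cut_in_continuous : continuous cut_in.
Proof.
move=> s; apply: (@continuous_comp _ _ _ (fun t : R => (4 - t) / 3) pospart).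
  apply: continuousM; last exact: cst_continuous.
  by apply: continuousB; [exact: cst_continuous|exact: cvg_id].
exact: pospart_continuous.
Qed.

Lemma cut_out_continuous : continuous cut_out.
Proof.
move=> s; apply: (@continuous_comp _ _ _ (fun t : R => 1 - cut_in t ^+ 4) pospart).
  apply: continuousB; [exact: cst_continuous|].
  apply: (@continuous_comp _ _ _ cut_in (fun x => x ^+ 4)); first exact: cut_in_continuous.
  exact: exprn_continuous.
exact: pospart_continuous.
Qed.

Lemma derive_continuous (f f' : R -> R) : (forall s, is_derive s 1 f (f' s)) -> continuous f.
Proof.
move=> D s; apply: differentiable_continuous; apply/derivable1_diffP.
by case: (D s).
Qed.

Lemma bump_continuous : continuous bump.
Proof. exact: derive_continuous is_derive_bump. Qed.

Lemma bump1_continuous : continuous bump1.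
Proof. exact: derive_continuous is_derive_bump1. Qed.

Lemma bump2_continuous : continuous bump2.
Proof.
have X k (f : R -> R) : continuous f -> continuous (fun s => f s ^+ k).
  by move=> cf s; apply: (@continuous_comp _ _ _ f (fun x => x ^+ k));
    [exact: cf|exact: exprn_continuous].
have Z (c : R) (f : R -> R) : continuous f -> continuous (fun s => c * f s).
  by move=> cf s; apply: continuousM; [exact: cst_continuous|exact: cf].
have P (f g : R -> R) : continuous f -> continuous g -> continuous (fun s => f s * g s).
  by move=> cf cg s; apply: continuousM; [exact: cf|exact: cg].
have S (f g : R -> R) : continuous f -> continuous g -> continuous (fun s => f s - g s).
  by move=> cf cg s; apply: continuousB; [exact: cf|exact: cg].
have ci := cut_in_continuous; have co := cut_out_continuous.
have ci' k := X k _ ci; have co' k := X k _ co.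
rewrite /bump2; apply: (Z).
apply: (S).
  by apply: (Z); apply: (S); apply: (Z); apply: (P).
by apply: (S); apply: (Z); apply: (P).
Qed.

Lemma cut_in_out s : 4 <= s -> cut_in s = 0.
Proof. by move=> h; rewrite /cut_in /pospart max_l //; lra. Qed.

Lemma cut_in_ge1 s : s <= 1 -> 1 <= cut_in s.
Proof. by move=> h; rewrite /cut_in /pospart le_max; apply/orP; right; lra. Qed.

Lemma cut_out_in s : s <= 1 -> cut_out s = 0.
Proof.
move=> /cut_in_ge1 h; rewrite /cut_out /pospart max_l // subr_le0.
by rewrite exprn_ege1.
Qed.

Lemma cut_in_lt1 s : 1 < s -> s < 4 -> 0 < cut_in s < 1.
Proof. by move=> h k; rewrite /cut_in /pospart max_r; lra. Qed.

Lemma cut_out_lt1 s : 1 < s -> s < 4 -> 0 < cut_out s < 1.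
Proof.
move=> h k; have /andP[a b] := cut_in_lt1 h k.
have p : 0 < cut_in s ^+ 4 < 1 by rewrite exprn_gt0 // exprn_ilt1 // ltW.
by rewrite /cut_out /pospart max_r; lra.
Qed.

Lemma cutoff_in s : s <= 1 -> cutoff s = 1.
Proof. by move=> /cut_out_in h; rewrite /cutoff h expr0n subr0. Qed.

Lemma cutoff_out s : 4 <= s -> cutoff s = 0.
Proof.
move=> /cut_in_out h; rewrite /cutoff /cut_out h expr0n subr0.
by rewrite /pospart max_r // expr1n subrr.
Qed.

Definition annular (k : R -> R) := continuous k /\ forall s, ~ (1 < s < 4) -> k s = 0.

Lemma cut_dichotomy s : ~ (1 < s < 4) -> cut_in s = 0 \/ cut_out s = 0.
Proof.
move=> h; case: (lerP s 1) => [/cut_out_in|s1]; first by right.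
case: (lerP 4 s) => [/cut_in_out|s4]; first by left.
by case: h; rewrite s1 s4.
Qed.

Lemma bump_annular : annular bump.
Proof.
split; first exact: bump_continuous.
by move=> s /cut_dichotomy[] h; rewrite /bump h expr0n ?mulr0 ?mul0r ?mulr0.
Qed.

Lemma bump1_annular : annular bump1.
Proof.
split; first exact: bump1_continuous.
by move=> s /cut_dichotomy[] h; rewrite /bump1 h !expr0n /=; ring.
Qed.

Lemma bump2_annular : annular bump2.
Proof.
split; first exact: bump2_continuous.
by move=> s /cut_dichotomy[] h; rewrite /bump2 h ?expr0n /=; ring.
Qed.

Lemma bump_ge0 s : 0 <= bump s.
Proof.
by apply: mulr_ge0; [rewrite divr_ge0|apply: mulr_ge0; apply: exprn_ge0; exact: pospart_ge0].
Qed.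

Lemma bumps_bounded s : [/\ `|bump s| <= 6, `|bump1 s| <= 200 & `|bump2 s| <= 200].
Proof.
have [/andP[h k]|nh] := pselect (1 < s < 4); last first.
  by rewrite bump_annular.2 // bump1_annular.2 // bump2_annular.2 // normr0.
have /andP[/ltW a /ltW b] := cut_in_lt1 h k.
have /andP[/ltW c /ltW d] := cut_out_lt1 h k.
have P i j : 0 <= cut_out s ^+ i * cut_in s ^+ j <= 1.
  by rewrite mulr_ge0 ?exprn_ge0 //= mulr_ile1 ?exprn_ge0 ?exprn_ile1.
have p1 := P 3 3; have p2 := P 2 6; have p3 := P 3 2.
have p4 := P 1 9; have p5 := P 2 5; have p6 := P 3 1; rewrite !expr1 in p4 p6.
rewrite /bump /bump1 /bump2; move: p1 p2 p3 p4 p5 p6.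
move: (_ ^+ 3 * _ ^+ 3) (_ ^+ 2 * _ ^+ 6) (_ ^+ 3 * _ ^+ 2) (cut_out s * _ ^+ 9) (_ ^+ 2 * _ ^+ 5) (_ ^+ 3 * cut_in s).
move=> q1 q2 q3 q4 q5 q6 p1 p2 p3 p4 p5 p6.
by split; rewrite ler_norml; lra.
Qed.

End Cutoff.

(** * Radial averages and Caccioppoli's inequality *)

Section Shell.
Variables (R : realType) (n : nat).
Notation V := 'rV[R]_n.
Implicit Types (f h w : V -> R) (x : V).

(** An open neighbourhood of the closed annulus 1 <= |x|^2 <= 4 that carries all annular weights;
    integrands have to be regular only here. *)
Definition shell : set V := [set x | 1 / 2 < dotp x x < 5].

Lemma rho_continuous : continuous (fun x : V => dotp x x).
Proof. by move=> x; exact: C1_cont (@C1_rho R n setT) I. Qed.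

Lemma dotp_ge0 x : 0 <= dotp x x.
Proof. by apply: sumr_ge0 => i _; rewrite -expr2 sqr_ge0. Qed.

Lemma coord_sqr_le x i : x 0 i ^+ 2 <= dotp x x.
Proof.
rewrite /dotp (bigD1 i) //= -expr2 lerDl.
by apply: sumr_ge0 => j _; rewrite -expr2 sqr_ge0.
Qed.

Lemma coord_le2 x i : dotp x x <= 4 -> `|x 0 i| <= 2.
Proof.
move=> h; have := le_trans (coord_sqr_le x i) h.
rewrite -real_normK ?num_real // => k; have := normr_ge0 (x 0 i); nra.
Qed.

Lemma annular_near0 (k : R -> R) x : annular k -> ~ shell x ->
  \near x, k (dotp x x) = 0.
Proof.
move=> [_ k0] nx.
have cr : {for x, continuous (fun x : V => dotp x x)} by exact: rho_continuous.
have [h|h] : dotp x x < 1 \/ 4 < dotp x x.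
  case: (lerP (dotp x x) (1/2)) => h; first by left; lra.
  case: (lerP 5 (dotp x x)) => h'; first by right; lra.
  by case: nx; rewrite /shell /= h h'.
- have : \forall y \near x, dotp (y : V) y < 1 by exact: cvgr_lt cr _ h.
  apply: filterS => y hy.
  by apply: k0 => /andP[]; lra.
- have : \forall y \near x, 4 < dotp (y : V) y by exact: cvgr_gt cr _ h.
  apply: filterS => y hy.
  by apply: k0 => /andP[]; lra.
Qed.

Lemma C1_radial_weight (k k' : R -> R) : (forall s : R, is_derive s 1 k (k' s)) ->
  continuous k' ->
  C1 setT (fun x : V => k (dotp x x)) (fun i x => k' (dotp x x) * (2 * x 0 i)).
Proof.
move=> dk ck; apply: (C1_comp (@C1_rho R n setT)) => x _.
by split; [exact: dk|exact: ck].
Qed.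

Definition shell_cont h := forall x, shell x -> {for x, continuous h}.

Lemma shell_cont_cst c : shell_cont (fun=> c).
Proof. by move=> x _; exact: cst_continuous. Qed.

Lemma shell_cont_coord i : shell_cont (fun x => x 0 i).
Proof. by move=> x _; exact: coord_continuous. Qed.

Lemma shell_contM f h : shell_cont f -> shell_cont h -> shell_cont (fun x => f x * h x).
Proof. by move=> cf ch x Sx; apply: continuousM; [exact: cf|exact: ch]. Qed.

Lemma shell_contD f h : shell_cont f -> shell_cont h -> shell_cont (fun x => f x + h x).
Proof. by move=> cf ch x Sx; apply: continuousD; [exact: cf|exact: ch]. Qed.

Lemma shell_contN f : shell_cont f -> shell_cont (fun x => - f x).
Proof. by move=> cf x Sx; apply: continuousN; exact: cf. Qed.

Lemma shell_contX f k : shell_cont f -> shell_cont (fun x => f x ^+ k).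
Proof.
move=> cf x Sx; apply: (@continuous_comp _ _ _ f (fun y => y ^+ k)); first exact: cf.
exact: exprn_continuous.
Qed.

Lemma shell_cont_sum (J : finType) (f : J -> V -> R) :
  (forall j, shell_cont (f j)) -> shell_cont (fun x => \sum_j f j x).
Proof.
move=> cf.
have -> : (fun x => \sum_j f j x) = (fun x => \sum_(j <- enum J) f j x).
  by apply/funext => x; rewrite big_enum.
elim: (enum J) => [|j s IH].
  rewrite (_ : (fun x => _) = fun=> 0); first exact: shell_cont_cst.
  by apply/funext => x; rewrite big_nil.
rewrite (_ : (fun x => _) = fun x => f j x + \sum_(j <- s) f j x).
  exact: shell_contD.
by apply/funext => x; rewrite big_cons.
Qed.

Lemma shell_cont_dotp (f h : V -> V) : (forall i, shell_cont (fun x => f x 0 i)) ->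
  (forall i, shell_cont (fun x => h x 0 i)) -> shell_cont (fun x => dotp (f x) (h x)).
Proof. by move=> cf ch; apply: shell_cont_sum => i; exact: shell_contM. Qed.

Lemma annular_continuous (k : R -> R) h : annular k -> shell_cont h ->
  continuous (fun x => k (dotp x x) * h x).
Proof.
move=> ak ch x; have [Sx|nSx] := pselect (shell x).
  apply: continuousM; last exact: ch.
  by apply: continuous_comp; [exact: rho_continuous|exact: ak.1].
apply: (@continuous_near_eq _ _ (fun=> 0)); last exact: cst_continuous.
by apply: filterS (annular_near0 ak nSx) => y ->; rewrite mul0r.
Qed.

Lemma annular_bsupp (k : R -> R) h : annular k -> shell_cont h ->
  bsupp (fun x => k (dotp x x) * h x).
Proof.
move=> ak ch; apply: (@continuous_bsupp _ _ _ 2); first exact: annular_continuous.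
move=> x i h2; rewrite ak.2 ?mul0r // => /andP[_ x4].
have := lt_le_trans x4 (lexx 4) => {}x4.
have := coord_sqr_le x i; rewrite -real_normK ?num_real // => k2.
have : 4 <= `|x 0 i| ^+ 2 by nra.
lra.
Qed.

Lemma bsupp_mul_coord f i : bsupp f -> bsupp (fun x => x 0 i * f x).
Proof.
move=> bf; have [K H] := bf; apply: (bsupp_dominated (c := K) bf) => x.
rewrite normrM; case: (lerP K `|x 0 i|) => h.
  by rewrite ((H x).2 i h) normr0 !mulr0.
by rewrite ler_wpM2r // ltW.
Qed.

End Shell.

Section FunctionalCalculus.
Variables (R : realType) (n : nat) (A : R) (J : ('rV[R]_n -> R) -> R).
Hypothesis HJ : ibp_functional A J.
Notation V := 'rV[R]_n.
Implicit Types (f h w : V -> R) (x : V).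

Lemma fctnD f h : bsupp f -> bsupp h -> J (fun x => f x + h x) = J f + J h.
Proof.
move=> bf bh; have [lin _ _ _] := HJ; rewrite -[J f]mul1r -lin //.
by congr J; apply/funext => x; rewrite mul1r.
Qed.

Lemma fctnZ c f : bsupp f -> J (fun x => c * f x) = c * J f.
Proof. by move=> bf; have [lin _ _ _] := HJ; exact: functionalZ. Qed.

Lemma fctnB f h : bsupp f -> bsupp h -> J (fun x => f x - h x) = J f - J h.
Proof.
move=> bf bh; rewrite -mulN1r -fctnZ // -fctnD //; last exact: bsupp_scale.
by congr J; apply/funext => x; rewrite mulN1r.
Qed.

Lemma fctn0 : J (fun=> 0) = 0.
Proof. by have [lin _ _ _] := HJ; exact: functional0. Qed.

Lemma fctn_sum (I : finType) (f : I -> V -> R) : (forall j, bsupp (f j)) ->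
  J (fun x => \sum_j f j x) = \sum_j J (f j).
Proof.
move=> bf; rewrite -big_enum /=.
have -> : (fun x => \sum_j f j x) = (fun x => \sum_(j <- enum I) f j x).
  by apply/funext => x; rewrite big_enum.
suff [] : J (fun x => \sum_(j <- enum I) f j x) = \sum_(j <- enum I) J (f j) /\
  bsupp (fun x => \sum_(j <- enum I) f j x) by [].
elim: (enum I) => [|j s [IH bs]].
  rewrite (_ : (fun x => _) = fun=> 0); first by rewrite big_nil fctn0; split => //; exact: bsupp0.
  by apply/funext => x; rewrite big_nil.
rewrite (_ : (fun x => _) = fun x => f j x + \sum_(j <- s) f j x); last first.
  by apply/funext => x; rewrite big_cons.
by rewrite big_cons fctnD // IH; split => //; exact: bsupp_add.
Qed.

Lemma fctn_norm_le f h : bsupp f -> bsupp h -> (forall x, `|f x| <= h x) -> `|J f| <= J h.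
Proof. by have [lin mono _ _] := HJ; exact: functional_norm_le. Qed.

Lemma fctn_bounded f (e : R) : bsupp f -> 0 <= e ->
  (forall x, 1 < dotp x x < 4 -> `|f x| <= e) ->
  (forall x, ~ (1 < dotp x x < 4) -> f x = 0) -> `|J f| <= e * A.
Proof.
move=> bf e0 fe f0; have [_ _ _ vol] := HJ.
apply: le_trans (ler_wpM2l e0 vol).
rewrite -fctnZ; last exact: box_bsupp.
apply: fctn_norm_le => //; first by apply: bsupp_scale; exact: box_bsupp.
move=> x; have [h|h] := pselect (1 < dotp x x < 4); last first.
  by rewrite f0 // normr0 mulr_ge0 // box_ge0.
rewrite box_in ?mulr1; first exact: fe.
by move=> i; rewrite mxE subr0; apply: coord_le2; case/andP: h => _ /ltW.
Qed.

Lemma fctn_ibp i f (g : 'I_n -> V -> R) : C1 setT f g -> bsupp f -> J (g i) = 0.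
Proof. by have [_ _ ibp _] := HJ; exact: ibp. Qed.

Section Radial.
Variables (q : V -> R) (dq : 'I_n -> V -> R).
Hypotheses (Cq : C1 setT q dq) (bq : bsupp q).
Hypothesis rad : forall i j x, x 0 j * dq i x = x 0 i * dq j x.

Let C1_ij i j : C1 setT (fun x : V => x 0 i * x 0 j * q x)
  (fun m x => ((m == i)%:R * x 0 j + x 0 i * (m == j)%:R) * q x + x 0 i * x 0 j * dq m x).
Proof. exact: C1_mul (C1_mul (@C1_coord R n setT i) (@C1_coord R n setT j)) Cq. Qed.

Let b_ij i j : bsupp (fun x : V => x 0 i * x 0 j * q x).
Proof.
apply: (bsupp_ext _ (bsupp_mul_coord i (bsupp_mul_coord j bq))) => x.
by rewrite mulrA.
Qed.

(* The rotation field x_i d_j - x_j d_i, applied to x_j q. *)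
Lemma radial_odd i : (2 <= n)%N -> J (fun x => x 0 i * q x) = 0.
Proof.
move=> n2.
have [j ji] : exists j : 'I_n, j != i.
  have /card_gt1P[a [b [_ _ ab]]] : (1 < #|'I_n|)%N by rewrite card_ord.
  by case: (eqVneq a i) => [<-|]; [exists b; rewrite eq_sym|exists a].
have h1 := fctn_ibp j (C1_ij i j) (b_ij i j).
have h2 := fctn_ibp i (C1_ij j j) (b_ij j j).
have b1 := C1_bsupp j (C1_ij i j) (b_ij i j).
have b2 := C1_bsupp i (C1_ij j j) (b_ij j j).
rewrite -[RHS](subrr 0) -{1}h1 -{1}h2 -fctnB //.
congr J; apply/funext => x; rewrite eqxx (negbTE ji) eq_sym (negbTE ji) /=.
have e : x 0 j * x 0 j * dq i x = x 0 i * x 0 j * dq j x by rewrite -mulrA (rad i j); ring.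
by rewrite e; ring.
Qed.

(** The rotation field x_i d_j - x_j d_i kills the radial [q] and sends x_i^2 q to -2 x_i x_j q. *)
Lemma radial_offdiag i j : i != j -> J (fun x => x 0 i * x 0 j * q x) = 0.
Proof.
move=> ij.
have C3 : C1 setT (fun x : V => x 0 i * (x 0 i * x 0 i * q x)) _ :=
  C1_mul (@C1_coord R n setT i) (C1_ij i i).
have C4 : C1 setT (fun x : V => x 0 j * (x 0 i * x 0 i * q x)) _ :=
  C1_mul (@C1_coord R n setT j) (C1_ij i i).
have b3 := bsupp_mul_coord i (b_ij i i).
have b4 := bsupp_mul_coord j (b_ij i i).
have h1 := fctn_ibp j C3 b3; have h2 := fctn_ibp i C4 b4.
have b1 := C1_bsupp j C3 b3; have b2 := C1_bsupp i C4 b4.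
have : -2 * J (fun x => x 0 i * x 0 j * q x) = 0.
  rewrite -fctnZ // -[RHS](subrr 0) -{1}h1 -{1}h2 -fctnB //.
  congr J; apply/funext => x; rewrite eqxx (negbTE ij) eq_sym (negbTE ij) /=.
  have e : x 0 j * (x 0 i * x 0 i * dq i x) = x 0 i * (x 0 i * x 0 i * dq j x).
    have -> : x 0 j * (x 0 i * x 0 i * dq i x) = x 0 i * x 0 i * (x 0 j * dq i x) by ring.
    by rewrite (rad i j); ring.
  by rewrite !mulrDr e; ring.
by move: (J _) => y; lra.
Qed.

(** The same rotation field sends x_i x_j q to x_i^2 q - x_j^2 q. *)
Lemma radial_diag i j : J (fun x => x 0 i * x 0 i * q x) = J (fun x => x 0 j * x 0 j * q x).
Proof.
have [->//|ij] := eqVneq i j.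
have C3 : C1 setT (fun x : V => x 0 i * (x 0 i * x 0 j * q x)) _ :=
  C1_mul (@C1_coord R n setT i) (C1_ij i j).
have C4 : C1 setT (fun x : V => x 0 j * (x 0 i * x 0 j * q x)) _ :=
  C1_mul (@C1_coord R n setT j) (C1_ij i j).
have b3 := bsupp_mul_coord i (b_ij i j).
have b4 := bsupp_mul_coord j (b_ij i j).
have h1 := fctn_ibp j C3 b3; have h2 := fctn_ibp i C4 b4.
have b1 := C1_bsupp j C3 b3; have b2 := C1_bsupp i C4 b4.
apply/eqP; rewrite -subr_eq0 -fctnB //; apply/eqP.
rewrite -[RHS](subrr 0) -{1}h1 -{1}h2 -fctnB //.
congr J; apply/funext => x; rewrite !eqxx (negbTE ij) eq_sym (negbTE ij) /=.
have e : x 0 j * (x 0 i * x 0 j * dq i x) = x 0 i * (x 0 i * x 0 j * dq j x).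
  have -> : x 0 j * (x 0 i * x 0 j * dq i x) = x 0 i * x 0 j * (x 0 j * dq i x) by ring.
  by rewrite (rad i j); ring.
by rewrite !mulrDr e; ring.
Qed.

(** Second moments against a radial weight are isotropic, and the trace fixes the factor 1/n. *)
Lemma radial_dotp (a b : V) : (2 <= n)%N ->
  J (fun x => dotp a x * dotp b x * q x) = dotp a b / n%:R * J (fun x => dotp x x * q x).
Proof.
move=> n2; have n0 : n%:R != 0 :> R by rewrite pnatr_eq0 -lt0n ltnW.
have Jrho i : J (fun x => dotp x x * q x) = n%:R * J (fun x => x 0 i * x 0 i * q x).
  rewrite (_ : (fun x => _) = fun x => \sum_j x 0 j * x 0 j * q x); last first.
    by apply/funext => x; rewrite /dotp mulr_suml.
  rewrite fctn_sum // (eq_bigr _ (fun j _ => radial_diag j i)) sumr_const card_ord.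
  by rewrite mulr_natl.
rewrite (_ : (fun x => dotp a x * _ * _) =
    fun x => \sum_i \sum_j a 0 i * b 0 j * (x 0 i * x 0 j * q x)); last first.
  apply/funext => x; rewrite /dotp mulr_suml mulr_suml; apply: eq_bigr => i _.
  by rewrite mulr_sumr mulr_suml; apply: eq_bigr => j _; ring.
rewrite fctn_sum => [|i]; last by apply: bsupp_sum => j; exact: bsupp_scale.
rewrite /dotp !mulr_suml; apply: eq_bigr => i _.
rewrite fctn_sum => [|j]; last exact: bsupp_scale.
rewrite (bigD1 i) //= big1 => [|j ji]; last first.
  by rewrite fctnZ // radial_offdiag ?mulr0 // eq_sym.
by rewrite addr0 fctnZ // (Jrho i) mulrA divfK.
Qed.

End Radial.

(** Integrates the sum over i of d_i (bump w d_i w - bump1 x_i w^2). Since the weight has derivative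
    2 x_i bump1, the terms in w d_i w cancel: the gradient is given by an equality and nothing has
    to be absorbed. *)
Lemma caccioppoli_identity w (dw : 'I_n -> V -> R) (ddw : 'I_n -> 'I_n -> V -> R) :
  C1 (@shell R n) w dw -> (forall i, C1 (@shell R n) (dw i) (ddw i)) ->
  J (fun x => bump (dotp x x) * \sum_i dw i x ^+ 2) =
  J (fun x => bump1 (dotp x x) * (n%:R * w x ^+ 2)) +
  J (fun x => bump2 (dotp x x) * (2 * dotp x x * w x ^+ 2)) -
  J (fun x => bump (dotp x x) * (w x * \sum_i ddw i i x)).
Proof.
move=> Cw Cdw.
have cw : shell_cont w by move=> x; exact: C1_cont Cw.
have cdw i : shell_cont (dw i) by move=> x; exact: C1_cont (Cdw i).
have cddw i j : shell_cont (ddw i j) by move=> x; exact: C1_dcont (Cdw i).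
have cx i : shell_cont (fun x : V => x 0 i) by exact: shell_cont_coord.
have crho : shell_cont (fun x : V => dotp x x) by move=> x _; exact: rho_continuous.
have B := annular_bsupp (@bump_annular R) (n := n).
have B1 := annular_bsupp (@bump1_annular R) (n := n).
have B2 := annular_bsupp (@bump2_annular R) (n := n).
have b1 : bsupp (fun x => bump (dotp x x) * \sum_i dw i x ^+ 2).
  by apply: B; apply: shell_cont_sum => i; exact: shell_contX.
have b2 : bsupp (fun x => bump1 (dotp x x) * (n%:R * w x ^+ 2)).
  by apply: B1; apply: shell_contM; [exact: shell_cont_cst|exact: shell_contX].
have b3 : bsupp (fun x => bump2 (dotp x x) * (2 * dotp x x * w x ^+ 2)).
  apply: B2; apply: shell_contM; last exact: shell_contX.
  by apply: shell_contM => //; exact: shell_cont_cst.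
have b4 : bsupp (fun x => bump (dotp x x) * (w x * \sum_i ddw i i x)).
  by apply: B; apply: shell_contM => //; exact: shell_cont_sum.
pose F i (x : V) := bump (dotp x x) * dw i x ^+ 2 + bump (dotp x x) * (w x * ddw i i x)
  - (bump1 (dotp x x) * w x ^+ 2 + bump2 (dotp x x) * (2 * x 0 i ^+ 2 * w x ^+ 2)).
have bF i : bsupp (F i) /\ J (F i) = 0.
  have C2 : C1 setT (fun x : V => bump (dotp x x) * (w x * dw i x)) _ :=
    C1_ext0 (C1_mul Cw (Cdw i))
      (C1_radial_weight (@is_derive_bump R) (@bump1_continuous R))
      (fun x => annular_near0 (@bump_annular R)).
  have N1 (x : V) : ~ shell x -> \near x, bump1 (dotp x x) * x 0 i = 0.
    move=> nx; have := annular_near0 (@bump1_annular R) nx.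
    by apply: filterS => y ->; rewrite mul0r.
  have C3 : C1 setT (fun x : V => bump1 (dotp x x) * x 0 i * (w x * w x)) _ :=
    C1_ext0 (C1_mul Cw Cw)
      (C1_mul (C1_radial_weight (@is_derive_bump1 R) (@bump2_continuous R)) (@C1_coord R n setT i))
      N1.
  have C4 := C1_sub_fun C2 C3.
  have b5 : bsupp (fun x => bump (dotp x x) * (w x * dw i x) -
      bump1 (dotp x x) * x 0 i * (w x * w x)).
    apply: (bsupp_ext _ (bsupp_add (B _ (shell_contM cw (cdw i)))
      (bsupp_scale (-1) (B1 _ (shell_contM (cx i) (shell_contM cw cw)))))) => x.
    by ring.
  have := C1_bsupp i C4 b5; have := fctn_ibp i C4 b5.
  rewrite (_ : (fun x => _) = F i) //; apply/funext => x; rewrite /F eqxx /=; ring.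
have Z : J (fun x => \sum_i F i x) = 0.
  by rewrite fctn_sum => [|i]; [rewrite big1 // => i _; exact: (bF i).2|exact: (bF i).1].
move: Z; rewrite (_ : (fun x => \sum_i F i x) = fun x =>
  (bump (dotp x x) * (\sum_i dw i x ^+ 2) + bump (dotp x x) * (w x * \sum_i ddw i i x))
  - (bump1 (dotp x x) * (n%:R * w x ^+ 2) + bump2 (dotp x x) * (2 * dotp x x * w x ^+ 2))).
  rewrite fctnB ?fctnD //; try exact: bsupp_add.
  by move: (J _) (J _) (J _) (J _) => y1 y2 y3 y4; lra.
apply/funext => x; rewrite /F sumrB !big_split /= -!mulr_sumr sumr_const card_ord.
congr (_ - (_ + _)); first by rewrite -mulr_natl; ring.
rewrite (_ : \sum_i _ = 2 * dotp x x * w x ^+ 2) //.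
rewrite /dotp mulr_sumr mulr_suml; apply: eq_bigr => i _; by rewrite expr2.
Qed.

Lemma caccioppoli (e L : R) w (dw : 'I_n -> V -> R) (ddw : 'I_n -> 'I_n -> V -> R) :
  0 <= A ->
  C1 (@shell R n) w dw -> (forall i, C1 (@shell R n) (dw i) (ddw i)) ->
  (forall x, 1 < dotp x x < 4 -> `|w x| <= e) ->
  (forall x, 1 < dotp x x < 4 -> `|\sum_i ddw i i x| <= L) ->
  0 <= e -> 0 <= L ->
  J (fun x => bump (dotp x x) * \sum_i dw i x ^+ 2) <=
    ((200 * n%:R + 200 * 8) * e ^+ 2 + 6 * e * L) * A.
Proof.
move=> A0 Cw Cdw we wL e0 L0; rewrite (caccioppoli_identity Cw Cdw).
have cw : shell_cont w by move=> x; exact: C1_cont Cw.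
have cddw i j : shell_cont (ddw i j) by move=> x; exact: C1_dcont (Cdw i).
have crho : shell_cont (fun x : V => dotp x x) by move=> x _; exact: rho_continuous.
have w2 x : 1 < dotp x x < 4 -> `|w x ^+ 2| <= e ^+ 2.
  by move=> /we h; rewrite normrX lerXn2r // nnegrE.
have h1 : `|J (fun x => bump1 (dotp x x) * (n%:R * w x ^+ 2))| <= 200 * n%:R * e ^+ 2 * A.
  apply: fctn_bounded.
  - apply: annular_bsupp; first exact: bump1_annular.
    by apply: shell_contM; [exact: shell_cont_cst|exact: shell_contX].
  - by apply: mulr_ge0; [apply: mulr_ge0; exact: ler0n|exact: sqr_ge0].
  - move=> x h; rewrite normrM -[leRHS]mulrA; apply: ler_pM => //.
      by have [_ ? _] := bumps_bounded (dotp x x).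
    by rewrite normrM normr_nat ler_wpM2l // w2.
  - by move=> x h; rewrite (bump1_annular R).2 ?mul0r.
have h2 : `|J (fun x => bump2 (dotp x x) * (2 * dotp x x * w x ^+ 2))| <= 200 * 8 * e ^+ 2 * A.
  apply: fctn_bounded.
  - apply: annular_bsupp; first exact: bump2_annular.
    apply: shell_contM; last exact: shell_contX.
    by apply: shell_contM => //; exact: shell_cont_cst.
  - by apply: mulr_ge0; [apply: mulr_ge0; exact: ler0n|exact: sqr_ge0].
  - move=> x h; rewrite normrM -[leRHS]mulrA; apply: ler_pM => //; first by have [] := bumps_bounded (dotp x x).
    rewrite normrM; apply: ler_pM => //; last exact: w2.
    by rewrite ger0_norm ?mulr_ge0 ?dotp_ge0 //; case/andP: h => _; lra.
  - by move=> x h; rewrite (bump2_annular R).2 ?mul0r.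
have h3 : `|J (fun x => bump (dotp x x) * (w x * \sum_i ddw i i x))| <= 6 * e * L * A.
  apply: fctn_bounded.
  - apply: annular_bsupp; first exact: bump_annular.
    by apply: shell_contM => //; exact: shell_cont_sum.
  - by apply: mulr_ge0 => //; apply: mulr_ge0 => //; exact: ler0n.
  - move=> x h; rewrite normrM -[leRHS]mulrA; apply: ler_pM => //.
      by have [] := bumps_bounded (dotp x x).
    by rewrite normrM; apply: ler_pM => //; [exact: we|exact: wL].
  - by move=> x h; rewrite (bump_annular R).2 ?mul0r.
have D (a b x c y : R) : ((a + b) * x + c) * y = a * x * y + b * x * y + c * y by ring.
rewrite D; apply: lerD; first apply: lerD.
- exact: le_trans (ler_norm _) h1.
- exact: le_trans (ler_norm _) h2.
by apply: le_trans h3; rewrite -normrN ler_norm.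
Qed.

End FunctionalCalculus.

(** * The Pohozaev flux *)

Section Dotp.
Variables (R : realType) (n : nat).
Notation V := 'rV[R]_n.
Implicit Types (x y z : V).

Lemma dotpC x y : dotp x y = dotp y x.
Proof. by apply: eq_bigr => i _; rewrite mulrC. Qed.

Lemma dotpDl x y z : dotp (x + y) z = dotp x z + dotp y z.
Proof. by rewrite -big_split; apply: eq_bigr => i _; rewrite mxE mulrDl. Qed.

Lemma dotpZl c x y : dotp (c *: x) y = c * dotp x y.
Proof. by rewrite /dotp mulr_sumr; apply: eq_bigr => i _; rewrite mxE mulrA. Qed.

Lemma dotpDr x y z : dotp z (x + y) = dotp z x + dotp z y.
Proof. by rewrite dotpC dotpDl !(dotpC z). Qed.

Lemma dotpZr c x y : dotp y (c *: x) = c * dotp y x.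
Proof. by rewrite dotpC dotpZl dotpC. Qed.

Lemma dotpNl x y : dotp (- x) y = - dotp x y.
Proof. by rewrite -scaleN1r dotpZl mulN1r. Qed.

Lemma dotpNr x y : dotp y (- x) = - dotp y x.
Proof. by rewrite dotpC dotpNl dotpC. Qed.

Lemma dotp0l y : dotp 0 y = 0.
Proof. by rewrite -(scale0r 0) dotpZl mul0r. Qed.

Lemma dotp_skew y (S : 'M[R]_n) : S^T = - S -> dotp (y *m S) y = 0.
Proof.
move=> hS.
have E x z : dotp x z = (x *m z^T) 0 0.
  by rewrite mxE; apply: eq_bigr => i _; rewrite mxE.
have : dotp (y *m S) y = - dotp (y *m S) y.
  by rewrite [LHS]dotpC !E trmx_mul hS !mulNmx mulmxN mulmxA !mxE.
lra.
Qed.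

(** The norm that pairs with coordinatewise bounds; by [l1norm_sqr] its square is controlled by the
    sum of squares that Caccioppoli's inequality estimates. *)
Definition l1norm x : R := \sum_i `|x 0 i|.

Lemma l1norm_ge0 x : 0 <= l1norm x. Proof. exact: sumr_ge0. Qed.

Lemma dotp_le_l1 x y (M : R) : (forall i, `|x 0 i| <= M) -> `|dotp x y| <= M * l1norm y.
Proof.
move=> xM; apply: le_trans (ler_norm_sum _ _ _) _; rewrite mulr_sumr.
by apply: ler_sum => i _; rewrite normrM ler_wpM2r.
Qed.

Lemma l1norm_le x (M : R) : (forall i, `|x 0 i| <= M) -> l1norm x <= n%:R * M.
Proof.
move=> xM; apply: le_trans (ler_sum _ (fun i _ => xM i)) _.
by rewrite sumr_const card_ord mulr_natl.
Qed.

Lemma dotp_le x y (M K : R) : 0 <= M -> (forall i, `|x 0 i| <= M) ->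
  (forall i, `|y 0 i| <= K) -> `|dotp x y| <= n%:R * M * K.
Proof.
move=> M0 xM yK; apply: le_trans (dotp_le_l1 y xM) _.
by rewrite mulrAC [_ * M]mulrC; apply: ler_wpM2l => //; exact: l1norm_le.
Qed.

Lemma dotp_self_le_l1 x : dotp x x <= l1norm x ^+ 2.
Proof.
rewrite expr2 {2}/l1norm mulr_sumr; apply: ler_sum => i _.
apply: le_trans (ler_norm _) _; rewrite normrM ler_wpM2r //.
by rewrite /l1norm (bigD1 i) //= lerDl sumr_ge0.
Qed.

(** Cauchy-Schwarz, by expanding the double sum and using 2 p q <= p^2 + q^2 termwise. *)
Lemma l1norm_sqr x : l1norm x ^+ 2 <= n%:R * \sum_i x 0 i ^+ 2.
Proof.
have sumc (c : R) : \sum_(j < n) c = n%:R * c by rewrite sumr_const card_ord mulr_natl.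
set S := \sum_i x 0 i ^+ 2.
rewrite expr2 {1}/l1norm mulr_suml.
apply: le_trans (_ : \sum_i (n%:R * (x 0 i ^+ 2 / 2) + S / 2) <= _).
  apply: ler_sum => i _; rewrite /l1norm mulr_sumr -sumc /S mulr_suml -big_split /=.
  apply: ler_sum => j _.
  have := sqr_ge0 (`|x 0 i| - `|x 0 j|).
  rewrite -[x 0 i ^+ 2]real_normK ?num_real // -[x 0 j ^+ 2]real_normK ?num_real //.
  by move: `|x 0 i| `|x 0 j| => p q; nra.
rewrite big_split /= -mulr_sumr -mulr_suml sumc -/S.
by rewrite -mulrDr -mulrDl -mulr2n -[_ *+ 2]mulr_natr mulfK.
Qed.

End Dotp.

Section Flux.
Variables (R : realType) (n : nat).
Notation V := 'rV[R]_n.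
Implicit Types (X Y Z y b a : V) (u v lam kap : R).

Let d : R := n%:R - 2.

Definition critical_pow u : R := u `^ ((n%:R + 2) / (n%:R - 2)).
Definition energy_pow u : R := u `^ (2 * n%:R / (n%:R - 2)).

(* Radial component P . y of the Pohozaev field
   P = (X.DU) DU - |DU|^2 X / 2 + kap (n-2)^2/8 U^(2n/(n-2)) X
       + (n-2)/2 lam U DU - (n-2)/4 U^2 b,
   for a conformal field X with divergence n lam and b = grad lam; u and Y
   stand for the values of U and DU. *)
Definition flux kap X lam b u Y y : R :=
  dotp X Y * dotp Y y - 2^-1 * dotp Y Y * dotp X y
  + kap * (d ^+ 2 / 8 * energy_pow u) * dotp X y
  + d / 2 * lam * u * dotp Y y - d / 4 * u ^+ 2 * dotp b y.

Lemma normM_le (p q s t : R) : `|p| <= s -> `|q| <= t -> `|p * q| <= s * t.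
Proof. by move=> h k; rewrite normrM ler_pM. Qed.

Lemma normD_le (p q s t : R) : `|p| <= s -> `|q| <= t -> `|p + q| <= s + t.
Proof. by move=> h k; apply: le_trans (ler_normD _ _) _; rewrite lerD. Qed.

Lemma normB_le (p q s t : R) : `|p| <= s -> `|q| <= t -> `|p - q| <= s + t.
Proof. by move=> h k; apply: normD_le; rewrite ?normrN. Qed.

(** The bound involves the gradients only through the first and second powers of their distance, so
    it can be integrated when that distance is known merely in L^2. The two couplings may differ, as
    they do at infinity. *)
Lemma flux_error (hn : (3 <= n)%N) kap kap' X lam b u v Y Z y (B M K r : R) :
  (forall i, `|X 0 i| <= B) -> `|lam| <= B -> (forall i, `|b 0 i| <= B) ->
  (forall i, `|y 0 i| <= 2) -> (forall i, `|Z 0 i| <= M) ->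
  `|u| <= M -> `|v| <= M -> 0 <= kap' <= 1 -> 0 <= B -> 0 <= M -> 0 <= K ->
  `|d ^+ 2 / 8 * energy_pow u| <= K ->
  `|d ^+ 2 / 8 * energy_pow u - d ^+ 2 / 8 * energy_pow v| <= K * r ->
  `|u - v| <= r ->
  `|flux kap X lam b u Y y - flux kap' X lam b v Z y| <=
    (2 + n%:R + 7 * n%:R * M + 2 * n%:R * K + 2 * n%:R ^+ 2 * M) * B *
    (l1norm (Y - Z) ^+ 2 + l1norm (Y - Z) + r + `|kap - kap'|).
Proof.
move=> XB lB bB y2 ZM uM vM /andP[k0 k1] B0 M0 K0 eu euv uv.
have r0 : 0 <= r by apply: le_trans uv.
have [E EZ] : exists E, Y - Z = E by exists (Y - Z).
have YE : Y = Z + E by rewrite -EZ addrC subrK.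
rewrite EZ.
set s := l1norm E; have s0 : 0 <= s by exact: l1norm_ge0.
set N : R := n%:R.
have N3 : 3 <= N by rewrite /N ler_nat.
have dE : d = N - 2 by [].
have XE : `|dotp X E| <= B * s by exact: dotp_le_l1.
have Ey : `|dotp E y| <= 2 * s by rewrite dotpC; exact: dotp_le_l1.
have XZ : `|dotp X Z| <= N * B * M by exact: dotp_le.
have Zy : `|dotp Z y| <= N * M * 2 by exact: dotp_le.
have ZE : `|dotp Z E| <= M * s by exact: dotp_le_l1.
have EE : `|dotp E E| <= s ^+ 2.
  rewrite ger0_norm; first exact: dotp_self_le_l1.
  exact: dotp_ge0.
have Xy : `|dotp X y| <= N * B * 2 by exact: dotp_le.
have Hby : `|dotp b y| <= N * B * 2 by exact: dotp_le.
have upv : `|u + v| <= M + M by exact: normD_le.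
have dd : `|d / 2| <= N / 2 by clear -N3 dE; rewrite dE ger0_norm; lra.
have dd4 : `|d / 4| <= N / 4 by clear -N3 dE; rewrite dE ger0_norm; lra.
have h2 : `|2^-1 : R| <= 2^-1 by rewrite ger0_norm // invr_ge0.
have n2 : `|2 : R| <= 2 by rewrite ger0_norm.
have kk : `|kap'| <= 1 by rewrite ger0_norm.
pose e1 := d ^+ 2 / 8 * energy_pow u; pose e2 := d ^+ 2 / 8 * energy_pow v.
have -> : flux kap X lam b u Y y - flux kap' X lam b v Z y =
  dotp X E * dotp E y + dotp X E * dotp Z y + dotp X Z * dotp E y
  - 2^-1 * (2 * dotp Z E + dotp E E) * dotp X y
  + ((kap - kap') * e1 + kap' * (e1 - e2)) * dotp X y
  + d / 2 * lam * (u * dotp E y + (u - v) * dotp Z y)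
  - d / 4 * ((u - v) * (u + v)) * dotp b y.
  rewrite /flux -/e1 -/e2 YE !(dotpDl, dotpDr) (dotpC E Z); ring.
have F1 := normM_le XE Ey.
have F2 := normM_le XE Zy.
have F3 := normM_le XZ Ey.
have F4 := normM_le (normM_le h2 (normD_le (normM_le n2 ZE) EE)) Xy.
have F5 := normM_le (normD_le (normM_le (lexx `|kap - kap'|) eu) (normM_le kk euv)) Xy.
have F6 := normM_le (normM_le dd lB) (normD_le (normM_le uM Ey) (normM_le uv Zy)).
have F7 := normM_le (normM_le dd4 (normM_le uv upv)) Hby.
have F := normB_le (normD_le (normD_le (normB_le (normD_le (normD_le F1 F2) F3) F4) F5) F6) F7.
apply: le_trans F _.
set t := `|kap - kap'|; have t0 : 0 <= t by exact: normr_ge0.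
have N0 : 0 <= N by exact: ler0n.
rewrite -subr_ge0 (_ : _ - _ = B * ((2 + N) * (s + r + t) + 7 * (N * M) * (s ^+ 2 + r + t)
  + 2 * (N * K) * (s ^+ 2 + s) + 2 * (N ^+ 2 * M) * (s ^+ 2 + s + t))); last by field.
have NM : 0 <= N * M by exact: mulr_ge0.
have NK : 0 <= N * K by exact: mulr_ge0.
have NNM : 0 <= N ^+ 2 * M by apply: mulr_ge0 => //; exact: sqr_ge0.
have s2 : 0 <= s ^+ 2 by exact: sqr_ge0.
apply: mulr_ge0 => //; apply: addr_ge0; first apply: addr_ge0; first apply: addr_ge0.
- by clear -N3 N0 s0 s2 r0 t0 NM NK NNM; apply: mulr_ge0; lra.
- by clear -N3 N0 s0 s2 r0 t0 NM NK NNM; apply: mulr_ge0; lra.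
- by clear -N3 N0 s0 s2 r0 t0 NM NK NNM; apply: mulr_ge0; lra.
by clear -N3 N0 s0 s2 r0 t0 NM NK NNM; apply: mulr_ge0; lra.
Qed.

End Flux.

(** * Radial profiles and their first-order variations *)

Section Powers.
Variables (R : realType).

Lemma is_derive_continuous (f : R -> R) (s e : R) : is_derive s 1 f e -> {for s, continuous f}.
Proof.
by move=> D; apply: differentiable_continuous; apply/derivable1_diffP; case: D.
Qed.

Lemma MVT_sym (f df : R -> R) (u v : R) :
  (forall t, Num.min u v <= t <= Num.max u v -> is_derive t 1 f (df t)) ->
  exists2 t, Num.min u v <= t <= Num.max u v & f u - f v = df t * (u - v).
Proof.
wlog uv : u v / u <= v.
  move=> W D; have [uv|vu] := orP (le_total u v); first exact: W.
  have [|t ht E] := W v u vu.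
    by move=> t ht; apply: D; rewrite minC maxC.
  exists t; first by rewrite minC maxC.
  by rewrite -opprB E -mulrN opprB.
rewrite (min_l uv) (max_r uv) => D.
have cf : {within `[u, v], continuous f}.
  apply: derivable_within_continuous => t; rewrite in_itv /= => ht.
  exact: (@ex_derive _ _ _ _ _ _ _ (D t ht)).
have D' t : t \in `]u, v[%R -> is_derive t 1 f (df t).
  by rewrite in_itv /= => /andP[/ltW a /ltW b]; apply: D; rewrite a b.
have [t] := MVT_segment uv D' cf; rewrite in_itv /= => ht E.
by exists t => //; rewrite -opprB E -mulrN opprB.
Qed.

Lemma powR_lipschitz (q M u v : R) : 1 <= q -> 0 < u <= M -> 0 < v <= M ->
  `|u `^ q - v `^ q| <= q * M `^ (q - 1) * `|u - v|.
Proof.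
move=> q1 /andP[u0 uM] /andP[v0 vM].
have [|t /andP[t1 t2] ->] := @MVT_sym (fun t => t `^ q) (fun t => q * t `^ (q - 1)) u v.
  move=> t /andP[t1 _]; apply: is_derive1_powR.
  by apply: lt_le_trans t1; rewrite lt_min u0 v0.
have t0 : 0 < t by apply: lt_le_trans t1; rewrite lt_min u0 v0.
have tM : t <= M by apply: le_trans t2 _; rewrite ge_max uM vM.
rewrite normrM ler_wpM2r // ger0_norm ?mulr_ge0 ?powR_ge0 //; last by lra.
apply: ler_wpM2l; first by lra.
apply: ge0_ler_powR => //; [by lra|by rewrite nnegrE ltW|].
by rewrite nnegrE ltW //; exact: lt_le_trans tM.
Qed.

Lemma powR_le_of_le (q M u : R) : 0 <= q -> 0 < u <= M -> 0 <= u `^ q <= M `^ q.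
Proof.
move=> q0 /andP[u0 uM]; rewrite powR_ge0 /=; apply: ge0_ler_powR => //; rewrite nnegrE ltW //.
exact: lt_le_trans uM.
Qed.

End Powers.

Section Energy.
Variables (R : realType) (n : nat).
Hypothesis hn : (3 <= n)%N.

Let d : R := n%:R - 2.
Let c : R := n%:R * (n%:R - 2) / 4.
Let p : R := (n%:R + 2) / (n%:R - 2).

Lemma dim_facts : [/\ 3 <= n%:R :> R, 1 <= d, 0 < c & 1 <= p].
Proof.
have h : 3 <= n%:R :> R by rewrite ler_nat.
have h1 : 1 <= d by rewrite /d; lra.
have h2 : 0 < c by rewrite /c divr_gt0 // mulr_gt0 //; rewrite /d in h1; lra.
by split => //; rewrite /p ler_pdivlMr; rewrite /d in h1; lra.
Qed.

Lemma is_derive_energy (u : R) : 0 < u ->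
  is_derive u 1 (fun t => d ^+ 2 / 8 * energy_pow n t) (c * critical_pow n u).
Proof.
move=> u0; have [h3 h1 _ _] := dim_facts.
have := @is_deriveZ _ _ _ (fun t : R => t `^ (2 * n%:R / d)) (d ^+ 2 / 8) u 1 _
  (is_derive1_powR (2 * n%:R / d) u0).
apply: is_derive_ext => //.
have d0 : d != 0 by rewrite gt_eqF //; lra.
rewrite /critical_pow -/d -[_ *: _]/(_ * _).
have -> : 2 * n%:R / d - 1 = (n%:R + 2) / d by rewrite /d; field; exact: d0.
by rewrite /c -/d mulrA; congr (_ * _); field.
Qed.

(** A quadratic remainder is needed for the part of the field that does not vanish at the centre of
    the annulus, where an error linear in [a] would be too large. *)
Lemma energy_taylor (M u v : R) : 0 < u <= M -> 0 < v <= M ->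
  `|d ^+ 2 / 8 * energy_pow n u - d ^+ 2 / 8 * energy_pow n v - c * critical_pow n v * (u - v)|
  <= c * (p * M `^ (p - 1)) * (u - v) ^+ 2.
Proof.
have [h3 h1 c0 p1] := dim_facts.
move=> hu hv; move: (hu) (hv) => /andP[u0 uM] /andP[v0 vM].
have [|t /andP[t1 t2] ->] := @MVT_sym _ (fun t => d ^+ 2 / 8 * energy_pow n t)
    (fun t => c * critical_pow n t) u v.
  move=> t /andP[t1 _]; apply: is_derive_energy.
  by apply: lt_le_trans t1; rewrite lt_min u0 v0.
have t0 : 0 < t by apply: lt_le_trans t1; rewrite lt_min u0 v0.
have tM : t <= M by apply: le_trans t2 _; rewrite ge_max uM vM.
have -> : c * critical_pow n t * (u - v) - c * critical_pow n v * (u - v) =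
  c * ((t `^ p - v `^ p) * (u - v)) by rewrite /critical_pow -/p; ring.
rewrite normrM (gtr0_norm c0) -mulrA; apply: ler_wpM2l; first exact: ltW.
rewrite normrM.
have L := @powR_lipschitz _ p M t v p1; rewrite t0 tM v0 vM in L.
apply: le_trans (ler_wpM2r (normr_ge0 _) (L isT isT)) _.
have tv : `|t - v| <= `|u - v|.
  move: t1 t2; rewrite ler_norml.
  have [uv|vu] := orP (le_total u v).
    by rewrite (min_l uv) (max_r uv) distrC ger0_norm ?subr_ge0 //; lra.
  by rewrite (min_r vu) (max_l vu) ger0_norm ?subr_ge0 //; lra.
rewrite -[(u - v) ^+ 2]real_normK ?num_real // expr2 [leRHS]mulrA.
apply: ler_wpM2r => //; apply: ler_wpM2l => //.
by apply: mulr_ge0; [lra|exact: powR_ge0].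
Qed.

End Energy.

Section Profile.
Variables (R : realType) (n : nat).
Hypothesis hn : (3 <= n)%N.
Notation V := 'rV[R]_n.

Let d : R := n%:R - 2.
Let c : R := n%:R * (n%:R - 2) / 4.
Let p : R := (n%:R + 2) / (n%:R - 2).

(* F(|y|^2) is a radial solution of Delta U + kap c U^p = 0 and, for a vector
   a, (a . y) G(|y|^2) is the infinitesimal variation of F(|y|^2) under the
   special conformal field of direction a; H is the conserved energy. *)
Definition profile (kap H : R) (F G : R -> R) := forall s, 1 / 2 < s < 5 ->
  [/\ 0 < F s,
      is_derive s 1 F ((G s - d * F s) / (2 * s)),
      is_derive s 1 G (- (kap * c / 2) * critical_pow n (F s))
    & (G s - d * F s) * G s + d ^+ 2 / 4 * kap * s * energy_pow n (F s)
        = s `^ ((2 - n%:R) / 2) * H].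

Variables (kap H : R) (F G : R -> R).
Hypothesis HFG : profile kap H F G.

(** The derivatives in the form dictated by the equations of [profile]; differentiating these once
    more gives the second derivatives without any further regularity assumption. *)
Definition prF1 s := (G s - d * F s) / (2 * s).
Definition prG1 s := - (kap * c / 2) * critical_pow n (F s).
Definition prF2 s := (prG1 s - n%:R * prF1 s) / (2 * s).
Definition prG2 s := - (kap * c / 2) * (p * F s `^ (p - 1) * prF1 s).

Lemma is_derive_prF1 (s : R) : 1 / 2 < s < 5 -> is_derive s 1 prF1 (prF2 s).
Proof.
move=> hs; have [F0 dF dG _] := HFG hs.
have s0 : s != 0 by rewrite gt_eqF //; lra.
have D1 : is_derive s 1 (fun t => G t + (- d) *: F t) _ :=
  is_derive_add dG (@is_deriveZ _ _ _ _ _ _ _ _ dF).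
have DV : is_derive s 1 (fun t : R => t^-1) (- s ^- 2).
  split; first exact: derivableV.
  by rewrite deriveV // derive_id -[_ *: _]/(_ * _) mulr1.
have D2 : is_derive s 1 (fun t : R => 2^-1 *: t^-1) _ := @is_deriveZ _ _ _ _ _ _ _ _ DV.
apply: is_derive_ext (is_derive_mul D1 D2).
  move=> t; rewrite /prF1 invfM scaleNr; congr (_ * _).
rewrite /prF2 -/(prG1 s) -/(prF1 s) -![_ *: _]/(_ * _).
have -> : G s = 2 * s * prF1 s + d * F s by rewrite /prF1; field.
rewrite /d; field; exact: s0.
Qed.

Lemma is_derive_prG1 (s : R) : 1 / 2 < s < 5 -> is_derive s 1 prG1 (prG2 s).
Proof.
move=> hs; have [F0 dF _ _] := HFG hs.
have D : is_derive s 1 (fun t => F t `^ p) (p * F s `^ (p - 1) * prF1 s).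
  exact: is_derive1_comp (is_derive1_powR p F0) dF.
exact: (@is_deriveZ _ _ _ _ _ _ _ _ D).
Qed.

Lemma prF2_continuous (s : R) : 1 / 2 < s < 5 -> {for s, continuous prF2}.
Proof.
move=> hs; have s0 : 2 * s != 0 by rewrite gt_eqF //; lra.
apply: continuousM.
  apply: continuousB; first exact: is_derive_continuous (is_derive_prG1 hs).
  apply: continuousM; first exact: cst_continuous.
  exact: is_derive_continuous (is_derive_prF1 hs).
apply: continuousV => //; apply: continuousM; [exact: cst_continuous|exact: cvg_id].
Qed.

Lemma prG2_continuous (s : R) : 1 / 2 < s < 5 -> {for s, continuous prG2}.
Proof.
move=> hs; have [F0 dF _ _] := HFG hs.
apply: continuousM; first exact: cst_continuous.
apply: continuousM; last exact: is_derive_continuous (is_derive_prF1 hs).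
apply: continuousM; first exact: cst_continuous.
exact: is_derive_continuous (is_derive1_comp (is_derive1_powR (p - 1) F0) dF).
Qed.

Lemma C1_radial (h h' : R -> R) :
  (forall s : R, 1 / 2 < s < 5 -> is_derive s 1 h (h' s) /\ {for s, continuous h'}) ->
  C1 (@shell R n) (fun x => h (dotp x x)) (fun i x => h' (dotp x x) * (2 * x 0 i)).
Proof. by move=> H'; apply: (C1_comp (@C1_rho R n (@shell R n))) => x; exact: H'. Qed.

Lemma C1_F : C1 (@shell R n) (fun x => F (dotp x x)) (fun i x => prF1 (dotp x x) * (2 * x 0 i)).
Proof.
apply: C1_radial => s hs; have [_ dF _ _] := HFG hs; split => //.
exact: is_derive_continuous (is_derive_prF1 hs).
Qed.

Lemma C1_G : C1 (@shell R n) (fun x => G (dotp x x)) (fun i x => prG1 (dotp x x) * (2 * x 0 i)).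
Proof.
apply: C1_radial => s hs; have [_ _ dG _] := HFG hs; split => //.
exact: is_derive_continuous (is_derive_prG1 hs).
Qed.

Lemma C1_F1 : C1 (@shell R n) (fun x => prF1 (dotp x x)) (fun i x => prF2 (dotp x x) * (2 * x 0 i)).
Proof.
by apply: C1_radial => s hs; split; [exact: is_derive_prF1|exact: prF2_continuous].
Qed.

Lemma C1_G1 : C1 (@shell R n) (fun x => prG1 (dotp x x)) (fun i x => prG2 (dotp x x) * (2 * x 0 i)).
Proof.
by apply: C1_radial => s hs; split; [exact: is_derive_prG1|exact: prG2_continuous].
Qed.

Variable a : V.

Lemma C1_dotp D : C1 D (fun x => dotp a x) (fun i _ => a 0 i).
Proof.
refine (C1_eq (C1_sum (fun j => C1_scale (a 0 j) (@C1_coord R n D j))) _ _) => // i x.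
rewrite (bigD1 i) //= big1 => [|j ji]; first by rewrite eqxx mulr1 addr0.
by rewrite eq_sym (negbTE ji) mulr0.
Qed.

Definition approx (x : V) : R := F (dotp x x) + dotp a x * G (dotp x x).
Definition dapprox (i : 'I_n) (x : V) : R := prF1 (dotp x x) * (2 * x 0 i) +
  (a 0 i * G (dotp x x) + dotp a x * (prG1 (dotp x x) * (2 * x 0 i))).

Lemma C1_approx : C1 (@shell R n) approx dapprox.
Proof. exact: C1_add C1_F (C1_mul (@C1_dotp _) C1_G). Qed.

(** The radial part solves the equation exactly. The Laplacian of the part linear in [a] is merely
    kept as a term of size O(|a|), which suffices for the gradient estimate. *)
Lemma C1_dapprox : exists dda : 'I_n -> 'I_n -> V -> R,
  (forall i, C1 (@shell R n) (dapprox i) (dda i)) /\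
  forall x, shell x -> \sum_i dda i i x = - (kap * c) * critical_pow n (F (dotp x x))
    + dotp a x * (4 * dotp x x * prG2 (dotp x x) + (2 * n%:R + 4) * prG1 (dotp x x)).
Proof.
have C2 i := C1_scale 2 (@C1_coord R n (@shell R n) i).
exists (fun i m x => (prF2 (dotp x x) * (2 * x 0 m)) * (2 * x 0 i) + prF1 (dotp x x) * (2 * (m == i)%:R)
   + (a 0 i * (prG1 (dotp x x) * (2 * x 0 m)) + (a 0 m * (prG1 (dotp x x) * (2 * x 0 i))
     + dotp a x * ((prG2 (dotp x x) * (2 * x 0 m)) * (2 * x 0 i) + prG1 (dotp x x) * (2 * (m == i)%:R))))).
split=> [i|x Sx].
  exact: C1_add (C1_mul C1_F1 (C2 i)) (C1_add (C1_scale (a 0 i) C1_G)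
    (C1_mul (@C1_dotp _) (C1_mul C1_G1 (C2 i)))).
have s0 : dotp x x != 0 by rewrite gt_eqF //; move: Sx => /andP[]; lra.
rewrite (eq_bigr (fun i => (4 * prF2 (dotp x x)) * (x 0 i * x 0 i) + 2 * prF1 (dotp x x)
  + (4 * prG1 (dotp x x)) * (a 0 i * x 0 i) + 4 * dotp a x * prG2 (dotp x x) * (x 0 i * x 0 i)
  + 2 * dotp a x * prG1 (dotp x x))); last first.
  by move=> i _; rewrite eqxx /=; ring.
have S (c1 c2 c3 c4 c5 : R) :
  \sum_(i < n) (c1 * (x 0 i * x 0 i) + c2 + c3 * (a 0 i * x 0 i) + c4 * (x 0 i * x 0 i) + c5)
  = c1 * dotp x x + n%:R * c2 + c3 * dotp a x + c4 * dotp x x + n%:R * c5.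
  by rewrite !big_split /= -!mulr_sumr !sumr_const card_ord -(mulr_natl c2) -(mulr_natl c5).
rewrite S.
have e1 : 4 * prF2 (dotp x x) * dotp x x = 2 * prG1 (dotp x x) - 2 * n%:R * prF1 (dotp x x).
  rewrite /prF2; move: (prF1 _) (prG1 _) => f1 g1; field; exact: s0.
have e2 : - (kap * c) * critical_pow n (F (dotp x x)) = 2 * prG1 (dotp x x).
  by rewrite /prG1; field.
rewrite e1 e2; move: (prF1 _) (prG1 _) (prG2 _) => f1 g1 g2; ring.
Qed.

End Profile.

(** * Comparison of fluxes *)

Section Arithmetic.
Variable R : realType.

Lemma annulus_sub (s : R) : 1 < s < 4 -> 1 / 2 < s < 5.
Proof. lra. Qed.

Lemma sub_mul_le_sqr (l r : R) : (l - r) * r <= l ^+ 2.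
Proof. have := sqr_ge0 (l - r); have := sqr_ge0 r; have := sqr_ge0 l; nra. Qed.

Lemma sum_le_of_split (l l2 q e t r k : R) : l <= r + q -> l2 <= q -> 2 * q <= k ->
  e <= r -> t <= r -> l2 + l + e + t <= k + 3 * r.
Proof. lra. Qed.

End Arithmetic.

Section Comparison.
Variables (R : realType) (n : nat).
Hypothesis hn : (3 <= n)%N.
Notation V := 'rV[R]_n.
Implicit Types (X Y Z y x b a : V) (u v lam kap : R).

Let d : R := n%:R - 2.
Let c : R := n%:R * (n%:R - 2) / 4.
Let p : R := (n%:R + 2) / (n%:R - 2).
Let N : R := n%:R.

Lemma shell_cont_powR (f : V -> R) (q : R) : shell_cont f -> (forall x, shell x -> 0 < f x) ->
  shell_cont (fun x => f x `^ q).
Proof.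
move=> cf f0 x Sx.
exact: (continuous_comp (cf x Sx) (is_derive_continuous (is_derive1_powR q (f0 x Sx)))).
Qed.

Lemma shell_cont_flux kap (X : V -> V) (lam : V -> R) b (u : V -> R) (Y : V -> V) :
  (forall i, shell_cont (fun x => X x 0 i)) -> shell_cont lam ->
  shell_cont u -> (forall x, shell x -> 0 < u x) ->
  (forall i, shell_cont (fun x => Y x 0 i)) ->
  shell_cont (fun x => flux kap (X x) (lam x) b (u x) (Y x) x).
Proof.
move=> cX cl cu u0 cY.
have cx (i : 'I_n) : shell_cont (fun x : V => x 0 i) by exact: shell_cont_coord.
have cst (r : R) : @shell_cont R n (fun=> r) by exact: shell_cont_cst.
rewrite /flux; apply: shell_contD; first apply: shell_contD; first apply: shell_contD; first apply: shell_contD.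
- by apply: shell_contM; exact: shell_cont_dotp.
- apply: shell_contN; apply: shell_contM; last exact: shell_cont_dotp.
  by apply: shell_contM => //; exact: shell_cont_dotp.
- apply: shell_contM; last exact: shell_cont_dotp.
  apply: shell_contM => //; apply: shell_contM => //; exact: shell_cont_powR.
- apply: shell_contM; last exact: shell_cont_dotp.
  by apply: shell_contM => //; apply: shell_contM.
apply: shell_contN; apply: shell_contM; last by apply: shell_cont_dotp.
by apply: shell_contM => //; exact: shell_contX.
Qed.

Lemma energy_lipschitz (M u v : R) : 0 < u <= M -> 0 < v <= M ->
  `|d ^+ 2 / 8 * energy_pow n u - d ^+ 2 / 8 * energy_pow n v| <=
  d ^+ 2 / 8 * (2 * N / d * M `^ (2 * N / d - 1)) * `|u - v|.
Proof.
have [h3 h1 c0 p1] := dim_facts R hn; have p0 : 0 <= p := le_trans ler01 p1.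
have pm : 0 <= p - 1 by rewrite subr_ge0.
have dd0 : 0 <= d ^+ 2 / 8 by rewrite divr_ge0 // sqr_ge0.
move=> hu hv; rewrite -mulrBr normrM (ger0_norm dd0) -[leRHS]mulrA.
apply: ler_wpM2l => //.
apply: powR_lipschitz => //; rewrite ler_pdivlMr; last by rewrite /d in h1 *; lra.
rewrite /N /d in h1 *; lra.
Qed.

Section Bounds.
Variables (M kap H : R) (F G : R -> R).
Hypothesis HFG : profile n kap H F G.
Hypothesis kap01 : 0 <= kap <= 1.
Hypothesis FGM : forall s, 1 / 2 < s < 5 -> F s <= M /\ `|G s| <= M.

Definition bndG1 : R := c / 2 * M `^ p.
Definition bndG2 : R := c / 2 * (p * M `^ (p - 1) * (N * M)).

Lemma prF1_bound s : 1 / 2 < s < 5 -> `|prF1 n F G s| <= N * M.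
Proof.
have [h3 h1 c0 p1] := dim_facts R hn; have p0 : 0 <= p := le_trans ler01 p1.
have pm : 0 <= p - 1 by rewrite subr_ge0.
move=> hs; have [F0 _ _ _] := HFG hs; have [FM GM] := FGM hs.
rewrite /prF1 normrM normfV ler_pdivrMr; last by rewrite normr_gt0 gt_eqF //; lra.
apply: le_trans (_ : N * M * 1 <= _); last first.
  apply: ler_wpM2l; first by rewrite mulr_ge0 //; lra.
  by rewrite ger0_norm; lra.
rewrite mulr1; apply: le_trans (normB_le GM (_ : _ <= d * M)) _.
  by rewrite normrM ger0_norm ?(ger0_norm (ltW F0)) ?ler_wpM2l //; rewrite /d in h1 *; lra.
rewrite /N /d; have : 0 <= M by lra.
nra.
Qed.

Lemma bndG1_ge0 : 0 <= bndG1.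
Proof.
have [h3 h1 c0 p1] := dim_facts R hn; have p0 : 0 <= p := le_trans ler01 p1.
have pm : 0 <= p - 1 by rewrite subr_ge0.
by apply: mulr_ge0; [apply: divr_ge0 => //; exact: ltW|exact: powR_ge0].
Qed.

Lemma bndG2_ge0 : 0 <= M -> 0 <= bndG2.
Proof.
move=> M0; have [h3 h1 c0 p1] := dim_facts R hn; have p0 : 0 <= p := le_trans ler01 p1.
have pm : 0 <= p - 1 by rewrite subr_ge0.
apply: mulr_ge0; first by apply: divr_ge0 => //; exact: ltW.
apply: mulr_ge0; last by apply: mulr_ge0 => //; rewrite /N; lra.
by apply: mulr_ge0; [|exact: powR_ge0].
Qed.

Lemma kap_bound : `|kap * c / 2| <= c / 2.
Proof.
have [_ _ c0 _] := dim_facts R hn; case/andP: kap01 => k0 k1.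
have c2 : 0 <= c / 2 by apply: divr_ge0 => //; exact: ltW.
by rewrite -mulrA normrM (ger0_norm k0) (ger0_norm c2) ler_piMl.
Qed.

Lemma prG1_bound s : 1 / 2 < s < 5 -> `|prG1 n kap F s| <= bndG1.
Proof.
have [h3 h1 c0 p1] := dim_facts R hn; have p0 : 0 <= p := le_trans ler01 p1.
have pm : 0 <= p - 1 by rewrite subr_ge0.
case/andP: kap01 => k0 k1.
move=> hs; have [F0 _ _ _] := HFG hs; have [FM GM] := FGM hs.
have hF : 0 < F s <= M by rewrite F0 FM.
have /andP[P0 P1] := powR_le_of_le p0 hF.
rewrite /prG1 mulNr normrN -/c /critical_pow -/p normrM [`|F s `^ p|]ger0_norm //.
by apply: ler_pM => //; exact: kap_bound.
Qed.

Lemma prG2_bound s : 1 / 2 < s < 5 -> `|prG2 n kap F G s| <= bndG2.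
Proof.
have [h3 h1 c0 p1] := dim_facts R hn; have p0 : 0 <= p := le_trans ler01 p1.
have pm : 0 <= p - 1 by rewrite subr_ge0.
case/andP: kap01 => k0 k1.
move=> hs; have [F0 _ _ _] := HFG hs; have [FM GM] := FGM hs.
have hF : 0 < F s <= M by rewrite F0 FM.
have /andP[P0 P1] := powR_le_of_le pm hF.
rewrite /prG2 mulNr normrN -/c -/p; apply: normM_le; first exact: kap_bound.
apply: normM_le; last exact: prF1_bound.
apply: normM_le; last by rewrite ger0_norm.
by rewrite ger0_norm.
Qed.

Variables (a : V) (alp : R).
Hypothesis aalp : forall i, `|a 0 i| <= alp.

Lemma approx_near x : 1 < dotp x x < 4 -> `|approx F G a x - F (dotp x x)| <= 2 * N * M * alp.
Proof.
move=> hx; have hs := annulus_sub hx.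
have [_ GM] := FGM hs.
rewrite /approx addrC addKr.
have x2 i : `|x 0 i| <= 2 by apply: coord_le2; case/andP: hx => _ /ltW.
have [i0] : exists i : 'I_n, True by exists (Ordinal (leq_trans (isT : (0 < 3)%N) hn)).
move=> _; have alp0 : 0 <= alp by apply: le_trans (aalp i0).
have h := dotp_le alp0 aalp x2.
apply: le_trans (normM_le h GM) _; rewrite -/N.
by rewrite [leLHS](_ : _ = 2 * N * M * alp) //; ring.
Qed.

Lemma dapprox_bound x i : 1 < dotp x x < 4 ->
  `|dapprox kap F G a i x - prF1 n F G (dotp x x) * (2 * x 0 i)| <= alp * (M + 8 * N * bndG1).
Proof.
move=> hx; have hs := annulus_sub hx.
have [_ GM] := FGM hs.
rewrite /dapprox addrC addKr.
have x2 j : `|x 0 j| <= 2 by apply: coord_le2; case/andP: hx => _ /ltW.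
have alp0 : 0 <= alp by apply: le_trans (aalp i).
have h := dotp_le alp0 aalp x2.
have h2 : `|2 * x 0 i| <= 2 * 2 by apply: normM_le => //; rewrite ger0_norm.
apply: le_trans (normD_le (normM_le (aalp i) GM) (normM_le h (normM_le (prG1_bound hs) h2))) _.
rewrite -/N [leLHS](_ : _ = alp * (M + 8 * N * bndG1)) //; ring.
Qed.

End Bounds.

(** [C] is chosen before the functional, the profile and the field because all of these vary with
    the scale. The condition on eps * (eps + alp + |kap - kap'|) makes the L^2 size of the gradient
    error, a geometric mean of the bounds on the difference and on its Laplacian, of order [del]. *)
Lemma flux_comparison (M A : R) : 0 < M -> 0 <= A -> exists2 C : R, 0 <= C &
  forall (J : (V -> R) -> R) (kap kap' H : R) (F G : R -> R) (a : V) (U : V -> R)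
    (dU : 'I_n -> V -> R) (ddU : 'I_n -> 'I_n -> V -> R) (X : V -> V) (lam : V -> R) (b : V)
    (eps alp del B : R),
  ibp_functional A J -> profile n kap' H F G -> 0 <= kap' <= 1 ->
  (forall s, 1 / 2 < s < 5 -> F s <= M /\ `|G s| <= M) ->
  C1 (@shell R n) U dU -> (forall i, C1 (@shell R n) (dU i) (ddU i)) ->
  (forall x, shell x -> \sum_i ddU i i x = - (kap * c) * critical_pow n (U x)) ->
  (forall x, shell x -> 0 < U x <= M) -> (forall x, shell x -> 0 < approx F G a x <= M) ->
  (forall x, 1 < dotp x x < 4 -> `|U x - approx F G a x| <= eps) ->
  (forall i, `|a 0 i| <= alp) -> alp <= 1 ->
  (forall i, shell_cont (fun x => X x 0 i)) -> shell_cont lam ->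
  (forall x, 1 < dotp x x < 4 -> (forall i, `|X x 0 i| <= B) /\ `|lam x| <= B) ->
  (forall i, `|b 0 i| <= B) -> 0 <= eps -> 0 <= B -> 0 < del <= 1 ->
  eps <= del -> `|kap - kap'| <= del -> eps * (eps + alp + `|kap - kap'|) <= del ^+ 2 ->
  `|J (fun x => bump (dotp x x) *
        flux kap (X x) (lam x) b (U x) (\row_i dU i x) x)
    - J (fun x => bump (dotp x x) *
        flux kap' (X x) (lam x) b (approx F G a x) (\row_i dapprox kap' F G a i x) x)|
    <= C * B * del.
Proof.
move=> M0 A0; have [h3 h1 c0 p1] := dim_facts R hn; have p0 : 0 <= p := le_trans ler01 p1.
have pm : 0 <= p - 1 by rewrite subr_ge0.
have N3 : 3 <= N by exact: h3.
have N0 : 0 <= N by lra.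
pose g1 := bndG1 M; pose g2 := bndG2 M.
have g10 : 0 <= g1 := bndG1_ge0 M.
have g20 : 0 <= g2 := bndG2_ge0 (ltW M0).
(* Bounds the gradient of [approx]: 4 N M comes from the radial part and M + 8 N g1 from the part
   linear in [a], as alp <= 1. *)
pose Mz := 4 * (N * M) + (M + 8 * N * g1).
have NM : 0 <= N * M by rewrite mulr_ge0 // ltW.
have Ng : 0 <= N * g1 by rewrite mulr_ge0.
have MMz : M <= Mz by rewrite /Mz; lra.
pose K1 := d ^+ 2 / 8 * M `^ (2 * N / d).
pose K2 := d ^+ 2 / 8 * (2 * N / d * M `^ (2 * N / d - 1)).
have d0 : 0 <= d by rewrite /d; rewrite /d in h1; lra.
have q0 : 0 <= 2 * N / d by rewrite divr_ge0 // mulr_ge0.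
have dd0 : 0 <= d ^+ 2 / 8 by rewrite divr_ge0 // sqr_ge0.
have K10 : 0 <= K1 by rewrite mulr_ge0 // powR_ge0.
have K20 : 0 <= K2 by apply: mulr_ge0 => //; apply: mulr_ge0 => //; exact: powR_ge0.
pose K := K1 + K2; have K0 : 0 <= K by exact: addr_ge0.
(* [K3 * (eps + alp + t)] will bound the Laplacian of the difference: one term for the change of
   coupling, one for the Lipschitz bound of u^p, one for the Laplacian of the part linear in [a]. *)
pose K3 := c * M `^ p + c * (p * M `^ (p - 1)) * (1 + 2 * N * M) + 2 * N * (20 * g2 + (2 * N + 4) * g1).
have cMp : 0 <= c * M `^ p by apply: mulr_ge0; [exact: ltW|exact: powR_ge0].
have cpM : 0 <= c * (p * M `^ (p - 1)).
  apply: mulr_ge0; first exact: ltW.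
  by apply: mulr_ge0; [|exact: powR_ge0].
have NMa : 0 <= 1 + 2 * N * M by rewrite -mulrA; lra.
have gg : 0 <= 20 * g2 + (2 * N + 4) * g1.
  by apply: addr_ge0; apply: mulr_ge0 => //; lra.
have K30 : 0 <= K3.
  by apply: addr_ge0; [apply: addr_ge0 => //; exact: mulr_ge0|do 2 apply: mulr_ge0 => //].
pose K4 := ((200 * N + 200 * 8) + 6 * K3) * A.
have K40 : 0 <= K4 by apply: mulr_ge0 => //; lra.
pose K5 := 2 + N + 7 * N * Mz + 2 * N * K + 2 * N ^+ 2 * Mz.
have K50 : 0 <= K5.
  have Mz0 : 0 <= Mz by exact: le_trans (ltW M0) MMz.
  rewrite /K5; do !apply: addr_ge0 => //; do !apply: mulr_ge0 => //.
exists (K5 * (2 * N * K4 + 18 * A)).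
  have NK4 : 0 <= N * K4 by exact: mulr_ge0.
  apply: mulr_ge0 => //; move: NK4 A0; clear; rewrite -(mulrA 2); lra.
move=> J kap kap' H F G a U dU ddU X lam b eps alp del B.
move=> HJ HFG k01 FGM CU CdU lapU Upos Apos Ueps aalp alp1 cX cl XB bB eps0 B0 /andP[del0 del1].
move=> epsd kapd epsad.
have CA := C1_approx HFG a.
have [dda [CdA lapA]] := C1_dapprox HFG a.
set t := `|kap - kap'|; have t0 : 0 <= t by exact: normr_ge0.
have alp0 : 0 <= alp.
  by apply: le_trans (aalp (Ordinal (leq_trans (isT : (0 < 3)%N) hn))).
have Cw := C1_sub_fun CU CA.
have Cdw i := C1_sub_fun (CdU i) (CdA i).
have sub x : 1 < dotp x x < 4 -> @shell R n x by exact: annulus_sub.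
have Lbound x : 1 < dotp x x < 4 ->
  `|\sum_i (ddU i i x - dda i i x)| <= K3 * (eps + alp + t).
  move=> hx; have Sx := sub x hx; have hs : 1 / 2 < dotp x x < 5 := Sx.
  have [F0 _ _ _] := HFG _ hs; have [FM GM] := FGM _ hs.
  rewrite sumrB lapU // lapA //.
  have x2 i : `|x 0 i| <= 2 by apply: coord_le2; case/andP: hx => _ /ltW.
  have UF : `|U x - F (dotp x x)| <= eps + 2 * N * M * alp.
    rewrite -[U x](subrK (approx F G a x)) -addrA; apply: normD_le; first exact: Ueps.
    exact: (approx_near FGM aalp).
  have hU := Upos x Sx; have hF : 0 < F (dotp x x) <= M by rewrite F0.
  have LU := powR_lipschitz p1 hU hF.
  have /andP[PU0 PUM] := powR_le_of_le p0 hU.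
  have -> : - (kap * c) * critical_pow n (U x) - (- (kap' * c) * critical_pow n (F (dotp x x)) +
     dotp a x * (4 * dotp x x * prG2 n kap' F G (dotp x x) + (2 * n%:R + 4) * prG1 n kap' F (dotp x x)))
   = - (c * ((kap - kap') * U x `^ p + kap' * (U x `^ p - F (dotp x x) `^ p)))
     - dotp a x * (4 * dotp x x * prG2 n kap' F G (dotp x x) + (2 * N + 4) * prG1 n kap' F (dotp x x)).
    by rewrite /critical_pow -/p -/N; ring.
  have k1 : `|kap'| <= 1 by case/andP: k01 => u1 u2; rewrite ger0_norm.
  have f1 : `|(kap - kap') * U x `^ p + kap' * (U x `^ p - F (dotp x x) `^ p)| <=
     t * M `^ p + 1 * (p * M `^ (p - 1) * (eps + 2 * N * M * alp)).
    apply: normD_le; apply: normM_le => //; first by rewrite ger0_norm.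
    apply: le_trans LU _; apply: ler_wpM2l => //.
    by apply: mulr_ge0 => //; exact: powR_ge0.
  have rho5 : `|4 * dotp x x| <= 4 * 5.
    by rewrite ger0_norm ?mulr_ge0 ?dotp_ge0 // ler_wpM2l // ltW //; case/andP: hs.
  have N4 : `|2 * N + 4| <= 2 * N + 4 by rewrite ger0_norm // addr_ge0 // mulr_ge0.
  have f3 := normM_le (dotp_le alp0 aalp x2) (normD_le (normM_le rho5 (prG2_bound HFG k01 FGM hs))
    (normM_le N4 (prG1_bound HFG k01 FGM hs))).
  have ca : `|c| <= c by rewrite gtr0_norm.
  rewrite -opprD normrN; apply: le_trans (normD_le (normM_le ca f1) f3) _.
  rewrite -/N -/g1 -/g2 -subr_ge0 (_ : _ - _ = (c * M `^ p) * (eps + alp)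
    + (c * (p * M `^ (p - 1))) * (alp + t + 2 * (N * M) * (eps + t))
    + 2 * (N * (20 * g2 + (2 * N + 4) * g1)) * (eps + t)); last first.
    rewrite /K3; move: (M `^ p) (M `^ (p - 1)) => m1 m2; ring.
  have et : 0 <= eps + t by exact: addr_ge0.
  have Ngg : 0 <= N * (20 * g2 + (2 * N + 4) * g1) by exact: mulr_ge0.
  apply: addr_ge0; first apply: addr_ge0.
  - by apply: mulr_ge0 => //; exact: addr_ge0.
  - apply: mulr_ge0 => //; apply: addr_ge0; first exact: addr_ge0.
    by apply: mulr_ge0 => //; apply: mulr_ge0.
  by apply: mulr_ge0 => //; apply: mulr_ge0.
pose w x := U x - approx F G a x; pose dw i x := dU i x - dapprox kap' F G a i x.
have L0 : 0 <= K3 * (eps + alp + t) by apply: mulr_ge0 => //; rewrite !addr_ge0.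
have Q := caccioppoli HJ A0 Cw Cdw Ueps Lbound eps0 L0.
have {Q}Q : J (fun x => bump (dotp x x) * \sum_i dw i x ^+ 2) <= K4 * del ^+ 2.
  apply: le_trans Q _; rewrite /K4 [leRHS]mulrAC; apply: ler_wpM2r => //.
  rewrite [leRHS]mulrDl; apply: lerD.
    apply: ler_wpM2l; first by apply: addr_ge0; apply: mulr_ge0.
    by rewrite lerXn2r // nnegrE ltW.
  have -> : 6 * eps * (K3 * (eps + alp + t)) = 6 * K3 * (eps * (eps + alp + t)) by ring.
  by apply: ler_wpM2l => //; apply: mulr_ge0.
have cU : shell_cont U by move=> x; exact: C1_cont CU.
have cdU i : shell_cont (dU i) by move=> x; exact: C1_cont (CdU i).
have cA : shell_cont (approx F G a) by move=> x; exact: C1_cont CA.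
have cdA i : shell_cont (dapprox kap' F G a i) by move=> x; exact: C1_cont (CdA i).
have cdw i : shell_cont (dw i) by move=> x; exact: C1_cont (Cdw i).
have rowc (f : 'I_n -> V -> R) : (forall i, shell_cont (f i)) ->
    forall i, shell_cont (fun x => (\row_j f j x) 0 i).
  move=> cf i; rewrite (_ : (fun x => _) = f i) //.
  by apply/funext => x; rewrite mxE.
have fU : shell_cont (fun x => flux kap (X x) (lam x) b (U x) (\row_i dU i x) x).
  apply: shell_cont_flux => //; first by move=> x /Upos/andP[].
  exact: rowc.
have fA : shell_cont (fun x => flux kap' (X x) (lam x) b (approx F G a x)
    (\row_i dapprox kap' F G a i x) x).
  apply: shell_cont_flux => //; first by move=> x /Apos/andP[].
  exact: rowc.
have ab := @bump_annular R.
have b1 := annular_bsupp ab fU; have b2 := annular_bsupp ab fA.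
rewrite -(fctnB HJ) //.
pose S x := \sum_i dw i x ^+ 2.
have cS : shell_cont S by apply: shell_cont_sum => i; exact: shell_contX.
have bS := annular_bsupp ab cS.
have bone := annular_bsupp ab (@shell_cont_cst R n 1).
have E0 : 0 <= K5 * B by exact: mulr_ge0.
(* Young's inequality l <= del + l^2 / del trades the linear gradient error for its square, which
   integrates to order del^2; the total is then of order [del]. *)
pose hh x := K5 * B * (2 / del * N) * (bump (dotp x x) * S x)
  + K5 * B * (3 * del) * (bump (dotp x x) * 1).
have bh : bsupp hh by apply: bsupp_add; exact: bsupp_scale.
apply: le_trans (fctn_norm_le HJ (h := hh) _ bh _) _.
- by apply: bsupp_ext (bsupp_scale_add (-1) b2 b1) => x; rewrite mulN1r addrC.
- move=> x; have [hx|nhx] := pselect (1 < dotp x x < 4); last first.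
    by rewrite ab.2 // !mul0r subrr normr0 /hh ab.2 // !mul0r !mulr0 addr0.
  rewrite -mulrBr normrM (ger0_norm (bump_ge0 _)) /hh.
  rewrite [leRHS](_ : _ = bump (dotp x x) * (K5 * B * (2 / del * N * S x + 3 * del))); last by ring.
  apply: ler_wpM2l; first exact: bump_ge0.
  have Sx := sub x hx; have hs : 1 / 2 < dotp x x < 5 := Sx.
  have /andP[U0 UM] := Upos x Sx; have /andP[A00 AM] := Apos x Sx.
  have x2 i : `|x 0 i| <= 2 by apply: coord_le2; case/andP: hx => _ /ltW.
  have ZM i : `|(\row_i dapprox kap' F G a i x) 0 i| <= Mz.
    rewrite mxE -[dapprox _ _ _ _ _ _](subrK (prF1 n F G (dotp x x) * (2 * x 0 i))) addrC.
    have t2 : `|2 : R| <= 2 by rewrite ger0_norm.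
    apply: le_trans (normD_le (normM_le (prF1_bound HFG FGM hs) (normM_le t2 (x2 i)))
      (dapprox_bound HFG k01 FGM aalp i hx)) _.
    rewrite /Mz -/g1 -/N; apply: lerD; first by rewrite [leLHS](_ : _ = 4 * (N * M)) //; ring.
    rewrite ler_piMl //; apply: addr_ge0; first exact: ltW.
    by rewrite -mulrA mulr_ge0.
  have uM : `|U x| <= Mz by rewrite (ger0_norm (ltW U0)); exact: le_trans UM MMz.
  have vM : `|approx F G a x| <= Mz by rewrite (ger0_norm (ltW A00)); exact: le_trans AM MMz.
  have Mz0 : 0 <= Mz by exact: le_trans (ltW M0) MMz.
  have eu : `|d ^+ 2 / 8 * energy_pow n (U x)| <= K.
    have /andP[e1 e2] := powR_le_of_le q0 (Upos x Sx).
    rewrite ger0_norm; last exact: mulr_ge0.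
    apply: le_trans (ler_wpM2l dd0 e2) _; by rewrite /K /K1 lerDl.
  have euv : `|d ^+ 2 / 8 * energy_pow n (U x) - d ^+ 2 / 8 * energy_pow n (approx F G a x)| <= K * eps.
    apply: le_trans (energy_lipschitz (Upos x Sx) (Apos x Sx)) _; rewrite -/K2.
    apply: ler_pM => //; [by rewrite /K lerDr|exact: Ueps].
  have [XBx lBx] := XB x hx.
  have FE := flux_error hn kap (\row_i dU i x) XBx lBx bB x2 ZM uM vM k01 B0 Mz0 K0 eu euv
    (Ueps x hx).
  apply: le_trans FE _; rewrite -/N -/K5 -/t.
  apply: ler_wpM2l => //.
  set D := _ - _; have DE i : D 0 i = dw i x by rewrite /D !mxE.
  have l2 := l1norm_sqr D; have l0 := l1norm_ge0 D.
  rewrite (eq_bigr (fun i => dw i x ^+ 2)) in l2; last by move=> i _; rewrite DE.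
  rewrite -/(S x) -/N in l2; move: l2 l0; move: (l1norm D) (S x) => l s l2 l0.
  have l3 : l <= del + l ^+ 2 / del.
    by rewrite -lerBlDl ler_pdivlMr //; exact: sub_mul_le_sqr.
  have l4 : l ^+ 2 <= l ^+ 2 / del.
    by rewrite ler_pdivlMr // ler_piMr // sqr_ge0.
  have l5 : 2 * (l ^+ 2 / del) <= 2 / del * N * s.
    rewrite (_ : 2 / del * N * s = 2 * (N * s / del)); last by field; rewrite gt_eqF.
    by apply: ler_wpM2l => //; apply: ler_wpM2r => //; rewrite invr_ge0 ltW.
  exact: sum_le_of_split l3 l4 l5 epsd kapd.
rewrite /hh (fctnD HJ) ?(fctnZ HJ) //; try exact: bsupp_scale.
have J1 : J (fun x => bump (dotp x x) * 1) <= 6 * A.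
  apply: le_trans (ler_norm _) _; apply: (fctn_bounded HJ) => //.
    by move=> x _; rewrite mulr1; have [] := bumps_bounded (dotp x x).
  by move=> x nx; rewrite ab.2 // mul0r.
apply: le_trans (lerD (ler_wpM2l _ Q) (ler_wpM2l _ J1)) _.
- by apply: mulr_ge0 => //; apply: mulr_ge0 => //; rewrite divr_ge0 // ltW.
- by apply: mulr_ge0 => //; apply: mulr_ge0 => //; exact: ltW.
rewrite [leLHS](_ : _ = K5 * (2 * N * K4 + 18 * A) * B * del) //.
by field; rewrite gt_eqF.
Qed.

End Comparison.

(** * Flux of a perturbed radial profile *)

Section RadialWeights.
Variables (R : realType) (n : nat).
Notation V := 'rV[R]_n.

Definition smooth_radial (h : R -> R) := exists h' : R -> R,
  forall s : R, 1 / 2 < s < 5 -> is_derive s 1 h (h' s) /\ {for s, continuous h'}.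

Lemma smooth_radial_cst r : smooth_radial (fun=> r).
Proof. by exists (fun=> 0) => s _; split; [exact: is_derive_cst|exact: cst_continuous]. Qed.

Lemma smooth_radial_id : smooth_radial id.
Proof. by exists (fun=> 1) => s _; split; [exact: is_derive_id|exact: cst_continuous]. Qed.

Lemma smooth_radialD h k : smooth_radial h -> smooth_radial k -> smooth_radial (fun s => h s + k s).
Proof.
move=> [h' Hh] [k' Hk]; exists (fun s => h' s + k' s) => s hs.
have [D1 c1] := Hh s hs; have [D2 c2] := Hk s hs.
by split; [exact: is_derive_add|exact: continuousD].
Qed.

Lemma smooth_radialM h k : smooth_radial h -> smooth_radial k -> smooth_radial (fun s => h s * k s).
Proof.
move=> [h' Hh] [k' Hk]; exists (fun s => h' s * k s + h s * k' s) => s hs.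
have [D1 c1] := Hh s hs; have [D2 c2] := Hk s hs.
split; first exact: is_derive_mul.
by apply: continuousD; apply: continuousM => //; apply: is_derive_continuous; eassumption.
Qed.

Lemma smooth_radialX h k : smooth_radial h -> smooth_radial (fun s => h s ^+ k).
Proof.
move=> Hh; elim: k => [|k IH]; first exact: smooth_radial_cst.
have -> : (fun s => h s ^+ k.+1) = (fun s => h s * h s ^+ k).
  by apply/funext => s; rewrite exprS.
exact: smooth_radialM.
Qed.

Lemma smooth_radial_powR h q : smooth_radial h -> (forall s, 1 / 2 < s < 5 -> 0 < h s) ->
  smooth_radial (fun s => h s `^ q).
Proof.
move=> [h' Hh] h0; exists (fun s => q * h s `^ (q - 1) * h' s) => s hs.
have [D1 c1] := Hh s hs; split.
  exact: is_derive1_comp (is_derive1_powR q (h0 s hs)) D1.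
apply: continuousM => //; apply: continuousM; first exact: cst_continuous.
exact: is_derive_continuous (is_derive1_comp (is_derive1_powR (q - 1) (h0 s hs)) D1).
Qed.

Lemma radial_weight h : smooth_radial h ->
  exists dq : 'I_n -> V -> R, [/\ C1 setT (fun x => bump (dotp x x) * h (dotp x x)) dq,
    bsupp (fun x : V => bump (dotp x x) * h (dotp x x))
  & forall (i j : 'I_n) (x : V), x 0 j * dq i x = x 0 i * dq j x].
Proof.
move=> [h' Hh]; have Ch := C1_radial (n := n) Hh.
have C2 := C1_ext0 Ch (C1_radial_weight (@is_derive_bump R) (@bump1_continuous R))
  (fun x => annular_near0 (@bump_annular R)).
eexists; split; first exact: C2.
  by apply: annular_bsupp; [exact: bump_annular|move=> x; exact: C1_cont Ch].
by move=> i j x /=; ring.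
Qed.

Lemma radial_weight_odd A J h v : (2 <= n)%N -> ibp_functional A J -> smooth_radial h ->
  J (fun x : V => bump (dotp x x) * (dotp v x * h (dotp x x))) = 0.
Proof.
move=> n2 HJ /radial_weight[dq [Cq bq rad]].
rewrite (_ : (fun x : V => _) = fun x => \sum_i v 0 i * (x 0 i * (bump (dotp x x) * h (dotp x x)))).
  rewrite (fctn_sum HJ) => [|i]; last by apply: bsupp_scale; exact: bsupp_mul_coord.
  rewrite big1 // => i _; rewrite (fctnZ HJ); last exact: bsupp_mul_coord.
  by rewrite (radial_odd HJ Cq bq rad i n2) mulr0.
apply/funext => x; rewrite [dotp v x]/dotp mulr_suml mulr_sumr; apply: eq_bigr => i _.
by move: (bump _) (h _) => y z; ring.
Qed.

Lemma radial_weight_even A J h v w : (2 <= n)%N -> ibp_functional A J -> smooth_radial h ->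
  J (fun x : V => bump (dotp x x) * (dotp v x * dotp w x * h (dotp x x))) =
  dotp w v / n%:R * J (fun x => bump (dotp x x) * (dotp x x * h (dotp x x))).
Proof.
move=> n2 HJ /radial_weight[dq [Cq bq rad]].
rewrite (_ : (fun x : V => bump _ * (dotp v x * _ * _)) =
   fun x => dotp w x * dotp v x * (bump (dotp x x) * h (dotp x x))).
  rewrite (radial_dotp HJ Cq bq rad w v n2); congr (_ * J _); apply/funext => x; ring.
apply/funext => x; ring.
Qed.

End RadialWeights.

(** * Conformal fields and their flux for a profile *)

Section FluxApprox.
Variables (R : realType) (n : nat).
Hypothesis hn : (3 <= n)%N.
Notation V := 'rV[R]_n.
Implicit Types (X Y Z y x b a : V) (u v lam kap : R).

Let d : R := n%:R - 2.
Let c : R := n%:R * (n%:R - 2) / 4.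
Let p : R := (n%:R + 2) / (n%:R - 2).
Let N : R := n%:R.

(* The conformal fields of R^n; the symmetric part of the differential is
   cdiv times the identity. *)
Definition cfield (X0 : V) (l0 : R) (S : 'M[R]_n) (b : V) (y : V) : V :=
  X0 + (l0 *: y + y *m S + (dotp b y *: y - (dotp y y / 2) *: b)).
Definition cdiv (l0 : R) (b y : V) : R := l0 + dotp b y.

Lemma critical_powM u : 0 < u -> critical_pow n u * u = energy_pow n u.
Proof.
move=> u0; have [h3 h1 _ _] := dim_facts R hn.
rewrite /critical_pow /energy_pow -[X in _ * X](powRr1 (ltW u0)) -powRD; last first.
  by rewrite (gt_eqF u0) implybT.
by congr (_ `^ _); field; rewrite gt_eqF //; lra.
Qed.

Section Pointwise.
Variables (kap H : R) (F G : R -> R).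
Hypothesis HFG : profile n kap H F G.
Let F1 := prF1 n F G.
Let G1 := prG1 n kap F.
Let en u := d ^+ 2 / 8 * energy_pow n u.

(** Radial coefficients of the flux: [fl4] belongs to the constant part of the field, [fl5] to [b],
    [fl3] to the dilation part, and [fl2], [fl1] to the first variation in [a] of the constant
    part. *)
Definition fl4 s := 2 * s * F1 s ^+ 2 + kap * en (F s).
Definition fl5 s := s / 2 * fl4 s + d * s * F s * F1 s - d / 4 * F s ^+ 2.
Definition fl3 s := s * fl4 s + d * s * F s * F1 s.
Definition fl2 s := 2 * s * F1 s * G s.
Definition fl1 s := 4 * s * F1 s * G1 s + kap * c * critical_pow n (F s) * G s.

(** The conserved energy in [profile] turns the dilation flux into a multiple of |x|^(2-n). *)
Lemma fl3E s : 1 / 2 < s < 5 -> fl3 s = s `^ ((2 - n%:R) / 2) * H / 2.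
Proof.
move=> hs; have [F0 _ _ E] := HFG hs; have s0 : s != 0 by rewrite gt_eqF //; lra.
rewrite -E /fl3 /fl4 /en /F1 /prF1 -/d; field; exact: s0.
Qed.

(** Under a radial average (a . x) (X0 . x) becomes |x|^2 (X0 . a) / n, so this combination is the
    coefficient of X0 . a; the energy evaluates it too, to twice the value of [fl3]. *)
Lemma fl12E s : 1 / 2 < s < 5 -> fl2 s + s * fl1 s / n%:R = s `^ ((2 - n%:R) / 2) * H.
Proof.
have [h3 h1 _ _] := dim_facts R hn.
move=> hs; have [F0 _ _ E] := HFG hs; have s0 : s != 0 by rewrite gt_eqF //; lra.
rewrite -E /fl2 /fl1 /F1 /G1 /prF1 /prG1 -(critical_powM F0) /c -/d.
move: (critical_pow _ _) => cp; rewrite /d; field; rewrite s0 /=.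
by rewrite gt_eqF //; lra.
Qed.

Lemma smooth_F : smooth_radial F.
Proof.
exists (prF1 n F G) => s hs; have [_ dF _ _] := HFG hs; split => //.
exact: is_derive_continuous (is_derive_prF1 HFG hs).
Qed.

Lemma smooth_G : smooth_radial G.
Proof.
exists (prG1 n kap F) => s hs; have [_ _ dG _] := HFG hs; split => //.
exact: is_derive_continuous (is_derive_prG1 HFG hs).
Qed.

Lemma smooth_F1 : smooth_radial F1.
Proof.
exists (prF2 n kap F G) => s hs; split; first exact: (is_derive_prF1 HFG hs).
exact: (prF2_continuous HFG).
Qed.

Lemma smooth_G1 : smooth_radial G1.
Proof.
exists (prG2 n kap F G) => s hs; split; first exact: (is_derive_prG1 HFG hs).
exact: (prG2_continuous HFG).
Qed.

Let cst := @smooth_radial_cst R.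

Lemma smooth_fl4 : smooth_radial fl4.
Proof.
apply: smooth_radialD.
  apply: smooth_radialM; last exact: smooth_radialX smooth_F1.
  exact: smooth_radialM (cst 2) (@smooth_radial_id R).
apply: smooth_radialM => //; apply: smooth_radialM => //.
apply: smooth_radial_powR; first exact: smooth_F.
by move=> s hs; have [] := HFG hs.
Qed.

Lemma smooth_FF1 : smooth_radial (fun s => d * s * F s * F1 s).
Proof.
apply: smooth_radialM smooth_F1; apply: smooth_radialM smooth_F.
exact: smooth_radialM (cst d) (@smooth_radial_id R).
Qed.

Lemma smooth_fl3 : smooth_radial fl3.
Proof.
apply: smooth_radialD smooth_FF1.
exact: smooth_radialM (@smooth_radial_id R) smooth_fl4.
Qed.

Lemma smooth_fl5 : smooth_radial fl5.
Proof.
rewrite /fl5; have -> : (fun s => s / 2 * fl4 s + d * s * F s * F1 s - d / 4 * F s ^+ 2) =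
  (fun s => (s / 2 * fl4 s + d * s * F s * F1 s) + - (d / 4) * F s ^+ 2).
  by apply/funext => s; rewrite mulNr.
apply: smooth_radialD; last exact: smooth_radialM (cst _) (smooth_radialX 2 smooth_F).
apply: smooth_radialD smooth_FF1; apply: smooth_radialM smooth_fl4.
exact: smooth_radialM (@smooth_radial_id R) (cst _).
Qed.

Lemma smooth_fl2 : smooth_radial fl2.
Proof.
apply: smooth_radialM smooth_G; apply: smooth_radialM smooth_F1.
exact: smooth_radialM (cst 2) (@smooth_radial_id R).
Qed.

Lemma smooth_fl1 : smooth_radial fl1.
Proof.
apply: smooth_radialD.
  apply: smooth_radialM smooth_G1; apply: smooth_radialM smooth_F1.
  exact: smooth_radialM (cst 4) (@smooth_radial_id R).
apply: smooth_radialM smooth_G; apply: smooth_radialM (cst _) _.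
apply: smooth_radial_powR; first exact: smooth_F.
by move=> s hs; have [] := HFG hs.
Qed.

Definition fl_main (X0 : V) (l0 : R) (b a x : V) : R :=
  dotp X0 x * fl4 (dotp x x) + dotp b x * fl5 (dotp x x) + l0 * fl3 (dotp x x)
  + dotp X0 a * fl2 (dotp x x) + dotp a x * dotp X0 x * fl1 (dotp x x).

Lemma smooth_shell_cont h : smooth_radial h -> shell_cont (fun x : V => h (dotp x x)).
Proof.
move=> [h' Hh] x Sx; have [D _] := Hh _ Sx.
exact: continuous_comp (@rho_continuous R n x) (is_derive_continuous D).
Qed.

(** The terms with [fl4] and [fl5] are odd in x and average to zero; in particular the part of order
    1 coming from a field that does not vanish at the centre disappears. *)
Lemma fctn_fl_main A J X0 l0 b a : ibp_functional A J ->
  J (fun x => bump (dotp x x) * fl_main X0 l0 b a x) =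
  J (fun x => bump (dotp x x) * dotp x x `^ ((2 - n%:R) / 2)) * (H * (dotp X0 a + l0 / 2)).
Proof.
move=> HJ; have n2 : (2 <= n)%N by exact: ltnW.
have cd (v : V) : shell_cont (fun x => dotp v x).
  apply: shell_cont_dotp => i; [exact: shell_cont_cst|exact: shell_cont_coord].
have c4 := smooth_shell_cont smooth_fl4; have c5 := smooth_shell_cont smooth_fl5.
have c3 := smooth_shell_cont smooth_fl3; have c2 := smooth_shell_cont smooth_fl2.
have c1 := smooth_shell_cont smooth_fl1.
have crho : shell_cont (fun x : V => dotp x x) by move=> x _; exact: rho_continuous.
have B (h : V -> R) : shell_cont h -> bsupp (fun x => bump (dotp x x) * h x).
  by move=> ch; apply: annular_bsupp => //; exact: bump_annular.
have b4 := B _ (shell_contM (cd X0) c4); have b5 := B _ (shell_contM (cd b) c5).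
have b3 := B _ c3; have b2 := B _ c2; have b1 := B _ (shell_contM (shell_contM (cd a) (cd X0)) c1).
have bs1 := B _ (shell_contM crho c1).
have bp : bsupp (fun x : V => bump (dotp x x) * dotp x x `^ ((2 - n%:R) / 2)).
  by apply: B; apply: shell_cont_powR => // x /andP[]; lra.
have lin5 f1 f2 f3 f4 f5 : bsupp f1 -> bsupp f2 -> bsupp f3 -> bsupp f4 -> bsupp f5 ->
   J (fun x : V => f1 x + f2 x + f3 x + f4 x + f5 x) = J f1 + J f2 + J f3 + J f4 + J f5.
  move=> h1 h2 h3 h4 h5; have h12 := bsupp_add h1 h2.
  have h123 := bsupp_add h12 h3; have h1234 := bsupp_add h123 h4.
  by rewrite (fctnD HJ h1234 h5) (fctnD HJ h123 h4) (fctnD HJ h12 h3) (fctnD HJ h1 h2).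
rewrite (_ : (fun x : V => _) = fun x =>
   bump (dotp x x) * (dotp X0 x * fl4 (dotp x x)) + bump (dotp x x) * (dotp b x * fl5 (dotp x x))
   + l0 * (bump (dotp x x) * fl3 (dotp x x)) + dotp X0 a * (bump (dotp x x) * fl2 (dotp x x))
   + bump (dotp x x) * (dotp a x * dotp X0 x * fl1 (dotp x x))); last first.
  by apply/funext => x; rewrite /fl_main; ring.
rewrite lin5 //; try exact: bsupp_scale.
rewrite (radial_weight_odd _ n2 HJ smooth_fl4) (radial_weight_odd _ n2 HJ smooth_fl5).
rewrite (radial_weight_even _ _ n2 HJ smooth_fl1) !(fctnZ HJ) //.
have E3 : J (fun x => bump (dotp x x) * fl3 (dotp x x)) =
    H / 2 * J (fun x => bump (dotp x x) * dotp x x `^ ((2 - n%:R) / 2)).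
  rewrite -(fctnZ HJ) //; congr J; apply/funext => x.
  have [hx|nx] := pselect (1 < dotp x x < 4); last by rewrite (bump_annular R).2 // !mul0r mulr0.
  by rewrite fl3E ?annulus_sub //; ring.
have E12 : J (fun x => bump (dotp x x) * fl2 (dotp x x)) +
      n%:R^-1 * J (fun x => bump (dotp x x) * (dotp x x * fl1 (dotp x x))) =
    H * J (fun x => bump (dotp x x) * dotp x x `^ ((2 - n%:R) / 2)).
  rewrite -!(fctnZ HJ) // -(fctnD HJ) //; last exact: bsupp_scale.
  congr J; apply/funext => x.
  have [hx|nx] := pselect (1 < dotp x x < 4); last by rewrite (bump_annular R).2 // !mul0r !mulr0 addr0.
  have -> : H * (bump (dotp x x) * dotp x x `^ ((2 - n%:R) / 2)) =
    bump (dotp x x) * (dotp x x `^ ((2 - n%:R) / 2) * H) by ring.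
  rewrite -(fl12E (annulus_sub hx)); ring.
rewrite E3 -[J (fun x => bump _ * fl2 _)](addrK (n%:R^-1 * J (fun x => bump (dotp x x) * (dotp x x * fl1 (dotp x x))))) E12.
by move: (J _) (J _) => j1 j2; ring.
Qed.

Lemma flux_split X0 X1 lam b u Y y : flux kap (X0 + X1) lam b u Y y =
  flux kap X0 0 0 u Y y + flux kap X1 lam b u Y y.
Proof. rewrite /flux !dotpDl dotp0l; ring. Qed.

(** The rotation part is tangent to the spheres, hence orthogonal to a radial gradient and to the
    normal, and contributes nothing. *)
Lemma flux_linear_radial l0 (S : 'M[R]_n) b x : S^T = - S ->
  flux kap (l0 *: x + x *m S + (dotp b x *: x - (dotp x x / 2) *: b)) (cdiv l0 b x) b
    (F (dotp x x)) ((2 * F1 (dotp x x)) *: x) x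
  = dotp b x * fl5 (dotp x x) + l0 * fl3 (dotp x x).
Proof.
move=> hS; rewrite /flux !(dotpZl, dotpZr, dotpDl, dotpNl) (dotp_skew x hS).
rewrite /cdiv /fl5 /fl3 /fl4 /en -/d.
by field.
Qed.

Lemma flux_constant_expand X0 u D x :
  flux kap X0 0 0 u ((2 * F1 (dotp x x)) *: x + D) x =
  dotp X0 x * fl4 (dotp x x) + 2 * dotp x x * F1 (dotp x x) * dotp X0 D
  + (dotp X0 D * dotp D x - 2^-1 * dotp D D * dotp X0 x
     + kap * (en u - en (F (dotp x x))) * dotp X0 x).
Proof.
rewrite /flux !(dotpZl, dotpZr, dotpDl, dotpDr) dotp0l (dotpC x D) /fl4 /en -/d.
by field.
Qed.

End Pointwise.

(** The field is its value [X0] at the centre plus a rest of size [B1]. At scale r both [B1] and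
    [alp] are of order r while [B0] is not small: the constant part needs an error quadratic in
    [alp], for the rest an error linear in [alp] will do, and both are then O(r^2). *)
Lemma flux_approx (M A : R) : 0 < M -> 0 <= A -> exists2 C : R, 0 <= C &
  forall (J : (V -> R) -> R) (kap H : R) (F G : R -> R) (a : V) (alp : R)
    (X0 : V) (l0 : R) (S : 'M[R]_n) (b : V) (B0 B1 : R),
  ibp_functional A J -> profile n kap H F G -> 0 <= kap <= 1 ->
  (forall s, 1 / 2 < s < 5 -> F s <= M /\ `|G s| <= M) ->
  (forall x, shell x -> 0 < approx F G a x <= M) ->
  (forall i, `|a 0 i| <= alp) -> alp <= 1 -> S^T = - S ->
  (forall i, `|X0 0 i| <= B0) -> `|l0| <= B1 -> (forall i j, `|S i j| <= B1) ->
  (forall i, `|b 0 i| <= B1) ->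
  `|J (fun x => bump (dotp x x) * flux kap (cfield X0 l0 S b x) (cdiv l0 b x) b
         (approx F G a x) (\row_i dapprox kap F G a i x) x)
    - J (fun x => bump (dotp x x) * dotp x x `^ ((2 - n%:R) / 2)) * (H * (dotp X0 a + l0 / 2))|
  <= C * (B1 * alp + B0 * alp ^+ 2).
Proof.
move=> M0 A0; have [h3 h1 c0 p1] := dim_facts R hn; have p0 : 0 <= p := le_trans ler01 p1.
have pm : 0 <= p - 1 by rewrite subr_ge0.
have N0 : 0 <= N by exact: ler0n.
pose g1 := bndG1 n M.
have g10 : 0 <= g1 := bndG1_ge0 hn M.
pose Mz := 4 * (N * M) + (M + 8 * N * g1).
have NM : 0 <= N * M by rewrite mulr_ge0 // ltW.
have Ng : 0 <= N * g1 by rewrite mulr_ge0.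
have Mg : 0 <= M + 8 * N * g1 by rewrite addr_ge0 ?(ltW M0) // -mulrA mulr_ge0.
have Mz0 : 0 <= Mz by rewrite addr_ge0 // mulr_ge0.
have NMMz : 4 * (N * M) <= Mz by rewrite lerDl.
have MMz : M <= Mz.
  apply: le_trans (_ : M + 8 * N * g1 <= _); first by rewrite lerDl -mulrA mulr_ge0.
  by rewrite lerDr mulr_ge0.
pose K1 := d ^+ 2 / 8 * M `^ (2 * N / d).
pose K2 := d ^+ 2 / 8 * (2 * N / d * M `^ (2 * N / d - 1)).
have d0 : 0 <= d by apply: le_trans ler01 h1.
have q0 : 0 <= 2 * N / d by rewrite divr_ge0 // mulr_ge0.
have dd0 : 0 <= d ^+ 2 / 8 by rewrite divr_ge0 // sqr_ge0.
have K10 : 0 <= K1 by rewrite mulr_ge0 // powR_ge0.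
have K20 : 0 <= K2 by apply: mulr_ge0 => //; apply: mulr_ge0 => //; exact: powR_ge0.
pose K := K1 + K2; have K0 : 0 <= K by exact: addr_ge0.
pose K5 := 2 + N + 7 * N * Mz + 2 * N * K + 2 * N ^+ 2 * Mz.
have K50 : 0 <= K5 by rewrite /K5; do !apply: addr_ge0 => //; do !apply: mulr_ge0 => //.
pose K6 := M + 8 * N * g1.
pose K7 := c * (p * M `^ (p - 1)).
have K70 : 0 <= K7.
  apply: mulr_ge0; first exact: ltW.
  by apply: mulr_ge0 => //; exact: powR_ge0.
pose E1 := K5 * (4 + 6 * N) * ((N * K6) ^+ 2 + N * K6 + 2 * (N * M)).
pose E2 := (2 + N) * (N * K6) ^+ 2 + 2 * N * (K7 * (2 * (N * M)) ^+ 2).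
have NK6 : 0 <= N * K6 by exact: mulr_ge0.
have E10 : 0 <= E1.
  apply: mulr_ge0; last by rewrite !addr_ge0 ?sqr_ge0 // mulr_ge0.
  by apply: mulr_ge0 => //; rewrite addr_ge0 // mulr_ge0.
have E20 : 0 <= E2.
  apply: addr_ge0; first by apply: mulr_ge0; [rewrite addr_ge0|exact: sqr_ge0].
  by apply: mulr_ge0; [rewrite mulr_ge0|apply: mulr_ge0 => //; exact: sqr_ge0].
exists (6 * (E1 + E2) * A); first by apply: mulr_ge0 => //; apply: mulr_ge0 => //; exact: addr_ge0.
move=> J kap H F G a alp X0 l0 S b B0 B1 HJ HFG k01 FGM Apos aalp alp1 hS XB lB SB bB.
have i0 : 'I_n := Ordinal (leq_trans (isT : (0 < 3)%N) hn).
have alp0 : 0 <= alp by apply: le_trans (aalp i0).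
have B00 : 0 <= B0 by apply: le_trans (XB i0).
have B10 : 0 <= B1 by apply: le_trans lB.
have alp2 : alp ^+ 2 <= alp by rewrite expr2 ler_piMl.
pose fl x := flux kap (cfield X0 l0 S b x) (cdiv l0 b x) b
         (approx F G a x) (\row_i dapprox kap F G a i x) x.
pose X1 (x : V) := l0 *: x + x *m S + (dotp b x *: x - (dotp x x / 2) *: b).
pose mn := fl_main kap F G X0 l0 b a.
have bnd x : 1 < dotp x x < 4 -> `|fl x - mn x| <= E1 * (B1 * alp) + E2 * (B0 * alp ^+ 2).
  move=> hx; have hs := annulus_sub hx; have Sx : shell x := hs.
  have [F0 _ _ _] := HFG _ hs; have [FM GM] := FGM _ hs.
  have hF : 0 < F (dotp x x) <= M by rewrite F0.
  have /andP[A00 AM] := Apos x Sx.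
  have x2 i : `|x 0 i| <= 2 by apply: coord_le2; case/andP: hx => _ /ltW.
  have rho4 : dotp x x <= 4 by case/andP: hx => _ /ltW.
  have two : `|2 : R| <= 2 by rewrite ger0_norm.
  pose Z0 := (2 * prF1 n F G (dotp x x)) *: x.
  pose D := G (dotp x x) *: a + (2 * dotp a x * prG1 n kap F (dotp x x)) *: x.
  have rowE : \row_i dapprox kap F G a i x = Z0 + D.
    by apply/rowP => i; rewrite !mxE /dapprox; ring.
  have Dle i : `|D 0 i| <= alp * K6.
    have := dapprox_bound hn HFG k01 FGM aalp i hx; rewrite -/N -/g1 -/K6.
    by congr (`|_| <= _); rewrite /dapprox !mxE; ring.
  have lD := l1norm_le Dle; have lD0 := l1norm_ge0 D.
  have lDe : l1norm D <= N * K6 * alp by apply: le_trans lD _; rewrite -/N mulrA mulrAC.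
  have lD2 : l1norm D ^+ 2 <= (N * K6) ^+ 2 * alp ^+ 2.
    by rewrite -exprMn; apply: lerXn2r; rewrite ?nnegrE ?mulr_ge0.
  have AF := approx_near hn FGM aalp hx.
  have Z0M i : `|Z0 0 i| <= Mz.
    rewrite mxE; apply: le_trans (normM_le (normM_le two (prF1_bound hn HFG FGM hs)) (x2 i)) _.
    by apply: le_trans NMMz; rewrite -/N [leLHS](_ : _ = 4 * (N * M)) //; ring.
  have uM : `|approx F G a x| <= Mz by rewrite (ger0_norm (ltW A00)); exact: le_trans AM MMz.
  have vM : `|F (dotp x x)| <= Mz by rewrite (ger0_norm (ltW F0)); exact: le_trans FM MMz.
  have eu : `|d ^+ 2 / 8 * energy_pow n (approx F G a x)| <= K.
    have /andP[e1 e2] := powR_le_of_le q0 (Apos x Sx).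
    rewrite ger0_norm; last exact: mulr_ge0.
    by apply: le_trans (ler_wpM2l dd0 e2) _; rewrite /K lerDl.
  have euv : `|d ^+ 2 / 8 * energy_pow n (approx F G a x) - d ^+ 2 / 8 * energy_pow n (F (dotp x x))|
      <= K * (2 * N * M * alp).
    apply: le_trans (energy_lipschitz hn (Apos x Sx) hF) _; rewrite -/K2.
    by apply: ler_pM => //; rewrite /K lerDr.
  have bx : `|dotp b x| <= N * B1 * 2 by exact: dotp_le.
  have X1B i : `|X1 x 0 i| <= (4 + 6 * N) * B1.
    have xS : `|(x *m S) 0 i| <= N * (2 * B1).
      rewrite mxE; apply: le_trans (ler_norm_sum _ _ _) _.
      apply: le_trans (ler_sum _ (fun j _ => normM_le (x2 j) (SB j i))) _.
      by rewrite sumr_const card_ord -(mulr_natl (2 * B1)).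
    have rr : `|dotp x x / 2| <= 2.
      rewrite ger0_norm; last by rewrite divr_ge0 // dotp_ge0.
      by rewrite ler_pdivrMr //; apply: le_trans rho4 _; rewrite -natrM.
    have := normD_le (normD_le (normM_le lB (x2 i)) xS) (normB_le (normM_le bx (x2 i)) (normM_le rr (bB i))).
    rewrite /X1 !mxE => h; apply: le_trans h _.
    by rewrite [leLHS](_ : _ = (4 + 6 * N) * B1) //; ring.
  have lamB : `|cdiv l0 b x| <= (4 + 6 * N) * B1.
    apply: le_trans (normD_le lB bx) _.
    rewrite -subr_ge0 (_ : _ - _ = 3 * B1 + 4 * (N * B1)); last by ring.
    by rewrite addr_ge0 // mulr_ge0 // mulr_ge0.
  have bB' i : `|b 0 i| <= (4 + 6 * N) * B1.
    apply: le_trans (bB i) _; rewrite ler_peMl // -subr_ge0 (_ : _ - _ = 3 + 6 * N); last by ring.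
    by rewrite addr_ge0 // mulr_ge0.
  have B1' : 0 <= (4 + 6 * N) * B1 by apply: mulr_ge0 => //; rewrite addr_ge0 // mulr_ge0.
  have FE := flux_error hn kap (Z0 + D) X1B lamB bB' x2 Z0M uM vM k01 B1' Mz0 K0 eu euv AF.
  have ZD : Z0 + D - Z0 = D by rewrite addrC addKr.
  rewrite ZD subrr normr0 addr0 -/N -/K5 in FE.
  (* The first bracket concerns the part of the field that vanishes at the centre and is left to
     [flux_error]; the second is the quadratic Taylor remainder of the constant part. *)
  have -> : fl x - mn x =
     (flux kap (X1 x) (cdiv l0 b x) b (approx F G a x) (Z0 + D) x
      - flux kap (X1 x) (cdiv l0 b x) b (F (dotp x x)) Z0 x)
     + (dotp X0 D * dotp D x - 2^-1 * dotp D D * dotp X0 x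
        + kap * (d ^+ 2 / 8 * energy_pow n (approx F G a x) - d ^+ 2 / 8 * energy_pow n (F (dotp x x))
          - c * critical_pow n (F (dotp x x)) * (approx F G a x - F (dotp x x))) * dotp X0 x).
    rewrite /fl rowE /cfield flux_split flux_constant_expand flux_linear_radial //.
    rewrite /mn /fl_main /D !(dotpDr, dotpZr) /fl2 /fl1 /approx -/d -/c /X1.
    by move: (prF1 _ _ _ _) (prG1 _ _ _ _) (critical_pow _ _) (energy_pow _ _) (flux _ _ _ _ _ _ _) => r1 r2 r3 r4 r5; ring.
  apply: normD_le.
    apply: le_trans FE _.
    have -> : E1 * (B1 * alp) = K5 * ((4 + 6 * N) * B1) *
       (((N * K6) ^+ 2 + N * K6 + 2 * (N * M)) * alp) by rewrite /E1; ring.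
    apply: ler_wpM2l; first exact: mulr_ge0.
    have -> : ((N * K6) ^+ 2 + N * K6 + 2 * (N * M)) * alp =
      (N * K6) ^+ 2 * alp + N * K6 * alp + 2 * N * M * alp by ring.
    rewrite lerD2r; apply: lerD => //; apply: le_trans lD2 _; apply: ler_wpM2l => //; exact: sqr_ge0.
  have XD : `|dotp X0 D| <= B0 * l1norm D by exact: dotp_le_l1.
  have Dx : `|dotp D x| <= 2 * l1norm D by rewrite dotpC; exact: dotp_le_l1.
  have DD : `|dotp D D| <= l1norm D ^+ 2.
    by rewrite ger0_norm; [exact: dotp_self_le_l1|exact: dotp_ge0].
  have Xx : `|dotp X0 x| <= N * B0 * 2 by exact: dotp_le.
  have h2 : `|2^-1 : R| <= 2^-1 by rewrite ger0_norm // invr_ge0.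
  have kk : `|kap| <= 1 by case/andP: k01 => u1 u2; rewrite ger0_norm.
  have T : `|d ^+ 2 / 8 * energy_pow n (approx F G a x) - d ^+ 2 / 8 * energy_pow n (F (dotp x x))
          - c * critical_pow n (F (dotp x x)) * (approx F G a x - F (dotp x x))|
       <= K7 * (2 * N * M * alp) ^+ 2.
    apply: le_trans (energy_taylor hn (Apos x Sx) hF) _; apply: ler_wpM2l => //.
    rewrite -[(_ - _) ^+ 2]real_normK ?num_real //; apply: lerXn2r => //; rewrite nnegrE //.
    by rewrite -(mulrA 2) mulr_ge0 // mulr_ge0.
  apply: le_trans (normD_le (normB_le (normM_le XD Dx) (normM_le (normM_le h2 DD) Xx))
    (normM_le (normM_le kk T) Xx)) _.
  have -> : B0 * l1norm D * (2 * l1norm D) + 2^-1 * l1norm D ^+ 2 * (N * B0 * 2) +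
     1 * (K7 * (2 * N * M * alp) ^+ 2) * (N * B0 * 2) =
     B0 * ((2 + N) * l1norm D ^+ 2 + 2 * N * (K7 * (2 * (N * M)) ^+ 2) * alp ^+ 2) by field.
  have -> : E2 * (B0 * alp ^+ 2) = B0 * ((2 + N) * ((N * K6) ^+ 2 * alp ^+ 2)
     + 2 * N * (K7 * (2 * (N * M)) ^+ 2) * alp ^+ 2) by rewrite /E2; ring.
  apply: ler_wpM2l => //; apply: lerD => //; apply: ler_wpM2l => //.
  exact: addr_ge0.
have ab := @bump_annular R.
have CA := C1_approx HFG a.
have [dda [CdA _]] := C1_dapprox HFG a.
have cA : shell_cont (approx F G a) by move=> x; exact: C1_cont CA.
have cdA i : shell_cont (dapprox kap F G a i) by move=> x; exact: C1_cont (CdA i).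
have cd (v : V) : shell_cont (fun x => dotp v x).
  by apply: shell_cont_dotp => i; [exact: shell_cont_cst|exact: shell_cont_coord].
have crho : shell_cont (fun x : V => dotp x x) by move=> x _; exact: rho_continuous.
have cX i : shell_cont (fun x => cfield X0 l0 S b x 0 i).
  rewrite (_ : (fun x => _) = fun x : V => X0 0 i + (l0 * x 0 i + \sum_j x 0 j * S j i
     + (dotp b x * x 0 i + - (dotp x x * (2^-1 * b 0 i))))); last first.
    by apply/funext => x; rewrite /cfield !mxE mulrA.
  have cst r := @shell_cont_cst R n r; have co j := @shell_cont_coord R n j.
  apply: shell_contD => //; apply: shell_contD; first apply: shell_contD.
  - exact: shell_contM.
  - by apply: shell_cont_sum => j; exact: shell_contM.
  apply: shell_contD; first exact: shell_contM.
  by apply: shell_contN; exact: shell_contM.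
have cl : shell_cont (cdiv l0 b) by apply: shell_contD => //; exact: shell_cont_cst.
have rowc i : shell_cont (fun x => (\row_j dapprox kap F G a j x) 0 i).
  rewrite (_ : (fun x => _) = dapprox kap F G a i) //.
  by apply/funext => x; rewrite mxE.
have cfl : shell_cont fl.
  by apply: shell_cont_flux => //; move=> x /Apos/andP[].
have cm : shell_cont mn.
  have c4 := smooth_shell_cont (smooth_fl4 HFG); have c5 := smooth_shell_cont (smooth_fl5 HFG).
  have c3 := smooth_shell_cont (smooth_fl3 HFG); have c2 := smooth_shell_cont (smooth_fl2 HFG).
  have c1 := smooth_shell_cont (smooth_fl1 HFG).
  apply: shell_contD; first apply: shell_contD; first apply: shell_contD; first apply: shell_contD.
  - exact: shell_contM.
  - exact: shell_contM.
  - by apply: shell_contM => //; exact: shell_cont_cst.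
  - by apply: shell_contM => //; exact: shell_cont_cst.
  by apply: shell_contM => //; exact: shell_contM.
have b1 := annular_bsupp ab cfl; have b2 := annular_bsupp ab cm.
rewrite -(fctn_fl_main HFG X0 l0 b a HJ) -(fctnB HJ) //.
apply: le_trans (_ : 6 * (E1 * (B1 * alp) + E2 * (B0 * alp ^+ 2)) * A <= _).
  have e0 : 0 <= E1 * (B1 * alp) + E2 * (B0 * alp ^+ 2).
    by apply: addr_ge0; apply: mulr_ge0 => //; apply: mulr_ge0 => //; exact: sqr_ge0.
  apply: (fctn_bounded HJ).
  - by apply: bsupp_ext (bsupp_scale_add (-1) b2 b1) => x; rewrite mulN1r addrC.
  - exact: mulr_ge0.
  - move=> x hx; rewrite -mulrBr normrM; apply: ler_pM => //; last exact: bnd.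
    by have [] := bumps_bounded (dotp x x).
  by move=> x nx; rewrite ab.2 // !mul0r subrr.
have h1' : 0 <= B1 * alp by exact: mulr_ge0.
have h2' : 0 <= B0 * alp ^+ 2 by apply: mulr_ge0 => //; exact: sqr_ge0.
rewrite -subr_ge0.
rewrite (_ : _ - _ = 6 * A * (E1 * (B0 * alp ^+ 2) + E2 * (B1 * alp))); last by ring.
by apply: mulr_ge0; [exact: mulr_ge0|apply: addr_ge0; exact: mulr_ge0].
Qed.

End FluxApprox.

(** * Behaviour of fluxes under scaling *)

Lemma mul_powR (R : realType) (t q : R) : 0 < t -> t * t `^ q = t `^ (1 + q).
Proof.
by move=> t0; rewrite -{1}(powRr1 (ltW t0)) -powRD // (gt_eqF t0) implybT.
Qed.

Section Scaling.
Variables (R : realType) (n : nat).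
Hypothesis hn : (3 <= n)%N.
Notation V := 'rV[R]_n.
Implicit Types (x y p a b X Y : V) (k s u kap lam : R).

Let d : R := n%:R - 2.
Let c : R := n%:R * (n%:R - 2) / 4.

(** Re-centring a conformal field at [p] and rescaling stays in the class. The new constant term is
    X(p), the rotation part absorbs b^T p - p^T b, and the parameters of degree 1 and 2 pick up s
    and s^2. *)
Lemma cfield_affine X0 l0 (S : 'M[R]_n) b p s y :
  cfield X0 l0 S b (p + s *: y) =
  cfield (cfield X0 l0 S b p) (s * cdiv l0 b p)
    (s *: (S + b^T *m p - p^T *m b)) (s ^+ 2 *: b) y.
Proof.
have mulT (u v w : V) : u *m (v^T *m w) = dotp u v *: w.
  rewrite mulmxA; have -> : u *m v^T = (dotp u v)%:M.
    apply/matrixP => i j; rewrite !mxE !ord1 eqxx mulr1n.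
    by apply: eq_bigr => m _; rewrite !mxE.
  exact: mul_scalar_mx.
apply/rowP => i; rewrite /cfield /cdiv.
rewrite !mulmxDl -!scalemxAr -!scalemxAl.
rewrite !(mulmxDl, mulmxDr, mulmxN) !mulT.
rewrite !(dotpDl, dotpDr, dotpZl, dotpZr) !mxE (dotpC y b) (dotpC y p).
by field.
Qed.

Lemma cdiv_affine l0 b p s y :
  s * cdiv l0 b (p + s *: y) = cdiv (s * cdiv l0 b p) (s ^+ 2 *: b) y.
Proof. by rewrite /cdiv dotpDr dotpZr dotpZl; ring. Qed.

Lemma skew_affine (S : 'M[R]_n) b p s : S^T = - S ->
  (s *: (S + b^T *m p - p^T *m b))^T = - (s *: (S + b^T *m p - p^T *m b)).
Proof.
move=> hS; rewrite linearZ /= -scalerN; congr (_ *: _).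
rewrite raddfB raddfD /= !trmx_mul !trmxK hS.
by apply/matrixP => i j; rewrite !mxE; ring.
Qed.

Lemma energy_powM k u : 0 < k -> 0 < u -> energy_pow n (k * u) = energy_pow n k * energy_pow n u.
Proof. by move=> k0 u0; rewrite /energy_pow powRM // ltW. Qed.

Lemma critical_powMM k u : 0 < k -> 0 < u ->
  critical_pow n (k * u) = critical_pow n k * critical_pow n u.
Proof. by move=> k0 u0; rewrite /critical_pow powRM // ltW. Qed.

(** The hypothesis relating [k], [s] and [kap] says that k U(p + s y) solves the equation with
    coupling [kap] when U solves it with coupling 1. For k = s^((n-2)/2) the coupling stays 1; for k
    = s^(n-2), used at infinity, it is s^-2. *)
Lemma flux_scaling kap k s X lam b u Y y : 0 < k -> 0 < u ->
  kap * critical_pow n k = k * s ^+ 2 ->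
  flux kap X (s * lam) (s ^+ 2 *: b) (k * u) ((k * s) *: Y) y =
  (k * s) ^+ 2 * flux 1 X lam b u Y y.
Proof.
move=> k0 u0 E; have E' : kap * energy_pow n k = (k * s) ^+ 2.
  by rewrite -(critical_powM hn k0) mulrA E; ring.
rewrite /flux !(dotpZl, dotpZr) (energy_powM k0 u0).
have -> : kap * ((n%:R - 2) ^+ 2 / 8 * (energy_pow n k * energy_pow n u)) =
   (k * s) ^+ 2 * ((n%:R - 2) ^+ 2 / 8 * energy_pow n u) by rewrite -E'; ring.
move: (energy_pow n u) => e; ring.
Qed.

Lemma C1_rescale D D' (f : V -> R) (g : 'I_n -> V -> R) p k s : C1 D f g ->
  (forall y, D' y -> D (p + s *: y)) ->
  C1 D' (fun y => k * f (p + s *: y)) (fun i y => k * s * g i (p + s *: y)).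
Proof.
move=> Cf H; have C := C1_scale k (@C1_affine R n D p s f g Cf).
by refine (C1_eq (C1_sub H C) _ _) => // i x; rewrite mulrA.
Qed.

End Scaling.

(** * The universal constant of the local fluxes *)

Section Omega.
Variables (R : realType) (n : nat).
Hypothesis hn : (3 <= n)%N.
Notation V := 'rV[R]_n.
Variable I : (V -> R) -> R.
Hypothesis HI : integral_like I.

(** Averages |x|^(2-n), the factor that [fl3E] and [fl12E] produce, over the annulus; its integral
    is the positive constant common to all singular points. *)
Definition newton_weight (x : V) : R := bump (dotp x x) * dotp x x `^ ((2 - n%:R) / 2).

Lemma ibp_functional_id : ibp_functional (6 ^+ n) I.
Proof.
have := rescaled_ibp_functional 0 (ltr01 : 0 < 1 :> R) HI.
rewrite (_ : rescaled I 0 1 = I) //; apply/funext => f; rewrite /rescaled expr1n mul1r.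
by congr I; apply/funext => x; rewrite add0r scale1r.
Qed.

Lemma newton_weight_bsupp : bsupp newton_weight.
Proof.
apply: annular_bsupp; first exact: bump_annular.
apply: shell_cont_powR; last by move=> x /andP[]; lra.
by move=> x _; exact: rho_continuous.
Qed.

Lemma newton_weight_continuous : continuous newton_weight.
Proof.
apply: annular_continuous; first exact: bump_annular.
apply: shell_cont_powR; last by move=> x /andP[]; lra.
by move=> x _; exact: rho_continuous.
Qed.

Definition cutoff_at (r : R) (x : V) : R := cutoff (r^-1 ^+ 2 * dotp x x).

Lemma C1_cutoff_at r : C1 setT (cutoff_at r)
  (fun i x => - bump (r^-1 ^+ 2 * dotp x x) * (r^-1 ^+ 2 * (2 * x 0 i))).
Proof.
apply: (@C1_comp _ _ _ _ (fun s => - bump s) (fun x => r^-1 ^+ 2 * dotp x x)).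
  exact: C1_scale (@C1_rho R n setT).
move=> x _; split; first exact: is_derive_cutoff.
by apply: continuousN; exact: bump_continuous.
Qed.

Lemma dotp_affine0 (r : R) (x : V) : dotp (r *: x) (r *: x) = r ^+ 2 * dotp x x.
Proof. by rewrite dotpZl dotpZr mulrA. Qed.

(* x |x|^-n is divergence free off the origin. *)
Lemma newton_weight_rescaled (p : V) (r : R) : 0 < r ->
  rescaled I (- (r^-1 *: p)) r^-1 newton_weight = I newton_weight.
Proof.
move=> r0; have [lin mono vol trans] := HI; have HJ := ibp_functional_id.
have ri : 0 < r^-1 by rewrite invr_gt0.
rewrite /rescaled.
have -> : I (fun x => newton_weight (- (r^-1 *: p) + r^-1 *: x)) =
    I (fun x => newton_weight (0 + r^-1 *: x)).
  have T := trans (fun x => newton_weight (0 + r^-1 *: x)) (- p)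
    (bsupp_affine 0 ri newton_weight_bsupp).
  rewrite -T; last first.
    move=> x; apply: (@continuous_comp _ _ _ (fun x : V => 0 + r^-1 *: x) newton_weight).
      by apply: continuousD; [exact: cst_continuous|exact: scaler_continuous].
    exact: newton_weight_continuous.
  rewrite (_ : (fun x => newton_weight (- _ + _)) = fun x => newton_weight (0 + r^-1 *: (x + - p))) //.
  by apply/funext => x; rewrite add0r scalerDr scalerN [- _ + _]addrC.
have bw := newton_weight_bsupp.
have bwr := bsupp_affine 0 ri bw.
pose D := [set x : V | 0 < dotp x x].
have CE i : C1 D (fun x => x 0 i * dotp x x `^ (- (n%:R / 2)))
   (fun j x => (j == i)%:R * dotp x x `^ (- (n%:R / 2)) +
       x 0 i * (- (n%:R / 2) * dotp x x `^ (- (n%:R / 2) - 1) * (2 * x 0 j))).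
  apply: C1_mul; first exact: C1_coord.
  refine (@C1_comp _ _ D (fun s => s `^ (- (n%:R / 2)))
    (fun s => - (n%:R / 2) * s `^ (- (n%:R / 2) - 1)) _ _ (@C1_rho R n D) _) => x Dx.
  split; first exact: is_derive1_powR.
  apply: continuousM; first exact: cst_continuous.
  exact: is_derive_continuous (is_derive1_powR _ Dx).
have near1 (s : R) : 0 < s -> \forall x \near (0 : V), cutoff_at s x = 1.
  move=> s0; have c0 : {for (0 : V), continuous (fun x : V => s^-1 ^+ 2 * dotp x x)}.
    by apply: continuousM; [exact: cst_continuous|exact: rho_continuous].
  have : \forall x \near (0 : V), s^-1 ^+ 2 * dotp x x < 1.
    by apply: cvgr_lt c0 _ _; rewrite dotp0l mulr0.
  by apply: filterS => x /ltW; exact: cutoff_in.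
(* The difference of the cutoffs at radii r and 1 vanishes near the origin and far away; the
   divergence of its product with x |x|^-n is twice the difference of the two weights to be
   compared. *)
have Cw := C1_sub_fun (C1_cutoff_at r) (C1_cutoff_at 1).
have w0 (x : V) : ~ D x -> \near x, cutoff_at r x - cutoff_at 1 x = 0.
  move=> nD; have -> : x = 0.
    apply/rowP => i; rewrite mxE; apply/eqP; rewrite -sqrf_eq0; apply/eqP/le_anti.
    rewrite sqr_ge0 andbT; apply: le_trans (coord_sqr_le x i) _.
    by rewrite leNgt; apply/negP.
  by have n1 := near1 r r0; have n2 := near1 1 ltr01; near=> x0;
    rewrite (near n1 x0) // (near n2 x0) // subrr.
have Cf i := C1_ext0 (CE i) Cw w0.
have bf i : bsupp (fun x : V => (cutoff_at r x - cutoff_at 1 x) * (x 0 i * dotp x x `^ (- (n%:R / 2)))).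
  apply: (@continuous_bsupp _ _ _ (2 * (r + 1))).
    by move=> x; exact: C1_cont (Cf i) Logic.I.
  move=> x j hx.
  have h4 : 4 * (r + 1) ^+ 2 <= dotp x x.
    apply: le_trans (coord_sqr_le x j); rewrite -[x 0 j ^+ 2]real_normK ?num_real //.
    rewrite (_ : 4 * _ = (2 * (r + 1)) ^+ 2); last by ring.
    by apply: lerXn2r; rewrite ?nnegrE // mulr_ge0 // addr_ge0 // ltW.
  rewrite /cutoff_at !cutoff_out ?subrr ?mul0r //.
    by rewrite invr1 expr1n mul1r; apply: le_trans h4; nra.
  rewrite exprVn mulrC ler_pdivlMr ?exprn_gt0 //; apply: le_trans h4.
  by rewrite ler_wpM2l //; apply: lerXn2r; rewrite ?nnegrE ?lerDl ?addr_ge0 ?ltW.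
have Z := fctn_sum HJ (fun i => C1_bsupp i (Cf i) (bf i)).
rewrite big1 in Z; last by move=> i _; exact: (fctn_ibp HJ i (Cf i) (bf i)).
have E x : \sum_i ((- bump (r^-1 ^+ 2 * dotp x x) * (r^-1 ^+ 2 * (2 * x 0 i)) -
       - bump (1^-1 ^+ 2 * dotp x x) * (1^-1 ^+ 2 * (2 * x 0 i))) *
      (x 0 i * dotp x x `^ (- (n%:R / 2))) +
      (cutoff_at r x - cutoff_at 1 x) *
      ((i == i)%:R * dotp x x `^ (- (n%:R / 2)) +
       x 0 i * (- (n%:R / 2) * dotp x x `^ (- (n%:R / 2) - 1) * (2 * x 0 i)))) =
   2 * (newton_weight x - r^-1 ^+ n * newton_weight (0 + r^-1 *: x)).
  have [Dx|nDx] := pselect (D x); last first.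
    have -> : x = 0.
      apply/rowP => i; rewrite mxE; apply/eqP; rewrite -sqrf_eq0; apply/eqP/le_anti.
      rewrite sqr_ge0 andbT; apply: le_trans (coord_sqr_le x i) _.
      by rewrite leNgt; apply/negP.
    have bz : bump 0 = 0 :> R by rewrite (bump_annular R).2 //; case/andP; lra.
    have nw0 : newton_weight 0 = 0 by rewrite /newton_weight dotp0l bz mul0r.
    rewrite [RHS](_ : _ = 0); last by rewrite scaler0 addr0 nw0 mulr0 subrr mulr0.
    rewrite big1 // => i _.
    rewrite (_ : cutoff_at r 0 = cutoff_at 1 0); last by rewrite /cutoff_at !dotp0l !mulr0.
    by rewrite mxE subrr !mul0r mulr0 addr0.
  have rho0 : dotp x x != 0 by rewrite gt_eqF.
  have P1 : dotp x x `^ (- (n%:R / 2)) = dotp x x * dotp x x `^ (- (n%:R / 2) - 1).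
    by rewrite mul_powR // addrC subrK.
  have P2 : dotp x x `^ ((2 - n%:R) / 2) = dotp x x * dotp x x `^ (- (n%:R / 2)).
    by rewrite mul_powR //; congr (_ `^ _); field.
  have nw1 : newton_weight x = bump (dotp x x) * (dotp x x * dotp x x `^ (- (n%:R / 2))).
    by rewrite /newton_weight P2.
  have nw2 : r^-1 ^+ n * newton_weight (0 + r^-1 *: x) =
     r^-1 ^+ 2 * bump (r^-1 ^+ 2 * dotp x x) * (dotp x x * dotp x x `^ (- (n%:R / 2))).
    rewrite /newton_weight add0r dotp_affine0 powRM ?exprn_ge0 ?(ltW ri) ?(ltW Dx) // P2.
    have Q : r^-1 ^+ n * (r^-1 ^+ 2) `^ ((2 - n%:R) / 2) = r^-1 ^+ 2.
      rewrite -!powR_mulrn ?(ltW ri) // -powRrM -powRD; last by rewrite (gt_eqF ri) implybT.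
      by congr (_ `^ _); field.
    by rewrite mulrCA [r^-1 ^+ n * _]mulrA Q mulrA [bump _ * _]mulrC.
  rewrite nw1 nw2 P1.
  rewrite invr1 expr1n mul1r.
  move: (dotp x x `^ (- (n%:R / 2) - 1)) (bump (r^-1 ^+ 2 * dotp x x)) (bump (dotp x x)).
  move: (cutoff_at r x - cutoff_at 1 x) => w t b1 b2.
  have S (al be : R) : \sum_(i < n) (al * (x 0 i * x 0 i) + be) = al * dotp x x + n%:R * be.
    by rewrite big_split /= -mulr_sumr sumr_const card_ord -(mulr_natl be).
  rewrite -[RHS](_ : (2 * (- b1 * r^-1 ^+ 2 + b2) * (dotp x x * t) - w * n%:R * t) * dotp x x
     + n%:R * (w * (dotp x x * t)) = _); last by ring.
  by rewrite -S; apply: eq_bigr => i _; rewrite eqxx /=; field; rewrite gt_eqF.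
move: Z; rewrite (_ : (fun x => \sum_i _) = fun x => 2 * (- r^-1 ^+ n * newton_weight (0 + r^-1 *: x) + newton_weight x)).
  rewrite (fctnZ HJ); last exact: bsupp_scale_add.
  rewrite lin // => /eqP; rewrite mulf_eq0 pnatr_eq0 /= mulNr addrC subr_eq0 => /eqP <-.
  by [].
by apply/funext => x; rewrite E mulNr [- _ + _]addrC.
Unshelve. all: by end_near. Qed.

Lemma newton_weight_pos : 0 < I newton_weight.
Proof.
have HJ := ibp_functional_id; have [lin mono vol trans] := HI.
have n0 : 0 < n%:R :> R by rewrite ltr0n; apply: leq_trans hn.
(* If all coordinates lie between sqrt(2/n) and sqrt(3/n), then 2 <= |x|^2 <= 3, well inside the
   annulus; a box of such points bounds the integral from below. *)
pose lo : R := Num.sqrt (2 / n%:R); pose hi : R := Num.sqrt (3 / n%:R).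
have lo2 : lo ^+ 2 = 2 / n%:R by rewrite sqr_sqrtr // divr_ge0 // ltW.
have hi2 : hi ^+ 2 = 3 / n%:R by rewrite sqr_sqrtr // divr_ge0 // ltW.
have lo0 : 0 < lo by rewrite sqrtr_gt0 divr_gt0.
have lohi : lo < hi by rewrite ltr_sqrt ?divr_gt0 // ltr_pM2r ?invr_gt0 // ltr_nat.
pose z : V := const_mx ((lo + hi) / 2); pose r := (hi - lo) / 2.
have r0 : 0 < r by rewrite divr_gt0 // subr_gt0.
have inbox (x : V) : (forall i, `|x 0 i - z 0 i| <= r) -> 2 <= dotp x x <= 3.
  move=> H; have xi i : lo <= x 0 i <= hi.
    by have := H i; rewrite mxE ler_norml /r => /andP[]; lra.
  have sumc (t : R) : \sum_(i < n) (t / n%:R) = t.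
    by rewrite sumr_const card_ord -(mulr_natl (t / n%:R)) mulrC divfK // gt_eqF.
  rewrite -(sumc 2) -(sumc 3) /dotp; apply/andP; split; apply: ler_sum => i _.
    have /andP[h1 h2] := xi i; rewrite -lo2 -expr2; apply: lerXn2r => //; rewrite nnegrE ltW //.
    exact: lt_le_trans lo0 h1.
  have /andP[h1 h2] := xi i; have x0 : 0 <= x 0 i by apply: ltW; exact: lt_le_trans lo0 h1.
  by rewrite -hi2 -expr2; apply: lerXn2r => //; rewrite nnegrE ltW // (lt_trans lo0).
have [e e0 He] : exists2 e : R, 0 < e & forall x, 2 <= dotp (x : V) x <= 3 -> e <= newton_weight x.
  (* For 2 <= s <= 3, [cut_in s] lies in [1/3, 2/3] and so [cut_out s] is at least 1 - (2/3)^4. *)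
  pose e1 : R := 16 / 3 * ((1 - (2 / 3) ^+ 4) ^+ 3 * (1 / 3) ^+ 3).
  pose e2 : R := 3 `^ ((2 - n%:R) / 2).
  have q0 : 0 <= 1 - (2 / 3 : R) ^+ 4 by rewrite !exprS expr0; lra.
  have q1 : 0 < 1 - (2 / 3 : R) ^+ 4 by rewrite !exprS expr0; lra.
  exists (e1 * e2).
    rewrite mulr_gt0 ?powR_gt0 //; apply: mulr_gt0; first by rewrite divr_gt0.
    by apply: mulr_gt0; apply: exprn_gt0 => //; rewrite divr_gt0.
  move=> x /andP[h1 h2]; apply: ler_pM.
  - apply: mulr_ge0; first by rewrite divr_ge0.
    by apply: mulr_ge0; apply: exprn_ge0 => //; rewrite divr_ge0.
  - exact: powR_ge0.
  - have ci : 1 / 3 <= cut_in (dotp x x) <= 2 / 3.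
      by rewrite /cut_in /pospart max_r; lra.
    have co : 1 - (2 / 3) ^+ 4 <= cut_out (dotp x x).
      rewrite /cut_out /pospart le_max; apply/orP; right; rewrite lerD2l lerN2.
      by case/andP: ci => c1 c2; apply: lerXn2r; rewrite ?nnegrE //; lra.
    apply: ler_wpM2l; first by rewrite divr_ge0.
    case/andP: ci => c1 c2.
    apply: ler_pM; [exact: exprn_ge0|by apply: exprn_ge0; rewrite divr_ge0| |].
      by apply: lerXn2r => //; rewrite nnegrE //; exact: le_trans co.
    by apply: lerXn2r => //; rewrite nnegrE ?divr_ge0 //; lra.
  rewrite /e2 /powR; do 2 (rewrite gt_eqF; last by lra).
  rewrite ler_expR; apply: ler_wnM2l; first by have := dim_facts R hn; case; lra.
  by rewrite ler_ln ?posrE //; lra.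
have bx := @box_bsupp R n z r.
apply: lt_le_trans (_ : e * I (box z r) <= _).
  by rewrite mulr_gt0 //; have /andP[h _] := vol z r r0; apply: lt_le_trans h; exact: exprn_gt0.
rewrite -(fctnZ HJ) //; apply: mono; [exact: bsupp_scale|exact: newton_weight_bsupp|].
move=> x; have [H|/existsNP[i /negP]] := pselect (forall i, `|x 0 i - z 0 i| <= r).
  by rewrite (box_in H) mulr1; apply: He; exact: inbox.
rewrite -ltNge => /box_out ->; rewrite mulr0.
by apply: mulr_ge0; [exact: bump_ge0|exact: powR_ge0].
Qed.

End Omega.

(** * The Fowler profile *)

(** [x], [y], [w], [q] stand for v'^2, v^2, (n-2)^2 and v^(4/(n-2)). Where q >= 2 the nonlinear term
    is at least twice the quadratic one, so the energy controls the amplitude. *)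
Lemma fowler_amplitude (R : realType) (x y w q h h' : R) :
  x - w / 4 * y + w / 4 * (y * q) = h -> 2 <= q -> h <= h' ->
  0 <= x -> 0 <= y -> 0 <= w -> y * w <= 4 * h'.
Proof.
move=> E q2 hh x0 y0 w0; have : 2 * (y * w) <= q * (y * w) by rewrite ler_wpM2r ?mulr_ge0.
lra.
Qed.

Section FowlerProfile.
Variables (R : realType) (n : nat).
Hypothesis hn : (3 <= n)%N.

Let d : R := n%:R - 2.
Let c : R := n%:R * (n%:R - 2) / 4.

Variables (eps : R) (v : R -> R).
Hypothesis (Hv : fowler_solution n eps v).
Let v' := derive1 v.

Lemma fowler_pos (t : R) : 0 < v t.
Proof. by have [/(_ t)[]] := Hv. Qed.

Lemma fowler_derive (t : R) : is_derive t 1 v (v' t).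
Proof. by have [/(_ t)[_ D _] _ _ _ _] := Hv; rewrite /v' derive1E; exact: derivableP. Qed.

Lemma fowler_derive2 (t : R) :
  is_derive t 1 v' (d ^+ 2 / 4 * v t - c * critical_pow n (v t)).
Proof.
have [/(_ t)[_ _ D] /(_ t) E _ _ _] := Hv.
have := derivableP D; rewrite -derive1E; apply: is_derive_ext => //.
by move: E; rewrite /critical_pow -/d -/c; lra.
Qed.

(** The equation makes the left side constant in time, and at 0 it reduces to H(eps) since v'(0) =
    0. *)
Lemma fowler_energy (t : R) :
  v' t ^+ 2 - d ^+ 2 / 4 * v t ^+ 2 + d ^+ 2 / 4 * energy_pow n (v t) = fowlerH n eps.
Proof.
have [h3 h1 c0 p1] := dim_facts R hn.
pose E s := v' s * v' s + ((- (d ^+ 2 / 4)) * (v s * v s) + 2 * (d ^+ 2 / 8 * energy_pow n (v s))).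
have DE (s : R) : is_derive s 1 E 0.
  have D1 := is_derive_mul (fowler_derive2 s) (fowler_derive2 s).
  have D2 := is_derive_mul (is_derive_cst (- (d ^+ 2 / 4)) s 1)
    (is_derive_mul (fowler_derive s) (fowler_derive s)).
  have D3 := is_derive_mul (is_derive_cst (2 : R) s 1)
    (is_derive1_comp (is_derive_energy hn (fowler_pos s)) (fowler_derive s)).
  apply: is_derive_ext (is_derive_add D1 (is_derive_add D2 D3)) => //.
  rewrite /= -/c -/d; move: (v' s) (v s) (critical_pow _ _) => y z w.
  by rewrite !mul0r !add0r; field.
have <- : E t = fowlerH n eps.
  rewrite (is_derive_0_is_cst t 0 DE) /E.
  have [_ _ _ [-> _] h0] := Hv; rewrite /v' h0 /fowlerH /energy_pow -/d.
  by move: (eps `^ _) => y; field.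
by rewrite /E; move: (energy_pow _ _) => y; field.
Qed.

Lemma fowler_bounded : exists2 M : R, 0 < M & forall t, v t <= M /\ `|v' t| <= M.
Proof.
have [h3 h1 c0 p1] := dim_facts R hn.
have d0 : 0 < d by apply: lt_le_trans h1.
set H := fowlerH n eps.
(* Below the threshold 2^(d/4) there is nothing to prove; above it v^(4/d) >= 2 and
   [fowler_amplitude] applies. *)
pose M1 := 2 `^ (d / 4) + 1 + 4 * `|H| / d ^+ 2.
have a0 : 0 < 2 `^ (d / 4) :> R by rewrite powR_gt0.
have b0 : 0 <= 4 * `|H| / d ^+ 2 by rewrite divr_ge0 ?sqr_ge0 // mulr_ge0.
have M10 : 0 < M1 by rewrite /M1; lra.
have vM t : v t <= M1.
  have E := fowler_energy t; rewrite -/H in E.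
  have v0 := fowler_pos t.
  have [h|h] := lerP (v t) (2 `^ (d / 4)); first by rewrite /M1; lra.
  have e2 : energy_pow n (v t) = v t ^+ 2 * v t `^ (4 / d).
    rewrite /energy_pow -powR_mulrn ?(ltW v0) // -powRD; last by rewrite (gt_eqF v0) implybT.
    by congr (_ `^ _); rewrite /d; field; rewrite -/d gt_eqF.
  have p2 : 2 <= v t `^ (4 / d).
    have -> : 2 = (2 `^ (d / 4)) `^ (4 / d) :> R.
      rewrite -powRrM (_ : d / 4 * (4 / d) = 1) ?powRr1 //.
      by field; rewrite gt_eqF.
    by apply: ge0_ler_powR; rewrite ?nnegrE ?divr_ge0 ?ltW.
  have k : v t ^+ 2 <= 4 * `|H| / d ^+ 2.
    rewrite ler_pdivlMr ?exprn_gt0 //; rewrite e2 in E.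
    exact: fowler_amplitude E p2 (ler_norm H) (sqr_ge0 (v' t)) (sqr_ge0 (v t)) (sqr_ge0 d).
  have : v t ^+ 2 <= (1 + 4 * `|H| / d ^+ 2) ^+ 2.
    apply: le_trans k _; move: b0; move: (4 * _ / _) => y y0; nra.
  rewrite ler_sqr ?nnegrE ?(ltW v0) ?addr_ge0 // => k2.
  by apply: le_trans k2 _; rewrite /M1; lra.
pose M2 := 1 + `|H| + d ^+ 2 / 4 * M1 ^+ 2.
have M20 : 0 <= d ^+ 2 / 4 * M1 ^+ 2 by rewrite mulr_ge0 ?sqr_ge0 // divr_ge0 ?sqr_ge0.
exists (M1 + M2); first by rewrite /M2; have := normr_ge0 H; lra.
move=> t; split; first by apply: le_trans (vM t) _; rewrite /M2; have := normr_ge0 H; lra.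
have E := fowler_energy t; rewrite -/H in E.
have v0 := fowler_pos t.
have e0 : 0 <= d ^+ 2 / 4 * energy_pow n (v t).
  by rewrite mulr_ge0 ?powR_ge0 // divr_ge0 ?sqr_ge0.
have k : v' t ^+ 2 <= `|H| + d ^+ 2 / 4 * M1 ^+ 2.
  have : d ^+ 2 / 4 * v t ^+ 2 <= d ^+ 2 / 4 * M1 ^+ 2.
    apply: ler_wpM2l; first by rewrite divr_ge0 ?sqr_ge0.
    by apply: lerXn2r (vM t); rewrite nnegrE ltW.
  have := ler_norm H; move: E e0; move: (d ^+ 2 / 4 * _) (d ^+ 2 / 4 * v t ^+ 2) => x y; lra.
have : v' t ^+ 2 <= M2 ^+ 2.
  apply: le_trans k _; rewrite /M2; have := normr_ge0 H; move: M20 => + z0.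
  move: (d ^+ 2 / 4 * _) `|H| z0 => y z z0 y0; nra.
have M2' : 0 <= M2 by rewrite /M2; have := normr_ge0 H; lra.
rewrite -[v' t ^+ 2]real_normK ?num_real // ler_sqr ?nnegrE // => k2.
by apply: le_trans k2 _; rewrite lerDr ltW.
Qed.

(** The Emden-Fowler change of variables written in s = |y|^2, where |y|^((2-n)/2) = s^((2-n)/4) and
    - log |y| = - ln s / 2. The shift [s0] will be T - ln r at scale r. *)
Definition fowF (s0 s : R) : R := s `^ ((2 - n%:R) / 4) * v (s0 + - 2^-1 * ln s).
Definition fowG (s0 s : R) : R :=
  s `^ ((2 - n%:R) / 4) * (- v' (s0 + - 2^-1 * ln s) + d / 2 * v (s0 + - 2^-1 * ln s)).

Lemma fowler_profile s0 : profile n 1 (fowlerH n eps) (fowF s0) (fowG s0).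
Proof.
have [h3 h1 c0 p1] := dim_facts R hn.
have d0 : d != 0 by rewrite gt_eqF // (lt_le_trans _ h1).
move=> s hs; have sp : 0 < s by lra.
have sn0 : s != 0 by rewrite gt_eqF.
set q : R := (2 - n%:R) / 4; set l := s0 + - 2^-1 * ln s.
have Dl : is_derive s 1 (fun t => s0 + - 2^-1 * ln t) (- 2^-1 * s^-1).
  apply: is_derive_ext (is_derive_add (is_derive_cst s0 s 1) (is_derive_mul (is_derive_cst (- 2^-1 : R) s 1) (is_derive1_ln sp))) => //.
  by rewrite mul0r !add0r.
have Dq : is_derive s 1 (fun t => t `^ q) (q * s `^ (q - 1)) by exact: is_derive1_powR.
have Dv : is_derive s 1 (fun t => v (s0 + - 2^-1 * ln t)) (v' l * (- 2^-1 * s^-1)).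
  exact: (@is_derive1_comp R v (fun t : R => s0 + - 2^-1 * ln t) s _ _ (fowler_derive l) Dl).
have Dv' : is_derive s 1 (fun t => v' (s0 + - 2^-1 * ln t))
    ((d ^+ 2 / 4 * v l - c * critical_pow n (v l)) * (- 2^-1 * s^-1)).
  exact: (@is_derive1_comp R v' (fun t : R => s0 + - 2^-1 * ln t) s _ _ (fowler_derive2 l) Dl).
have v0 := fowler_pos l.
have Pq : s `^ q = s * s `^ (q - 1) by rewrite mul_powR // addrC subrK.
have qE : q = - d / 4 by rewrite /q /d; lra.
split.
- by rewrite /fowF mulr_gt0 ?powR_gt0.
- apply: is_derive_ext (is_derive_mul Dq Dv) => //.
  rewrite /fowF /fowG -/q -/l Pq qE -/d; move: (s `^ _) (v l) (v' l) => x y z.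
  by field.
- have DG := is_derive_mul Dq (is_derive_add (is_derive_mul (is_derive_cst (-1 : R) s 1) Dv')
     (is_derive_mul (is_derive_cst (d / 2) s 1) Dv)).
  apply: is_derive_ext DG; first by move=> t; rewrite /fowG mulN1r.
  rewrite -/l /fowF -/l /critical_pow powRM ?powR_ge0 ?(ltW v0) // -powRrM.
  have -> : s `^ (q * ((n%:R + 2) / (n%:R - 2))) = s `^ (q - 1).
    by congr (_ `^ _); rewrite qE /d; field; rewrite -/d.
  rewrite !mul0r !add0r Pq qE mul1r -/c /= -/d.
  by move: (v l) (v' l) (s `^ _) => y z x; move: (y `^ _) => w; field.
rewrite -(fowler_energy l) /fowF /fowG -/q -/l.
have -> : energy_pow n (s `^ q * v l) = s `^ (- (n%:R / 2)) * energy_pow n (v l).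
  rewrite energy_powM ?powR_gt0 //; congr (_ * _); rewrite /energy_pow -powRrM; congr (_ `^ _).
  by rewrite qE /d; field; rewrite -/d.
have -> : s `^ ((2 - n%:R) / 2) = s `^ q * s `^ q.
  rewrite -powRD; last by rewrite sn0 implybT.
  by congr (_ `^ _); rewrite /q; field.
have E : s * s `^ (- (n%:R / 2)) = s `^ q * s `^ q.
  rewrite mul_powR // -powRD; last by rewrite sn0 implybT.
  by congr (_ `^ _); rewrite /q; field.
rewrite -/d mulr1.
have -> : d ^+ 2 / 4 * s * (s `^ (- (n%:R / 2)) * energy_pow n (v l)) =
   d ^+ 2 / 4 * (s * s `^ (- (n%:R / 2))) * energy_pow n (v l) by ring.
by rewrite E; move: (energy_pow n (v l)) (s `^ q) (v' l) (v l) => w x y z; field.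
Qed.

End FowlerProfile.

(** * The averaged flux in rescaled variables *)

Section FluxRescale.
Variables (R : realType) (n : nat).
Hypothesis hn : (3 <= n)%N.
Notation V := 'rV[R]_n.
Variable I : (V -> R) -> R.
Hypothesis HI : integral_like I.
Variables (U : V -> R) (dU : 'I_n -> V -> R).
Variables (X0 : V) (l0 : R) (S : 'M[R]_n) (b : V).

(* P . D (cutoff (|x - p|^2 / s^2)) = - 2 s^-2 cflux s p x for the Pohozaev
   field P. *)
Definition cflux (s : R) (p x : V) : R := bump (s^-1 ^+ 2 * dotp (x - p) (x - p)) *
  flux 1 (cfield X0 l0 S b x) (cdiv l0 b x) b (U x) (\row_i dU i x) (x - p).

Lemma shell_cont_cfield X1 l1 S1 (b1 : V) i : shell_cont (fun x => cfield X1 l1 S1 b1 x 0 i).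
Proof.
have crho : shell_cont (fun x : V => dotp x x) by move=> x _; exact: rho_continuous.
rewrite (_ : (fun x => _) = fun x : V => X1 0 i + (l1 * x 0 i + \sum_j x 0 j * S1 j i
     + (dotp b1 x * x 0 i + - (dotp x x * (2^-1 * b1 0 i))))); last first.
  by apply/funext => x; rewrite /cfield !mxE mulrA.
have cst r := @shell_cont_cst R n r; have co j := @shell_cont_coord R n j.
apply: shell_contD => //; apply: shell_contD; first apply: shell_contD.
- exact: shell_contM.
- by apply: shell_cont_sum => j; exact: shell_contM.
apply: shell_contD.
  by apply: shell_contM => //; apply: shell_cont_dotp => j.
by apply: shell_contN; exact: shell_contM.
Qed.

Lemma shell_cont_cdiv l1 (b1 : V) : shell_cont (cdiv l1 b1).
Proof.
apply: shell_contD; first exact: shell_cont_cst.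
by apply: shell_cont_dotp => j; [exact: shell_cont_cst|exact: shell_cont_coord].
Qed.

Section Rescaling.
Variables (D : set V) (kap k s : R) (p : V).
Hypotheses (k0 : 0 < k) (s0 : 0 < s) (E : kap * critical_pow n k = k * s ^+ 2).
Hypotheses (CU : C1 D U dU) (U0 : forall x, D x -> 0 < U x).
Hypothesis sD : forall y, shell y -> D (p + s *: y).

(** The integrand of [cflux] in the variable y = (x - p) / s, for the function k U(p + s y) and the
    field re-centred at [p]. *)
Let f y := bump (dotp y y) *
    flux kap (cfield (cfield X0 l0 S b p) (s * cdiv l0 b p) (s *: (S + b^T *m p - p^T *m b)) (s ^+ 2 *: b) y)
      (cdiv (s * cdiv l0 b p) (s ^+ 2 *: b) y) (s ^+ 2 *: b)
      (k * U (p + s *: y)) (\row_i (k * s * dU i (p + s *: y))) y.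

Lemma scaled_flux_bsupp : bsupp f.
Proof.
have Cf := @C1_rescale R n D (@shell R n) U dU p k s CU sD.
apply: annular_bsupp; first exact: bump_annular.
apply: shell_cont_flux.
- by move=> i; exact: shell_cont_cfield.
- exact: shell_cont_cdiv.
- by move=> y hy; exact: C1_cont Cf hy.
- by move=> y hy; rewrite mulr_gt0 // U0 //; exact: sD.
- by move=> i y hy; apply: continuous_near_eq (C1_dcont (i := i) Cf hy); near=> z; rewrite mxE.
Unshelve. all: by end_near. Qed.

Lemma cflux_scaled x : cflux s p x = (k ^+ 2 * s)^-1 * f (- (s^-1 *: p) + s^-1 *: x).
Proof.
have s1 : s != 0 by rewrite gt_eqF.
have k1 : k != 0 by rewrite gt_eqF.
rewrite /cflux /f.
set y := - (s^-1 *: p) + s^-1 *: x.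
have xE : x = p + s *: y.
  by rewrite /y scalerDr scalerN !scalerA divff // !scale1r addrA subrr add0r.
have xp : x - p = s *: y by rewrite {1}xE addrAC subrr add0r.
have -> : s^-1 ^+ 2 * dotp (x - p) (x - p) = dotp y y.
  by rewrite xp dotp_affine0 mulrA -exprMn mulVf // expr1n mul1r.
have [Sy|nSy] := pselect (shell y); last first.
  rewrite (bump_annular R).2 ?mul0r ?mulr0 //.
  by case/andP => h4 h5; apply: nSy; apply/andP; split; lra.
rewrite mulrCA; congr (_ * _); rewrite xp {1 2 3 4}xE cfield_affine -cdiv_affine.
rewrite (_ : \row_i (k * s * _) = (k * s) *: \row_i dU i (p + s *: y)); last first.
  by apply/rowP => i; rewrite !mxE.
rewrite flux_scaling //; last by apply: U0; exact: sD.
by rewrite /flux !dotpZr; field; rewrite s1 k1.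
Qed.

Lemma cflux_bsupp : bsupp (cflux s p).
Proof.
apply: (@bsupp_ext _ _ (fun x => (k ^+ 2 * s)^-1 * f (- (s^-1 *: p) + s^-1 *: x))).
  by move=> x; rewrite cflux_scaled.
apply: bsupp_scale; apply: bsupp_affine scaled_flux_bsupp; by rewrite invr_gt0.
Qed.

Lemma cflux_rescaled :
  s^-1 ^+ 2 * I (cflux s p) = s ^+ n / (s ^+ 3 * k ^+ 2) * rescaled I (- (s^-1 *: p)) s^-1 f.
Proof.
have [lin _ _ _] := HI.
have s1 : s != 0 by rewrite gt_eqF.
have k1 : k != 0 by rewrite gt_eqF.
rewrite (funext cflux_scaled) (functionalZ lin); last first.
  by apply: bsupp_affine scaled_flux_bsupp; rewrite invr_gt0.
rewrite /rescaled !exprVn.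
have sn : s ^+ n != 0 by rewrite expf_neq0.
move: (I _) (s ^+ n) sn => z w sn.
by field; rewrite k1 sn s1.
Qed.

End Rescaling.

End FluxRescale.

(** * The Fowler expansion on a rescaled annulus *)

Section FowlerExpansion.
Variables (R : realType) (n : nat).
Hypothesis hn : (3 <= n)%N.
Notation V := 'rV[R]_n.

Let d : R := n%:R - 2.

(** The bounds have to be uniform in [s0], which tends to infinity as the annulus shrinks to the
    singular point. *)
Lemma fowler_shell_bounds (eps : R) (v : R -> R) : 0 < eps -> fowler_solution n eps v ->
  exists m M : R, [/\ 0 < m, 0 < M & forall s0 s : R, 1 / 2 < s < 5 ->
    [/\ m <= fowF n v s0 s <= M, `|fowG n v s0 s| <= M & s `^ ((2 - n%:R) / 4) <= M]].
Proof.
move=> e0 Hv; have [h3 h1 c0 p1] := dim_facts R hn.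
have d0 : 0 <= d by rewrite /d; move: h1; lra.
have [M M0 HM] := fowler_bounded hn Hv.
pose K : R := (1 / 2) `^ ((2 - n%:R) / 4); pose m : R := 5 `^ ((2 - n%:R) / 4).
have K0 : 0 < K by rewrite powR_gt0 // divr_gt0.
have m0 : 0 < m by rewrite powR_gt0.
have q0 : (2 - n%:R) / 4 <= 0 :> R by move: h1; lra.
have powle (s t : R) : 0 < s -> s <= t -> t `^ ((2 - n%:R) / 4) <= s `^ ((2 - n%:R) / 4).
  move=> s0 st; have t0 : 0 < t := lt_le_trans s0 st.
  rewrite /powR !gt_eqF // ler_expR; apply: ler_wnM2l => //.
  by rewrite ler_ln ?posrE.
have M20 : 0 <= M + d / 2 * M by rewrite addr_ge0 ?(ltW M0) // mulr_ge0 ?(ltW M0) // divr_ge0.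
exists (m * eps), (K * (M + d / 2 * M) + K); split.
- exact: mulr_gt0.
- by rewrite ltr_wpDl // mulr_ge0 // ltW.
move=> s0 s /andP[s1 s2].
have sK : s `^ ((2 - n%:R) / 4) <= K by apply: powle; [rewrite divr_gt0|exact: ltW].
have sm : m <= s `^ ((2 - n%:R) / 4).
  by apply: powle; [apply: lt_trans s1; rewrite divr_gt0|exact: ltW].
have sp := powR_ge0 s ((2 - n%:R) / 4).
have [vM v'M] := HM (s0 + - 2^-1 * ln s).
have [_ _ _ [_ ev] _] := Hv; have {}ev := ev (s0 + - 2^-1 * ln s).
have v0 : 0 <= v (s0 + - 2^-1 * ln s) by apply: le_trans ev; exact: ltW.
have MM : M <= M + d / 2 * M by rewrite lerDl mulr_ge0 ?(ltW M0) // divr_ge0.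
have KM : K * (M + d / 2 * M) <= K * (M + d / 2 * M) + K by rewrite lerDl ltW.
split.
- apply/andP; split; first by rewrite /fowF; apply: ler_pM => //; exact: ltW.
  apply: le_trans KM; rewrite /fowF; apply: ler_pM => //; exact: le_trans MM.
- apply: le_trans KM; apply: normM_le; first by rewrite ger0_norm.
  apply: normD_le; first by rewrite normrN.
  by apply: normM_le; rewrite ger0_norm ?divr_ge0.
by apply: le_trans sK _; rewrite lerDr mulr_ge0 // ltW.
Qed.

Lemma shell_coord (x : V) i : shell x -> `|x 0 i| <= 3.
Proof.
case/andP => _ /ltW h; have := le_trans (coord_sqr_le x i) h.
rewrite -real_normK ?num_real // => k; have := normr_ge0 (x 0 i); nra.
Qed.

(** The remainder has the form r (r^h)^2 because the gradient error will be the geometric mean of it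
    and of a Laplacian of order r, that is r r^h. *)
Lemma fowler_expansion (U : V -> R) (p : V) (eps : R) (a : V) : fowler_parameters U p eps a ->
  exists (v : R -> R) (T h K r0 : R), [/\ fowler_solution n eps v, 0 < h <= 1, 0 <= K, 0 < r0 <= 1 &
    forall r, 0 < r < r0 -> forall x : V, shell x ->
    `|r `^ ((n%:R - 2) / 2) * U (p + r *: x) -
      approx (fowF n v (T - ln r)) (fowG n v (T - ln r)) (r *: a) x| <= K * (r * (r `^ h) ^+ 2)].
Proof.
move=> [/andP[e0 _] [v [T [be [C [Hv be1 Hn]]]]]].
have [m [M [m0 M0 HM]]] := fowler_shell_bounds e0 Hv.
(* Half of the excess of [be] over 1, capped so that r <= r^h for r < 1: the errors of order r^2
   must be bounded by r r^h as well. *)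
pose h := Num.min (be - 1) 1 / 2.
have mn0 : 0 < Num.min (be - 1) 1 by rewrite lt_min ltr01 andbT subr_gt0.
have h0 : 0 < h by rewrite divr_gt0.
have mn1 : Num.min (be - 1) 1 <= 1 by rewrite ge_min lexx orbT.
have hbe : h *+ 2 <= be - 1.
  rewrite -mulr_natr /h divfK //; by rewrite ge_min lexx.
exists v, T, h, (M * (`|C| * 3 `^ be)).
have /nbhs_ballP[dl /= dl0 Hd] : \forall y \near (0 : V), (y != 0)%R ->
   let s := - ln (enorm y) + T in exists2 r : R, `|r| <= C * enorm y `^ be
   & U (p + y) = enorm y `^ ((2 - n%:R) / 2) *
     (v s + dotp a y * (- derive1 v s + (n%:R - 2) / 2 * v s) + r) by [].
(* Coordinates on the shell are at most 3 in absolute value, so r < dl / 4 keeps r x in the ball of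
   the expansion. *)
exists (Num.min 1 (dl / 4)); split => //.
- by rewrite h0 /h; lra.
- by rewrite !mulr_ge0 ?powR_ge0 // ltW.
- by rewrite lt_min ltr01 divr_gt0 //= ge_min lexx.
move=> r /andP[r0]; rewrite lt_min => /andP[r1 rd] x Sx.
have /andP[x1 x5] := Sx.
have xx0 : 0 < dotp x x by apply: lt_trans x1; rewrite divr_gt0.
have x0 : x != 0 by apply: contraTneq xx0 => ->; rewrite dotp0l ltxx.
have rx0 : r *: x != 0 by rewrite scaler_eq0 negb_or x0 andbT gt_eqF.
have ball_rx : ball (0 : V) dl (r *: x).
  rewrite -ball_normE /ball_ /= sub0r normrN.
  have : `|r *: x| <= r * 3.
    apply/norm_leP; first by rewrite mulr_ge0 // ltW.
    by move=> i; rewrite mxE normrM gtr0_norm // ler_wpM2l ?(ltW r0) // shell_coord.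
  by move=> k; apply: le_lt_trans k _; lra.
have [e he ->] := Hd _ ball_rx rx0.
set q := Num.sqrt (dotp x x).
have q0 : 0 < q by rewrite sqrtr_gt0.
have qE : enorm (r *: x) = r * q.
  by rewrite /enorm dotp_affine0 sqrtrM ?sqr_ge0 // sqrtr_sqr gtr0_norm.
rewrite qE in he *.
have qp t : (r * q) `^ t = r `^ t * q `^ t by rewrite powRM // ltW.
have lq : ln q = 2^-1 * ln (dotp x x).
  have -> : dotp x x = q * q by rewrite -expr2 sqr_sqrtr // ltW.
  by rewrite lnM ?posrE // -mulr2n -(mulr_natl (ln q)) mulrA mulVf // mul1r.
have sE : - ln (r * q) + T = T - ln r + - 2^-1 * ln (dotp x x).
  by rewrite lnM ?posrE // lq; ring.
have q4 : q `^ ((2 - n%:R) / 2) = dotp x x `^ ((2 - n%:R) / 4).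
  have -> : dotp x x = q `^ 2 by rewrite powR_mulrn ?(ltW q0) // sqr_sqrtr // ltW.
  by rewrite -powRrM; congr (_ `^ _); field.
have rr : r `^ ((n%:R - 2) / 2) * r `^ ((2 - n%:R) / 2) = 1.
  rewrite -powRD; last by rewrite (gt_eqF r0) implybT.
  by rewrite (_ : (n%:R - 2) / 2 + (2 - n%:R) / 2 = 0) ?powRr0 //; field.
rewrite sE qp q4 /approx /fowF /fowG.
set s := dotp x x `^ _; set t := T - ln r + _.
rewrite (_ : _ - _ = s * e); last first.
  rewrite dotpZl dotpZr mulrA [r `^ _ * (_ * _)]mulrA rr mul1r; ring.
have [_ _ sM] := HM 0 _ Sx.
rewrite -!mulrA; apply: normM_le; first by rewrite ger0_norm ?powR_ge0.
apply: le_trans he _; apply: le_trans (_ : `|C| * (r * q) `^ be <= _).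
  by rewrite ler_wpM2r ?powR_ge0 // ler_norm.
rewrite qp [r `^ be * _]mulrC; apply: ler_wpM2l => //; apply: ler_pM; rewrite ?powR_ge0 //.
  apply: ge0_ler_powR; rewrite ?nnegrE ?(ltW q0) //; first by lra.
  rewrite -ler_sqr ?nnegrE ?(ltW q0) // sqr_sqrtr ?(ltW xx0) //.
  by apply: le_trans (ltW x5) _; lra.
rewrite -powR_mulrn ?powR_ge0 // -powRrM -{2}(powRr1 (ltW r0)) -powRD; last by rewrite (gt_eqF r0) implybT.
rewrite /powR gt_eqF // ler_expR; apply: ler_wnM2r; last by rewrite mulr_natr; lra.
by apply: ln_le0; exact: ltW.
Qed.

End FowlerExpansion.

(** * Flux at a singular point *)

Lemma powR_cvg_bound (R : realType) (f : R -> R) (l K h : R) : 0 < h ->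
  (\forall r \near 0^'+, `|f r - l| <= K * r `^ h) -> f @ 0^'+ --> l.
Proof.
move=> h0 Hf; apply/cvgrPdist_le => e e0.
pose K' := `|K| + 1; have K0 : 0 < K' by rewrite ltr_wpDl.
have dl0 : 0 < (e / K') `^ h^-1 by rewrite powR_gt0 // divr_gt0.
near=> r; have r0 : 0 < r by near: r; exact: nbhs_right_gt.
have rd : r <= (e / K') `^ h^-1 by near: r; exact: nbhs_right_le.
rewrite distrC; apply: le_trans (near Hf r _) _ => //.
have rh : r `^ h <= e / K'.
  have -> : e / K' = ((e / K') `^ h^-1) `^ h.
    by rewrite -powRrM mulVf ?gt_eqF // powRr1 // ltW // divr_gt0.
  by apply: ge0_ler_powR; rewrite ?nnegrE ?powR_ge0 // ltW.
apply: le_trans (_ : K' * (e / K') <= _); last by rewrite mulrC divfK // gt_eqF.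
apply: le_trans (_ : K' * r `^ h <= _); last by rewrite ler_wpM2l // ltW.
rewrite ler_wpM2r ?powR_ge0 //; apply: le_trans (ler_norm K) _; by rewrite lerDl.
Unshelve. all: by end_near. Qed.

Lemma coord_le_sum (R : realType) n (x : 'rV[R]_n) i : `|x 0 i| <= \sum_j `|x 0 j|.
Proof. by rewrite (bigD1 i) //= lerDl sumr_ge0. Qed.

Lemma entry_le_sum (R : realType) n (S : 'M[R]_n) i j : `|S i j| <= \sum_k \sum_l `|S k l|.
Proof.
rewrite (bigD1 i) //= (bigD1 j) //= -addrA lerDl addr_ge0 ?sumr_ge0 // => k _.
exact: sumr_ge0.
Qed.

Lemma le_of_dist (R : realType) (x y e M : R) : `|x - y| <= e -> e <= 1 -> y <= M -> x <= M + 1.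
Proof. by rewrite ler_norml => /andP[_]; lra. Qed.

Lemma gt0_of_dist (R : realType) (x y e m : R) : `|x - y| <= e -> e < m -> m <= y -> 0 < x.
Proof. by rewrite ler_norml => /andP[+ _]; lra. Qed.

Lemma coef_bounds (R : realType) (m : R) : 3 <= m ->
  [/\ 0 <= 4 + 6 * m, 1 + 2 * m <= 4 + 6 * m & 1 <= 4 + 6 * m].
Proof. by move=> h; split; lra. Qed.

Lemma local_flux_arith (R : realType) (r t x y w H A l C1 C2 B K L al B0 : R) :
  0 < r -> r <= t -> 0 <= C2 -> 0 <= L * al + B0 * al ^+ 2 ->
  `|x - y| <= C1 * B * (K * (r * t)) ->
  `|y - w * (H * (r * A + r * l / 2))| <= C2 * (r * L * (r * al) + B0 * (r * al) ^+ 2) ->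
  `|r^-1 * x - w * (H * (A + l / 2))| <= (C1 * B * K + C2 * (L * al + B0 * al ^+ 2)) * t.
Proof.
move=> r0 rt C20 Q0 h1 h2.
have -> : r^-1 * x - w * (H * (A + l / 2)) = r^-1 * ((x - y) + (y - w * (H * (r * A + r * l / 2)))).
  by field; rewrite gt_eqF.
rewrite normrM gtr0_norm ?invr_gt0 // mulrC ler_pdivrMr //.
apply: le_trans (normD_le h1 h2) _.
rewrite -subr_ge0 (_ : _ - _ = r * (C2 * (L * al + B0 * al ^+ 2)) * (t - r)); last by ring.
by rewrite mulr_ge0 ?subr_ge0 // mulr_ge0 ?(ltW r0) // mulr_ge0.
Qed.

Section Local.
Variables (R : realType) (n : nat).
Hypothesis hn : (3 <= n)%N.
Notation V := 'rV[R]_n.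
Variable I : (V -> R) -> R.
Hypothesis HI : integral_like I.
Let c : R := n%:R * (n%:R - 2) / 4.

Variables (D : set V) (U : V -> R) (dU : 'I_n -> V -> R) (ddU : 'I_n -> 'I_n -> V -> R).
Hypotheses (CU : C1 D U dU) (CdU : forall i, C1 D (dU i) (ddU i)).
Hypothesis U0 : forall x, D x -> 0 < U x.
Hypothesis yamabe : forall x, D x -> \sum_i ddU i i x = - c * critical_pow n (U x).

Variables (X0 : V) (l0 : R) (S : 'M[R]_n) (b : V).
Hypothesis skewS : S^T = - S.

Lemma cfield_le (X1 : V) (l1 : R) (S1 : 'M[R]_n) (b1 : V) (B0 B1 : R) (x : V) : dotp x x <= 4 ->
  (forall i, `|X1 0 i| <= B0) -> `|l1| <= B1 -> (forall i j, `|S1 i j| <= B1) ->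
  (forall i, `|b1 0 i| <= B1) ->
  (forall i, `|cfield X1 l1 S1 b1 x 0 i| <= B0 + (4 + 6 * n%:R) * B1) /\
  `|cdiv l1 b1 x| <= (1 + 2 * n%:R) * B1.
Proof.
move=> x4 XB lB SB bB.
have x2 i : `|x 0 i| <= 2 by exact: coord_le2.
have B10 : 0 <= B1 by apply: le_trans lB.
have bx : `|dotp b1 x| <= n%:R * B1 * 2 by exact: dotp_le.
have xS i : `|(x *m S1) 0 i| <= n%:R * 2 * B1.
  rewrite mxE; apply: le_trans (ler_norm_sum _ _ _) _.
  apply: le_trans (ler_sum _ (fun j _ => normM_le (x2 j) (SB j i))) _.
  by rewrite sumr_const card_ord -(mulr_natl (2 * B1)) mulrA.
have xx : `|dotp x x / 2| <= 2 by rewrite ger0_norm ?divr_ge0 ?dotp_ge0 //; lra.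
split=> [i|]; last first.
  by apply: le_trans (normD_le lB bx) _; rewrite [leRHS](_ : _ = B1 + n%:R * B1 * 2) //; ring.
have -> : cfield X1 l1 S1 b1 x 0 i = X1 0 i + (l1 * x 0 i + (x *m S1) 0 i +
    (dotp b1 x * x 0 i - dotp x x / 2 * b1 0 i)) by rewrite /cfield !mxE.
apply: le_trans (normD_le (XB i) (normD_le (normD_le (normM_le lB (x2 i)) (xS i))
  (normB_le (normM_le bx (x2 i)) (normM_le xx (bB i))))) _.
by rewrite [leRHS](_ : _ = B0 + (B1 * 2 + n%:R * 2 * B1 + (n%:R * B1 * 2 * 2 + 2 * B1))) //; ring.
Qed.

Variables (p : V) (eps : R) (a : V).
Hypothesis Hpar : fowler_parameters U p eps a.
Hypothesis Dp : \forall r \near 0^'+, forall y, shell y -> D (p + r *: y).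

(** Rescaling leaves the prefactor 1/r, against which the error r r^h of [flux_comparison] and the
    error r^2 of [flux_approx] are negligible. *)
Lemma local_flux :
  (fun r => r^-1 ^+ 2 * I (cflux U dU X0 l0 S b r p)) @ 0^'+ -->
  I (@newton_weight R n) * (fowlerH n eps * (dotp (cfield X0 l0 S b p) a + cdiv l0 b p / 2)).
Proof.
have [h3 h1 c0 p1] := dim_facts R hn.
have [v [T [h [K [r0 [Hv /andP[h0 hle1] K0 /andP[r00 r01] Hexp]]]]]] := fowler_expansion hn Hpar.
have e0 : 0 < eps by have [/andP[]] := Hpar.
have [m [M1 [m0 M10 HM]]] := fowler_shell_bounds hn e0 Hv.
pose al := \sum_i `|a 0 i|; have al0 : 0 <= al by apply: sumr_ge0.
have ale i : `|a 0 i| <= al by exact: coord_le_sum.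
pose N1 := n%:R * al * 3 * M1.
have N10 : 0 <= N1.
  by apply: mulr_ge0 (ltW M10); apply: mulr_ge0 => //; apply: mulr_ge0.
(* One unit of room for the term linear in [a], one for the remainder of the expansion. *)
pose M := M1 + 2; have M0 : 0 < M by rewrite addr_gt0.
have A0 : 0 <= 6 ^+ n :> R by exact: exprn_ge0.
have [C1' C10 H1] := flux_comparison hn M0 A0.
have [C2' C20 H2] := flux_approx hn M0 A0.
set Xp := cfield X0 l0 S b p; set lp := cdiv l0 b p.
pose S2 := S + b^T *m p - p^T *m b.
pose B0 := \sum_i `|Xp 0 i|.
pose L := `|lp| + (\sum_i \sum_j `|S2 i j| + \sum_i `|b 0 i|).
have SS0 : 0 <= \sum_i \sum_j `|S2 i j| by apply: sumr_ge0 => i _; apply: sumr_ge0.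
have bb0 : 0 <= \sum_i `|b 0 i| by apply: sumr_ge0.
have B00 : 0 <= B0 by apply: sumr_ge0.
have L0 : 0 <= L by rewrite !addr_ge0.
have XB i : `|Xp 0 i| <= B0 by exact: coord_le_sum.
have SL i j : `|S2 i j| <= L.
  by apply: le_trans (entry_le_sum S2 i j) _; rewrite /L addrCA lerDl addr_ge0.
have bL i : `|b 0 i| <= L.
  by apply: le_trans (coord_le_sum b i) _; rewrite /L addrA lerDr addr_ge0.
have lL : `|lp| <= L by rewrite /L lerDl addr_ge0.
(* [K' * (r * t)] will be the accuracy [del]: K + al is what the gradient condition asks for, and
   the added 1 makes it positive. *)
pose K' := K + al + 1; have K'0 : 0 < K' by rewrite ltr_wpDl // addr_ge0.
pose B := B0 + (4 + 6 * n%:R) * L.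
have [nn nn1 nn2] := coef_bounds h3.
have BB0 : 0 <= B by apply: addr_ge0 => //; apply: mulr_ge0.
pose Kf := C1' * B * K' + C2' * (L * al + B0 * al ^+ 2).
apply: (@powR_cvg_bound _ _ _ Kf h h0).
near=> r.
have rp : 0 < r by near: r; exact: nbhs_right_gt.
have rr0 : r < r0 by near: r; exact: nbhs_right_lt.
have r1 : r < 1 by exact: lt_le_trans rr0 r01.
have rm : r * N1 < m.
  have : r < m / (N1 + 1) by near: r; apply: nbhs_right_lt; rewrite divr_gt0 // ltr_wpDl.
  rewrite ltr_pdivlMr ?ltr_wpDl // => k; by apply: lt_trans k; rewrite ltr_pM2l // ltrDl.
have rN : r * N1 <= 1.
  have : r <= 1 / (N1 + 1) by near: r; apply: nbhs_right_le; rewrite divr_gt0 // ltr_wpDl.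
  rewrite ler_pdivlMr ?ltr_wpDl // => k; by apply: le_trans k; rewrite ler_pM2l // lerDl.
have rK' : r * K' <= 1.
  by rewrite -ler_pdivlMr // ; near: r; apply: nbhs_right_le; rewrite divr_gt0.
have Dr : forall y, shell y -> D (p + r *: y) by near: r.
set t := r `^ h.
have t0 : 0 <= t by exact: powR_ge0.
have t1 : t <= 1.
  rewrite /t /powR gt_eqF // -expR0 ler_expR; apply: mulr_ge0_le0; first exact: ltW.
  by apply: ln_le0; exact: ltW.
have rt : r <= t.
  rewrite -{1}(powRr1 (ltW rp)) /t /powR gt_eqF // ler_expR.
  by apply: ler_wnM2r => //; apply: ln_le0; exact: ltW.
have dn0 : n%:R - 2 != 0 :> R by rewrite gt_eqF // (lt_le_trans _ h1).
set k := r `^ ((n%:R - 2) / 2).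
have k0 : 0 < k by exact: powR_gt0.
have rn0 : r != 0 by rewrite gt_eqF.
(* k^(4/(n-2)) = r^2, so this rescaling preserves the equation. *)
have kE : 1 * critical_pow n k = k * r ^+ 2.
  rewrite mul1r /critical_pow /k -powRrM -powR_mulrn ?(ltW rp) // -powRD ?rn0 ?implybT //.
  by congr (_ `^ _); field; exact: dn0.
have kr : r ^+ n / (r ^+ 3 * k ^+ 2) = r^-1.
  have k2 : k ^+ 2 * r ^+ 2 = r ^+ n.
    rewrite -!powR_mulrn ?(ltW rp) ?(ltW k0) // /k -powRrM -powRD ?rn0 ?implybT //.
    by congr (_ `^ _); field.
  rewrite -k2; field; rewrite rn0 (gt_eqF k0) //.
have EE := cflux_rescaled hn HI X0 l0 S b k0 rp kE CU U0 Dr; rewrite kr in EE.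
rewrite EE {EE}.
set J := rescaled I _ _.
have HJ : ibp_functional (6 ^+ n) J.
  by apply: rescaled_ibp_functional HI; rewrite invr_gt0.
have rr : 0 < r < r0 by rewrite rp.
have fexp := Hexp r rr.
have HP := fowler_profile hn Hv (T - ln r).
have FG s : 1 / 2 < s < 5 -> fowF n v (T - ln r) s <= M /\ `|fowG n v (T - ln r) s| <= M.
  move=> hs; have [/andP[_ h4] h5 _] := HM (T - ln r) s hs; have M1M : M1 <= M by rewrite lerDl.
  by split; [exact: le_trans h4 M1M|exact: le_trans h5 M1M].
have ra i : `|(r *: a) 0 i| <= r * al.
  by rewrite mxE normrM gtr0_norm // ler_wpM2l // ltW.
have apx x : shell x -> `|approx (fowF n v (T - ln r)) (fowG n v (T - ln r)) (r *: a) x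
   - fowF n v (T - ln r) (dotp x x)| <= r * N1.
  move=> Sx; rewrite /approx addrC addKr.
  have [_ gM _] := HM (T - ln r) _ Sx.
  have := normM_le (dotp_le (mulr_ge0 (ltW rp) al0) ra (fun i => shell_coord i Sx)) gM.
  by rewrite (_ : r * N1 = n%:R * (r * al) * 3 * M1) //; rewrite /N1; ring.
have apx2 x : shell x -> 0 < approx (fowF n v (T - ln r)) (fowG n v (T - ln r)) (r *: a) x <= M1 + 1.
  move=> Sx; have [/andP[h4 h5] _ _] := HM (T - ln r) _ Sx.
  by rewrite (gt0_of_dist (apx x Sx) rm h4) (le_of_dist (apx x Sx) rN h5).
have dlt : 0 < K' * (r * t) <= 1.
  rewrite mulr_gt0 ?mulr_gt0 //=; last by rewrite /t powR_gt0.
  rewrite mulrA [K' * r]mulrC; apply: le_trans (_ : r * K' * 1 <= _); last by rewrite mulr1.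
  by apply: ler_wpM2l => //; rewrite mulr_ge0 // ltW.
have rle : r <= 1 by exact: ltW.
have rL : r * L <= L by rewrite ler_piMl.
have rrb i : `|(r ^+ 2 *: b) 0 i| <= r * L.
  rewrite mxE normrM ger0_norm ?sqr_ge0 // expr2 -mulrA ler_wpM2l ?(ltW rp) //.
  by apply: le_trans (bL i); rewrite ler_piMl.
have rS i j : `|(r *: S2) i j| <= r * L.
  by rewrite mxE normrM gtr0_norm // ler_wpM2l ?(ltW rp).
have rl : `|r * lp| <= r * L by rewrite normrM gtr0_norm // ler_wpM2l ?(ltW rp).
have k11 : 0 <= (1 : R) <= 1 by rewrite ler01 lexx.
have al1 : r * al <= 1.
  by apply: le_trans rK'; rewrite ler_wpM2l ?(ltW rp) // /K' addrAC lerDr addr_ge0.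
(* The scale invariance of the constant: the main term is the same for every r although the
   functional changes. *)
have J0 : J (@newton_weight R n) = I (@newton_weight R n) by exact: newton_weight_rescaled.
have apM x : shell x -> 0 < approx (fowF n v (T - ln r)) (fowG n v (T - ln r)) (r *: a) x <= M.
  by move=> Sx; have /andP[-> h4] := apx2 x Sx; apply: le_trans h4 _; rewrite lerD2l ler1n.
have A2 := H2 J 1 (fowlerH n eps) (fowF n v (T - ln r)) (fowG n v (T - ln r)) (r *: a) (r * al)
  Xp (r * lp) (r *: S2) (r ^+ 2 *: b) B0 (r * L) HJ HP k11 FG apM ra al1 (skew_affine _ _ _ skewS) XB rl rS rrb.
rewrite -[fun x => bump _ * _ `^ _]/(@newton_weight R n) J0 dotpZr in A2.
have CU1 := @C1_rescale R n D (@shell R n) U dU p k r CU Dr.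
have CU2 i := @C1_rescale R n D (@shell R n) (dU i) (ddU i) p (k * r) r (CdU i) Dr.
have PDE x : shell x -> \sum_i k * r * r * ddU i i (p + r *: x) =
    - (1 * c) * critical_pow n (k * U (p + r *: x)).
  move=> Sx; have Dx := Dr x Sx.
  rewrite -mulr_sumr yamabe // (critical_powMM n k0 (U0 Dx)).
  have -> : critical_pow n k = k * r ^+ 2 by rewrite -kE mul1r.
  by rewrite mul1r; ring.
have rtt : r * t ^+ 2 <= r * t.
  by rewrite ler_wpM2l ?(ltW rp) // expr2 ler_piMl.
have KK1 : K <= K' by rewrite /K' -addrA lerDl addr_ge0.
have rt0 : 0 <= r * t by rewrite mulr_ge0 // ltW.
have rtt0 : 0 <= r * t ^+ 2 by rewrite mulr_ge0 ?sqr_ge0 // ltW.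
have UM x : shell x -> 0 < k * U (p + r *: x) <= M.
  move=> Sx; rewrite mulr_gt0 ?U0 //=; last exact: Dr.
  have h4 : K * (r * t ^+ 2) <= 1.
    case/andP: dlt => _; apply: le_trans; apply: ler_pM => //.
  have /andP[_ h5] := apx2 x Sx.
  by rewrite (_ : M = M1 + 1 + 1) ?(le_of_dist (fexp x Sx) h4 h5) // -addrA.
have Ue x : 1 < dotp x x < 4 -> `|k * U (p + r *: x) -
    approx (fowF n v (T - ln r)) (fowG n v (T - ln r)) (r *: a) x| <= K * (r * t ^+ 2).
  by move=> hx; apply: fexp; exact: annulus_sub.
have LB : (4 + 6 * n%:R) * (r * L) <= (4 + 6 * n%:R) * L by rewrite ler_wpM2l.
have XL x : 1 < dotp x x < 4 ->
  (forall i, `|cfield Xp (r * lp) (r *: S2) (r ^+ 2 *: b) x 0 i| <= B) /\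
  `|cdiv (r * lp) (r ^+ 2 *: b) x| <= B.
  case/andP=> _ /ltW x4; have [h4 h5] := cfield_le x4 XB rl rS rrb; split=> [i|].
    by apply: le_trans (h4 i) _; rewrite lerD2l.
  apply: le_trans h5 _; apply: le_trans (_ : (4 + 6 * n%:R) * (r * L) <= _).
    by apply: ler_wpM2r => //; rewrite mulr_ge0 // ltW.
  by apply: le_trans LB _; rewrite lerDr.
have bB i : `|(r ^+ 2 *: b) 0 i| <= B.
  apply: le_trans (rrb i) _; apply: le_trans rL _; apply: le_trans (_ : (4 + 6 * n%:R) * L <= _).
    by rewrite ler_peMl.
  by rewrite lerDr.
have eps0 : 0 <= K * (r * t ^+ 2) by rewrite mulr_ge0.
have d11 : `|(1 : R) - 1| <= K' * (r * t).
  by rewrite subrr normr0; case/andP: dlt => /ltW.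
have eps1 : K * (r * t ^+ 2) <= K' * (r * t) by apply: ler_pM.
have eps2 : K * (r * t ^+ 2) * (K * (r * t ^+ 2) + r * al + `|(1 : R) - 1|) <= (K' * (r * t)) ^+ 2.
  rewrite subrr normr0 addr0.
  have h4 : K * (r * t ^+ 2) + r * al <= r * K'.
    rewrite -mulrCA -mulrDr ler_wpM2l ?(ltW rp) // /K'.
    apply: le_trans (_ : K * 1 + al <= _); last by rewrite mulr1 lerDl.
    by rewrite lerD2r ler_wpM2l // expr_le1.
  apply: le_trans (ler_wpM2l eps0 h4) _.
  rewrite [leLHS](_ : _ = K * K' * (r * t) ^+ 2) ?[leRHS](_ : _ = K' * K' * (r * t) ^+ 2); [|ring|ring].
  by rewrite ler_wpM2r ?sqr_ge0 // ler_wpM2r // ltW.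
have A1 := H1 J 1 1 (fowlerH n eps) (fowF n v (T - ln r)) (fowG n v (T - ln r)) (r *: a)
  _ _ _ (cfield Xp (r * lp) (r *: S2) (r ^+ 2 *: b)) (cdiv (r * lp) (r ^+ 2 *: b)) (r ^+ 2 *: b)
  (K * (r * t ^+ 2)) (r * al) (K' * (r * t)) B HJ HP k11 FG CU1 CU2 PDE UM apM Ue ra al1
  (fun i => @shell_cont_cfield R n _ _ _ _ i) (@shell_cont_cdiv R n _ _) XL bB eps0 BB0 dlt eps1 d11 eps2.
apply: local_flux_arith A1 A2 => //.
by apply: addr_ge0; [exact: mulr_ge0|apply: mulr_ge0 => //; exact: sqr_ge0].
Unshelve. all: by end_near. Qed.

End Local.

(** * Flux at infinity *)

Section Infinity.
Variables (R : realType) (n : nat).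
Hypothesis hn : (3 <= n)%N.
Notation V := 'rV[R]_n.
Variable I : (V -> R) -> R.
Hypothesis HI : integral_like I.
Let c : R := n%:R * (n%:R - 2) / 4.

(** The harmonic function A0 |x|^(2-n) as a profile with zero coupling and zero energy; it is the
    limit of the rescaled U at infinity. *)
Lemma newton_profile (A0 : R) : 0 < A0 ->
  profile n 0 0 (fun s => A0 * s `^ ((2 - n%:R) / 2)) (fun=> 0).
Proof.
move=> A00 s /andP[s1 _]; have s0 : 0 < s by lra.
split.
- by rewrite mulr_gt0 // powR_gt0.
- apply: is_derive_ext (is_derive_mul (is_derive_cst A0 s 1) (is_derive1_powR _ s0)) => //.
  have -> : s `^ ((2 - n%:R) / 2) = s * s `^ ((2 - n%:R) / 2 - 1).
    by rewrite mul_powR //; congr (_ `^ _); ring.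
  by rewrite /=; move: (s `^ _) => z; field; rewrite gt_eqF.
- by apply: is_derive_ext (is_derive_cst 0 s 1) => //; rewrite !mul0r oppr0 mul0r.
by rewrite !mulr0 !mul0r addr0.
Qed.

Variables (D : set V) (U : V -> R) (dU : 'I_n -> V -> R) (ddU : 'I_n -> 'I_n -> V -> R).
Hypotheses (CU : C1 D U dU) (CdU : forall i, C1 D (dU i) (ddU i)).
Hypothesis U0 : forall x, D x -> 0 < U x.
Hypothesis yamabe : forall x, D x -> \sum_i ddU i i x = - c * critical_pow n (U x).

Variables (X0 : V) (l0 : R) (S : 'M[R]_n) (b : V).
Hypothesis skewS : S^T = - S.

Hypothesis Doo : \forall s \near +oo, forall y, shell y -> D (0 + s *: y).
Variable A0 : R.
Hypothesis A00 : 0 < A0.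
Hypothesis Uoo : forall e : R, 0 < e -> \forall s \near +oo, forall y : V, shell y ->
  `|s `^ (n%:R - 2) * U (0 + s *: y) - A0 * dotp y y `^ ((2 - n%:R) / 2)| <= e.

(** Rescaling by k = s^(n-2) gives the prefactor s^(1-n), while the parameters of the field grow
    like s^2. For n = 3 these only balance, so the limit is zero because the limiting profile
    carries no flux. *)
Lemma infinity_flux :
  (fun s => s^-1 ^+ 2 * I (cflux U dU X0 l0 S b s 0)) @ +oo --> (0 : R).
Proof.
have [h3 h1 c0 p1] := dim_facts R hn.
pose F s : R := A0 * s `^ ((2 - n%:R) / 2).
pose M0 := A0 * (1 / 2) `^ ((2 - n%:R) / 2).
have M00 : 0 < M0 by rewrite mulr_gt0 // powR_gt0 // divr_gt0.
have FM s : 1 / 2 < s < 5 -> 0 < F s <= M0.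
  case/andP=> s1 _; have s0 : 0 < s by apply: lt_trans s1; rewrite divr_gt0.
  have q0 : (2 - n%:R) / 2 <= 0 :> R by move: h1; lra.
  rewrite /F mulr_gt0 ?powR_gt0 //= ler_wpM2l ?(ltW A00) //.
  rewrite /powR !gt_eqF ?divr_gt0 // ler_expR; apply: ler_wnM2l => //.
  by rewrite ler_ln ?posrE ?divr_gt0 // ltW.
pose M := M0 + 1; have MM0 : 0 < M by rewrite addr_gt0.
have A60 : 0 <= 6 ^+ n :> R by exact: exprn_ge0.
have [C1' C10 H1] := flux_comparison hn MM0 A60.
have [C2' C20 H2] := flux_approx hn MM0 A60.
set Xp := cfield X0 l0 S b 0; set lp := cdiv l0 b 0.
pose S2 := S + b^T *m (0 : V) - (0 : V)^T *m b.
pose B0 := \sum_i `|Xp 0 i|.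
pose L := `|lp| + (\sum_i \sum_j `|S2 i j| + \sum_i `|b 0 i|).
have SS0 : 0 <= \sum_i \sum_j `|S2 i j| by apply: sumr_ge0 => i _; apply: sumr_ge0.
have bb0 : 0 <= \sum_i `|b 0 i| by apply: sumr_ge0.
have B00 : 0 <= B0 by apply: sumr_ge0.
have L0 : 0 <= L by rewrite !addr_ge0.
have XB i : `|Xp 0 i| <= B0 by exact: coord_le_sum.
have SL i j : `|S2 i j| <= L.
  by apply: le_trans (entry_le_sum S2 i j) _; rewrite /L addrCA lerDl addr_ge0.
have bL i : `|b 0 i| <= L.
  by apply: le_trans (coord_le_sum b i) _; rewrite /L addrA lerDr addr_ge0.
have lL : `|lp| <= L by rewrite /L lerDl addr_ge0.
have [nn nn1 nn2] := coef_bounds h3.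
pose Q := B0 + (4 + 6 * n%:R) * L.
have Q0 : 0 <= Q by rewrite addr_ge0 // mulr_ge0.
pose K := C1' * Q + 1.
have K0 : 0 < K by rewrite ltr_wpDl // mulr_ge0.
apply/cvgrPdist_le => e e0.
(* [del / 2] will bound both the distance to the harmonic profile and [kap], so that their sum is at
   most [del] in the gradient condition; [e / K] makes the final bound at most [e]. *)
pose del := Num.min 1 (e / K).
have del0 : 0 < del by rewrite lt_min ltr01 divr_gt0.
have del1 : del <= 1 by rewrite ge_min lexx.
have delK : K * del <= e by rewrite mulrC -ler_pdivlMr // ge_min lexx orbT.
have dle : del / 2 <= del by rewrite ler_pdivrMr // ler_peMr ?(ltW del0) // ler1n.
have del20 : 0 < del / 2 by rewrite divr_gt0.
near=> s.
have s1 : 1 < s by near: s; exact: nbhs_pinfty_gt.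
have sd : 2 / del < s by near: s; apply: nbhs_pinfty_gt; exact: num_real.
have Ds : forall y, shell y -> D (0 + s *: y) by near: s.
have Us : forall y : V, shell y ->
  `|s `^ (n%:R - 2) * U (0 + s *: y) - A0 * dotp y y `^ ((2 - n%:R) / 2)| <= del / 2.
  by near: s; exact: Uoo.
have s0 : 0 < s by exact: lt_trans s1.
have sn0 : s != 0 by rewrite gt_eqF.
have ss1 : 1 <= s ^+ 2 by rewrite exprn_ege1 // ltW.
have s2 : s <= s ^+ 2 by rewrite expr2 ler_peMl ?ltW.
set k := s `^ (n%:R - 2) in Us *.
have k0 : 0 < k by exact: powR_gt0.
set kap := s^-1 ^+ 2.
have kap0 : 0 <= kap by exact: sqr_ge0.
have kapd : kap <= del / 2.
  rewrite /kap exprVn invf_ple ?posrE ?exprn_gt0 //; apply: le_trans s2.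
  by rewrite invf_div ltW.
have kE : kap * critical_pow n k = k * s ^+ 2.
  rewrite /kap exprVn; apply: (canLR (mulKf _)); first by rewrite expf_neq0.
  rewrite /critical_pow /k -powRrM -powR_mulrn ?(ltW s0) // -!powRD ?sn0 ?implybT //.
  by congr (_ `^ _); field; rewrite gt_eqF // (lt_le_trans _ h1).
(* The left side equals s^(3-n), at most 1 since n >= 3 and s > 1. *)
have kr : s ^+ n / (s ^+ 3 * k ^+ 2) * s ^+ 2 <= 1.
  have k2 : s ^+ n * s ^+ 2 = s ^+ 3 * (s * k).
    rewrite /k (mul_powR _ s0) -!powR_mulrn ?(ltW s0) // -!powRD ?sn0 ?implybT //.
    by congr (_ `^ _); ring.
  have s3 : 0 < s ^+ 3 by exact: exprn_gt0.
  rewrite mulrAC k2 ler_pdivrMr ?mulr_gt0 ?exprn_gt0 // mul1r ler_pM2l // expr2.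
  apply: ler_wpM2r; first exact: ltW.
  rewrite -{1}(powRr1 (ltW s0)) /k /powR (gt_eqF s0) ler_expR; apply: ler_wpM2r => //.
  by apply: ln_ge0; exact: ltW.
have EE := cflux_rescaled hn HI X0 l0 S b k0 s0 kE CU U0 Ds.
rewrite sub0r normrN EE {EE}.
set J := rescaled I _ _.
have HJ : ibp_functional (6 ^+ n) J.
  by apply: rescaled_ibp_functional HI; rewrite invr_gt0.
have HP : profile n 0 0 F (fun=> 0) := newton_profile A00.
have FG r : 1 / 2 < r < 5 -> F r <= M /\ `|0 : R| <= M.
  move=> /FM/andP[_ h4]; rewrite normr0 (ltW MM0); split=> //.
  by apply: le_trans h4 _; rewrite lerDl.
have ap0 x : approx F (fun=> 0) 0 x = F (dotp x x) by rewrite /approx mulr0 addr0.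
have apM (x : V) : shell x -> 0 < approx F (fun=> 0) 0 x <= M.
  by rewrite ap0 => /[dup] /FM/andP[-> _] /FG[].
have a0 (i : 'I_n) : `|(0 : V) 0 i| <= 0 by rewrite mxE normr0.
have k11 : 0 <= (0 : R) <= 1 by rewrite ler01 lexx.
have sl : `|s * lp| <= s ^+ 2 * L.
  rewrite normrM gtr0_norm //; apply: ler_pM => //; exact: ltW.
have sb i : `|(s ^+ 2 *: b) 0 i| <= s ^+ 2 * L.
  by rewrite mxE normrM ger0_norm ?sqr_ge0 // ler_wpM2l ?sqr_ge0.
have sS i j : `|(s *: S2) i j| <= s ^+ 2 * L.
  by rewrite mxE normrM gtr0_norm //; apply: ler_pM => //; exact: ltW.
have A2 := H2 J 0 0 F (fun=> 0) 0 0
  Xp (s * lp) (s *: S2) (s ^+ 2 *: b) B0 (s ^+ 2 * L) HJ HP k11 FG apM a0 ler01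
  (skew_affine _ _ _ skewS) XB sl sS sb.
rewrite mul0r mulr0 subr0 expr0n /= !mulr0 addr0 mulr0 in A2.
have CU1 := @C1_rescale R n D (@shell R n) U dU 0 k s CU Ds.
have CU2 i := @C1_rescale R n D (@shell R n) (dU i) (ddU i) 0 (k * s) s (CdU i) Ds.
have PDE x : shell x -> \sum_i k * s * s * ddU i i (0 + s *: x) =
    - (kap * c) * critical_pow n (k * U (0 + s *: x)).
  move=> Sx; have Dx := Ds x Sx.
  rewrite -mulr_sumr yamabe // (critical_powMM n k0 (U0 Dx)).
  have -> : - (kap * c) * (critical_pow n k * critical_pow n (U (0 + s *: x))) =
    - c * (kap * critical_pow n k) * critical_pow n (U (0 + s *: x)) by ring.
  by rewrite kE; ring.
have UM x : shell x -> 0 < k * U (0 + s *: x) <= M.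
  move=> Sx; rewrite mulr_gt0 ?U0 //=; last exact: Ds.
  have /andP[_ h4] := FM _ Sx.
  by rewrite (le_of_dist (Us x Sx) (le_trans dle del1) h4).
have Ue x : 1 < dotp x x < 4 -> `|k * U (0 + s *: x) - approx F (fun=> 0) 0 x| <= del / 2.
  by move=> hx; rewrite ap0; apply: Us; exact: annulus_sub.
have sQ : (4 + 6 * n%:R) * (s ^+ 2 * L) <= s ^+ 2 * Q.
  by rewrite mulrCA ler_wpM2l ?sqr_ge0 // lerDr.
have XL x : 1 < dotp x x < 4 ->
  (forall i, `|cfield Xp (s * lp) (s *: S2) (s ^+ 2 *: b) x 0 i| <= s ^+ 2 * Q) /\
  `|cdiv (s * lp) (s ^+ 2 *: b) x| <= s ^+ 2 * Q.
  have sL0 : 0 <= s ^+ 2 * L by rewrite mulr_ge0 ?sqr_ge0.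
  case/andP=> _ /ltW x4; have [h4 h5] := cfield_le x4 XB sl sS sb; split=> [i|].
    apply: le_trans (h4 i) _; rewrite [leRHS](_ : _ = s ^+ 2 * B0 + (4 + 6 * n%:R) * (s ^+ 2 * L)).
      by rewrite lerD2r ler_peMl.
    by rewrite /Q; ring.
  apply: le_trans h5 _; apply: le_trans sQ; exact: ler_wpM2r.
have bB i : `|(s ^+ 2 *: b) 0 i| <= s ^+ 2 * Q.
  apply: le_trans (sb i) _; apply: le_trans sQ.
  by rewrite ler_peMl // mulr_ge0 ?sqr_ge0.
have dd : 0 < del <= 1 by rewrite del0.
have kk : `|kap - 0| <= del by rewrite subr0 ger0_norm //; exact: le_trans dle.
have ee : del / 2 * (del / 2 + 0 + `|kap - 0|) <= del ^+ 2.
  rewrite addr0 subr0 ger0_norm // expr2; apply: ler_pM => //; first exact: ltW.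
    by rewrite addr_ge0 // ltW.
  by rewrite [leRHS](splitr del) lerD2l.
have sQ0 : 0 <= s ^+ 2 * Q by rewrite mulr_ge0 ?sqr_ge0.
have A1 := H1 J kap 0 0 F (fun=> 0) 0
  _ _ _ (cfield Xp (s * lp) (s *: S2) (s ^+ 2 *: b)) (cdiv (s * lp) (s ^+ 2 *: b)) (s ^+ 2 *: b)
  (del / 2) 0 del (s ^+ 2 * Q) HJ HP k11 FG CU1 CU2 PDE UM apM Ue a0 ler01
  (fun i => @shell_cont_cfield R n _ _ _ _ i) (@shell_cont_cdiv R n _ _) XL bB (ltW del20) sQ0 dd dle kk ee.
move: A1 A2; rewrite -/Xp -/lp -/S2; set j1 := J _; set j2 := J _; rewrite normr_le0 => + /eqP j20.
rewrite j20 subr0 => A1.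
have sk0 : 0 <= s ^+ n / (s ^+ 3 * k ^+ 2).
  exact: divr_ge0 (exprn_ge0 _ (ltW s0)) (mulr_ge0 (exprn_ge0 _ (ltW s0)) (sqr_ge0 k)).
rewrite normrM ger0_norm //; apply: le_trans (ler_wpM2l sk0 A1) _.
apply: le_trans delK.
rewrite [leLHS](_ : _ = s ^+ n / (s ^+ 3 * k ^+ 2) * s ^+ 2 * (C1' * Q * del)); last by ring.
have C0 : 0 <= C1' * Q * del by rewrite !mulr_ge0 // ltW.
apply: le_trans (ler_wpM2r C0 kr) _; rewrite mul1r /K ler_wpM2r ?(ltW del0) //.
by rewrite lerDl.
Unshelve. all: by end_near. Qed.

End Infinity.

(** * The Pohozaev field is divergence free *)

Section Schwarz.
Variables (R : realType) (n : nat).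
Notation V := 'rV[R]_n.
Notation e_ i := (delta_mx 0 i : V).

(** The mean value theorem twice: along e_i for y -> f(y + h e_j) - f(y), then along e_j for the
    resulting increment of [g i]. *)
Lemma schwarz_rectangle D (f : V -> R) (g : 'I_n -> V -> R) (gg : 'I_n -> 'I_n -> V -> R) x i j (h : R) :
  0 < h -> C1 D f g -> (forall i, C1 D (g i) (gg i)) ->
  (forall s t : R, 0 <= s <= h -> 0 <= t <= h -> D (x + s *: e_ i + t *: e_ j)) ->
  exists s t : R, [/\ 0 <= s <= h, 0 <= t <= h &
   f (x + h *: e_ i + h *: e_ j) - f (x + h *: e_ i) - (f (x + h *: e_ j) - f x)
     = gg i j (x + s *: e_ i + t *: e_ j) * h ^+ 2].
Proof.
move=> h0 Cf Cg sD; have h1 := ltW h0.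
have hh : 0 <= h <= h by rewrite h1 lexx.
have h00 : 0 <= (0 : R) <= h by rewrite h1 lexx.
pose D' := [set y | D y /\ D (y + h *: e_ j)].
have CF : C1 D' (fun y => f (h *: e_ j + 1 *: y) - f y) (fun i y => g i (h *: e_ j + 1 *: y) - g i y).
  have C2 : C1 D' (fun y => f (h *: e_ j + 1 *: y)) (fun i y => g i (h *: e_ j + 1 *: y)).
    refine (C1_eq (C1_sub _ (@C1_affine R n D (h *: e_ j) 1 f g Cf)) _ _) => //.
      by move=> y [_]; rewrite /= scale1r addrC.
    by move=> k y; rewrite mul1r.
  by apply: C1_sub_fun C2 _; apply: C1_sub Cf => y [].
have [|s hs] := MVT_line (x := x) (i := i) h1 CF.
  by move=> t ht; split; [have := sD t 0 ht h00; rewrite scale0r addr0|exact: sD].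
have [t ht] := MVT_line (x := x + s *: e_ i) (i := j) h1 (Cg i) (fun t ht => sD s t hs ht).
move=> E1 E2; exists s, t; split=> //.
move: E2; rewrite !scale1r ![h *: e_ j + _]addrC => ->.
by rewrite E1 expr2 mulrA.
Qed.

Lemma schwarz D (f : V -> R) (g : 'I_n -> V -> R) (gg : 'I_n -> 'I_n -> V -> R) x i j :
  open D -> D x -> C1 D f g -> (forall i, C1 D (g i) (gg i)) -> gg i j x = gg j i x.
Proof.
move=> oD Dx Cf Cg.
have /nbhs_ballP[r /= r0 rD] : nbhs x D by exact: open_nbhs_nbhs.
apply/eqP; rewrite -subr_eq0 -normr_eq0; apply/eqP/le_anti; rewrite normr_ge0 andbT.
apply/ler_addgt0Pr => e e0; rewrite add0r.
have e2 : 0 < e / 2 by rewrite divr_gt0.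
have near_gg k l : exists2 dl : R, 0 < dl & forall y, ball x dl y -> `|gg k l x - gg k l y| <= e / 2.
  have := C1_dcont (i := l) (Cg k) Dx => /cvgrPdist_le/(_ _ e2)/nbhs_ballP[dl /= d0 H].
  by exists dl.
have [d1 d10 H1] := near_gg i j; have [d2 d20 H2] := near_gg j i.
pose dl := Num.min r (Num.min d1 d2); pose h := dl / 4.
have dl0 : 0 < dl by rewrite !lt_min r0 d10.
have h0 : 0 < h by rewrite divr_gt0.
have ballE (k l : 'I_n) (s t : R) : 0 <= s <= h -> 0 <= t <= h -> ball x dl (x + s *: e_ k + t *: e_ l).
  move=> /andP[s0 sh] /andP[t0 th]; rewrite -ball_normE /ball_ /= -addrA opprD addrA subrr sub0r normrN.
  apply: le_lt_trans (_ : 2 * h < _); last by rewrite /h; lra.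
  apply/norm_leP; first by rewrite mulr_ge0 // ltW.
  move=> m; rewrite !mxE eqxx /=.
  apply: le_trans (_ : s * 1 + t * 1 <= _); last by lra.
  apply: normD_le; rewrite normrM ger0_norm // ler_wpM2l //; case: eqP => _ /=; by rewrite ?normr1 ?normr0.
have rb : dl <= r by rewrite ge_min lexx.
have d1b : dl <= d1 by rewrite !ge_min lexx !orbT.
have d2b : dl <= d2 by rewrite !ge_min lexx !orbT.
have DD k l s t : 0 <= s <= h -> 0 <= t <= h -> D (x + s *: e_ k + t *: e_ l).
  by move=> hs ht; apply: rD; apply: le_ball rb _ _; exact: ballE.
have [s [t [hs ht E1]]] := schwarz_rectangle h0 Cf Cg (DD i j).
have [s' [t' [hs' ht' E2]]] := schwarz_rectangle h0 Cf Cg (DD j i).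
have E : gg i j (x + s *: e_ i + t *: e_ j) = gg j i (x + s' *: e_ j + t' *: e_ i).
  have hn : h ^+ 2 != 0 by rewrite expf_neq0 // gt_eqF.
  apply: (mulIf hn); rewrite -E1 -E2 [x + h *: e_ j + _]addrAC; ring.
have K1 := H1 _ (le_ball d1b (ballE i j s t hs ht)).
have K2 := H2 _ (le_ball d2b (ballE j i s' t' hs' ht')).
rewrite E in K1.
rewrite (_ : _ - _ = (gg i j x - gg j i (x + s' *: e_ j + t' *: e_ i)) -
   (gg j i x - gg j i (x + s' *: e_ j + t' *: e_ i))); last by ring.
by apply: le_trans (normB_le K1 K2) _; rewrite -splitr.
Qed.

End Schwarz.

Section Pohozaev.
Variables (R : realType) (n : nat).
Hypothesis hn : (3 <= n)%N.
Notation V := 'rV[R]_n.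
Let c : R := n%:R * (n%:R - 2) / 4.
Let d : R := n%:R - 2.

Variables (D : set V) (U : V -> R) (dU : 'I_n -> V -> R) (ddU : 'I_n -> 'I_n -> V -> R).
Hypotheses (oD : open D) (CU : C1 D U dU) (CdU : forall i, C1 D (dU i) (ddU i)).
Hypothesis U0 : forall x, D x -> 0 < U x.
Hypothesis yamabe : forall x, D x -> \sum_i ddU i i x = - c * critical_pow n (U x).
Variables (X0 : V) (l0 : R) (S : 'M[R]_n) (b : V).
Hypothesis skewS : S^T = - S.

Let X j (x : V) := cfield X0 l0 S b x 0 j.
Let dX j i (x : V) := cdiv l0 b x * (i == j)%:R + (S i j + (b 0 i * x 0 j - x 0 i * b 0 j)).

Lemma C1_cfield j : C1 D (X j) (dX j).
Proof.
refine (C1_eq (C1_add (@C1_cst R n D (X0 0 j)) (C1_add (C1_add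
  (C1_scale l0 (@C1_coord R n D j))
  (C1_sum (fun m => C1_mul (@C1_coord R n D m) (@C1_cst R n D (S m j)))))
  (C1_sub_fun (C1_mul (@C1_dotp R n b D) (@C1_coord R n D j))
    (C1_scale (b 0 j / 2) (@C1_rho R n D))))) _ _).
  move=> x; rewrite /X /cfield !mxE.
  by move: (dotp x x) => z; ring.
move=> i x; rewrite /dX /cdiv.
rewrite (bigD1 i) //= big1 => [|m mi]; last by rewrite eq_sym (negbTE mi) !mul0r mulr0 addr0.
by rewrite eqxx /=; field.
Qed.

Lemma C1_cdiv : C1 D (cdiv l0 b) (fun i _ => b 0 i).
Proof.
by refine (C1_eq (C1_add (@C1_cst R n D l0) (@C1_dotp R n b D)) _ _) => // i x; rewrite add0r.
Qed.

Definition pohozaev (i : 'I_n) (x : V) : R :=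
  (\sum_j X j x * dU j x) * dU i x - 2^-1 * (\sum_j dU j x * dU j x) * X i x
  + d ^+ 2 / 8 * energy_pow n (U x) * X i x
  + d / 2 * (cdiv l0 b x * U x) * dU i x - d / 4 * (U x * U x) * b 0 i.

Definition dpohozaev (i m : 'I_n) (x : V) : R :=
  (\sum_j (dX j m x * dU j x + X j x * ddU j m x)) * dU i x + (\sum_j X j x * dU j x) * ddU i m x
  - (2^-1 * (\sum_j (ddU j m x * dU j x + dU j x * ddU j m x)) * X i x
     + 2^-1 * (\sum_j dU j x * dU j x) * dX i m x)
  + (c * critical_pow n (U x) * dU m x * X i x + d ^+ 2 / 8 * energy_pow n (U x) * dX i m x)
  + (d / 2 * (b 0 m * U x + cdiv l0 b x * dU m x) * dU i x + d / 2 * (cdiv l0 b x * U x) * ddU i m x)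
  - d / 4 * (dU m x * U x + U x * dU m x) * b 0 i.

Lemma C1_pohozaev i : C1 D (pohozaev i) (dpohozaev i).
Proof.
have CE : C1 D (fun x => d ^+ 2 / 8 * energy_pow n (U x)) (fun m x => c * critical_pow n (U x) * dU m x).
  apply: (@C1_comp _ _ D (fun t => d ^+ 2 / 8 * energy_pow n t) (fun t => c * critical_pow n t) U dU CU).
  move=> x Dx; have DE := is_derive_energy hn (U0 Dx); split; first exact: DE.
  apply: continuousM; first exact: cst_continuous.
  exact: is_derive_continuous (is_derive1_powR _ (U0 Dx)).
refine (C1_eq (C1_sub_fun (C1_add (C1_add (C1_sub_fun
   (C1_mul (C1_sum (fun j => C1_mul (C1_cfield j) (CdU j))) (CdU i))
   (C1_mul (C1_scale 2^-1 (C1_sum (fun j => C1_mul (CdU j) (CdU j)))) (C1_cfield i)))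
   (C1_mul CE (C1_cfield i)))
   (C1_mul (C1_scale (d / 2) (C1_mul C1_cdiv CU)) (CdU i)))
   (C1_mul (C1_scale (d / 4) (C1_mul CU CU)) (@C1_cst R n D (b 0 i)))) _ _) => //.
by move=> m x; rewrite mulr0 addr0.
Qed.

Lemma pohozaev_flux (x y : V) : \sum_i pohozaev i x * y 0 i =
  flux 1 (cfield X0 l0 S b x) (cdiv l0 b x) b (U x) (\row_i dU i x) y.
Proof.
have E1 : \sum_j X j x * dU j x = dotp (cfield X0 l0 S b x) (\row_i dU i x).
  by apply: eq_bigr => j _; rewrite mxE.
have E2 : \sum_j dU j x * dU j x = dotp (\row_i dU i x) (\row_i dU i x).
  by apply: eq_bigr => j _; rewrite mxE.
rewrite /flux mul1r -E1 -E2 expr2 /pohozaev.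
set A := \sum_j X j x * dU j x; set B := \sum_j dU j x * dU j x; set e := energy_pow _ _; set l := cdiv _ _ _.
rewrite (eq_bigr (fun i => A * (dU i x * y 0 i) + (- (2^-1 * B) + d ^+ 2 / 8 * e) * (X i x * y 0 i)
   + d / 2 * (l * U x) * (dU i x * y 0 i) + - (d / 4 * (U x * U x)) * (b 0 i * y 0 i))); last first.
  by move=> i _; ring.
rewrite !big_split /= -!mulr_sumr.
have -> : \sum_i dU i x * y 0 i = dotp (\row_i dU i x) y by apply: eq_bigr => j _; rewrite mxE.
have -> : \sum_i b 0 i * y 0 i = dotp b y by [].
have -> : \sum_i X i x * y 0 i = dotp (cfield X0 l0 S b x) y by [].
by rewrite /d; ring.
Qed.

Lemma skew_sum (K : 'I_n -> 'I_n -> R) (u : 'I_n -> R) : (forall i j, K i j = - K j i) ->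
  \sum_i \sum_j K i j * (u i * u j) = 0.
Proof.
move=> hK; have : \sum_i \sum_j K i j * (u i * u j) = - \sum_i \sum_j K i j * (u i * u j).
  rewrite {1}exchange_big /= -sumrN; apply: eq_bigr => i _; rewrite -sumrN.
  by apply: eq_bigr => j _; rewrite hK; ring.
by move: (\sum_i _) => z; lra.
Qed.

(** The symmetric part of DX is [cdiv] times the identity, so DX(DU, DU) = lam |DU|^2 ([T1]);
    symmetry of the Hessian cancels the remaining quadratic second-order terms ([T2]). With div X =
    n lam ([T3]) and the equation, the multiples of lam |DU|^2 and of lam U^(2n/(n-2)) add up to
    zero. *)
Lemma div_pohozaev (x : V) : D x -> \sum_i dpohozaev i i x = 0.
Proof.
move=> Dx; have [h3 h1 c0 p1] := dim_facts R hn.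
have sy i j : ddU i j x = ddU j i x by exact: schwarz oD Dx CU CdU.
have DU := yamabe Dx.
have EU := critical_powM hn (U0 Dx).
have skS i j : S i j = - S j i by have /matrixP/(_ j i) := skewS; rewrite !mxE.
set l := cdiv l0 b x; set A := \sum_j X j x * dU j x; set B := \sum_j dU j x * dU j x.
set e := energy_pow n (U x) in EU *; set q := critical_pow n (U x) in EU DU *.
have T1 : \sum_i \sum_j dX j i x * (dU i x * dU j x) = l * B.
  have hK i j : S i j + (b 0 i * x 0 j - x 0 i * b 0 j) = - (S j i + (b 0 j * x 0 i - x 0 j * b 0 i)).
    by rewrite skS; ring.
  have Z := @skew_sum (fun i j => S i j + (b 0 i * x 0 j - x 0 i * b 0 j)) (fun i => dU i x) hK.
  apply: etrans (_ : l * B + \sum_i \sum_j (S i j + (b 0 i * x 0 j - x 0 i * b 0 j)) * (dU i x * dU j x) = _).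
    rewrite /B mulr_sumr.
    rewrite -big_split /=; apply: eq_bigr => i _.
    rewrite (bigD1 i) //= [in RHS](bigD1 i) //= addrA; congr (_ + _).
      by rewrite /dX eqxx /= -/l; ring.
    by apply: eq_bigr => j ji; rewrite /dX eq_sym (negbTE ji) mulr0 add0r.
  by rewrite Z addr0.
have T2 : \sum_i (\sum_j X j x * ddU j i x) * dU i x = \sum_i (\sum_j dU j x * ddU j i x) * X i x.
  rewrite (eq_bigr (fun i => \sum_j X j x * ddU j i x * dU i x)); last by move=> i _; rewrite mulr_suml.
  rewrite exchange_big /=; apply: eq_bigr => i _; rewrite mulr_suml; apply: eq_bigr => j _.
  by rewrite sy; ring.
have T3 : \sum_i dX i i x = n%:R * l.
  rewrite (eq_bigr (fun=> l)); first by rewrite sumr_const card_ord mulr_natl.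
  move=> i _; have := skS i i; rewrite /dX eqxx /= -/l => h.
  have -> : S i i = 0 by lra.
  ring.
rewrite (eq_bigr (fun i => (\sum_j dX j i x * (dU i x * dU j x)) +
   (\sum_j X j x * ddU j i x) * dU i x + A * ddU i i x - (\sum_j dU j x * ddU j i x) * X i x
   + (d ^+ 2 / 8 * e - 2^-1 * B) * dX i i x + c * q * (X i x * dU i x)
   + d / 2 * l * (dU i x * dU i x) + d / 2 * (l * U x) * ddU i i x)); last first.
  move=> i _; rewrite /dpohozaev -/A -/B -/l -/e -/q.
  rewrite big_split /= mulrDl mulr_suml.
  rewrite (eq_bigr (fun j => dX j i x * (dU i x * dU j x))); last by move=> j _; ring.
  have -> : \sum_j (ddU j i x * dU j x + dU j x * ddU j i x) = 2 * \sum_j dU j x * ddU j i x.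
    by rewrite mulr_sumr; apply: eq_bigr => j _; ring.
  move: (\sum_j dX j i x * _) (\sum_j X j x * _) (\sum_j dU j x * _) => z1 z2 z3.
  by field.
rewrite !big_split /= sumrN -!mulr_sumr T1 T2 T3 DU -/A -/B -EU.
move: (\sum_i _) => z; rewrite /c /d; by field.
Qed.

End Pohozaev.

(** * Balance of fluxes *)

Section Global.
Variables (R : realType) (n k : nat).
Hypothesis hn : (3 <= n)%N.
Notation V := 'rV[R]_n.
Variable I : (V -> R) -> R.
Hypothesis HI : integral_like I.
Let c : R := n%:R * (n%:R - 2) / 4.

Variables (p : 'I_k -> V) (U : V -> R) (dU : 'I_n -> V -> R) (ddU : 'I_n -> 'I_n -> V -> R).
Hypothesis p_inj : injective p.
Let D : set V := [set x | ~ range p x].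
Hypotheses (CU : C1 D U dU) (CdU : forall i, C1 D (dU i) (ddU i)).
Hypothesis U0 : forall x, D x -> 0 < U x.
Hypothesis yamabe : forall x, D x -> \sum_i ddU i i x = - c * critical_pow n (U x).

Lemma dotp_points_le j : dotp (p j) (p j) <= \sum_j dotp (p j) (p j).
Proof. by rewrite (bigD1 j) //= lerDl; apply: sumr_ge0 => i _; exact: dotp_ge0. Qed.

(** The factor 2 compensates the lower bound 1/2 of |y|^2 on the shell, so that the points s y lie
    beyond all the p_j. *)
Lemma sqr_points_near : \forall s \near +oo, 0 < s /\ 2 * (\sum_j dotp (p j) (p j) + 1) < s ^+ 2.
Proof.
near=> s; have s1 : 1 < s by near: s; exact: nbhs_pinfty_gt.
have sQ : 2 * (\sum_j dotp (p j) (p j) + 1) < s by near: s; apply: nbhs_pinfty_gt; exact: num_real.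
split; first exact: lt_trans s1.
by apply: lt_trans sQ _; rewrite expr2 ltr_pMl // (lt_trans _ s1).
Unshelve. all: by end_near. Qed.

Lemma regular_far : \forall s \near +oo, forall y, shell y -> D (0 + s *: y).
Proof.
have Q0 : 0 <= \sum_j dotp (p j) (p j) by apply: sumr_ge0 => j _; exact: dotp_ge0.
apply: filterS sqr_points_near => s [s0 hs] y /andP[y1 _] [j _ pj].
have := dotp_points_le j; rewrite pj add0r dotp_affine0.
have h2 : s ^+ 2 * (1 / 2) < s ^+ 2 * dotp y y by rewrite ltr_pM2l // exprn_gt0.
by move: hs h2 Q0; move: (\sum_j _) (s ^+ 2 * dotp y y) (s ^+ 2) => z w' w; lra.
Qed.

Lemma range_closed : closed (range p).
Proof.
rewrite (_ : range p = \bigcup_(j in setT) [set p j]).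
  by apply: closed_bigcup; [exact: finite_finset|move=> j _; apply: accessible_closed_set1; exact: hausdorff_accessible (@norm_hausdorff _ _)].
by apply/seteqP; split=> x [j _ h]; exists j.
Qed.

Lemma regular_open : open D.
Proof. by rewrite (_ : D = ~` range p) // openC; exact: range_closed. Qed.

Variables (X0 : V) (l0 : R) (S : 'M[R]_n) (b : V).
Hypothesis skewS : S^T = - S.

Section Cutoff.
Variables (r s : R).
Hypotheses (r0 : 0 < r) (s0 : 0 < s).
Hypothesis in_s : forall j, s^-1 ^+ 2 * dotp (p j) (p j) < 1.
Hypothesis sep_r : forall i j, i != j -> 4 < r^-1 ^+ 2 * dotp (p j - p i) (p j - p i).

(** A cutoff with bounded support that vanishes near each p_j: there the large cutoff and the one
    centred at p_j are 1 and cancel, while [sep_r] makes those centred at the other points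
    vanish. *)
Let eta (x : V) := cutoff_at s x - \sum_j cutoff_at r (x - p j).
Let deta i (x : V) := - bump (s^-1 ^+ 2 * dotp x x) * (s^-1 ^+ 2 * (2 * x 0 i)) -
  \sum_j - bump (r^-1 ^+ 2 * dotp (x - p j) (x - p j)) * (r^-1 ^+ 2 * (2 * (x - p j) 0 i)).

Lemma C1_eta : C1 setT eta deta.
Proof.
apply: C1_sub_fun; first exact: C1_cutoff_at.
apply: C1_sum => j.
refine (C1_eq (@C1_affine R n setT (- p j) 1 _ _ (C1_cutoff_at r)) _ _).
  by move=> x; rewrite scale1r addrC.
by move=> i x; rewrite mul1r scale1r addrC.
Qed.

Lemma eta_near x : ~ D x -> \near x, eta x = 0.
Proof.
move=> /contrapT[j0 _ <-].
have cont (t : R) (q : V) : {for p j0, continuous (fun y : V => t * dotp (y - q) (y - q))}.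
  apply: continuousM; first exact: cst_continuous.
  apply: (@continuous_comp _ _ _ (fun y : V => y - q) (fun y : V => dotp y y)); last exact: rho_continuous.
  by apply: continuousB => //; exact: cst_continuous.
have n1 : \forall y \near p j0, s^-1 ^+ 2 * dotp (y - 0) (y - 0) < 1.
  by apply: cvgr_lt (cont _ 0) _ _; rewrite subr0.
have n2 : \forall y \near p j0, r^-1 ^+ 2 * dotp (y - p j0) (y - p j0) < 1.
  by apply: cvgr_lt (cont _ (p j0)) _ _; rewrite subrr dotp0l mulr0.
have n3 : \forall y \near p j0, forall i, i != j0 -> 4 < r^-1 ^+ 2 * dotp (y - p i) (y - p i).
  have H i : \forall y \near p j0, i != j0 -> 4 < r^-1 ^+ 2 * dotp (y - p i) (y - p i).
    have [->|ij] := eqVneq i j0; first by near=> y.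
    apply: filterS (_ : \forall y \near p j0, 4 < r^-1 ^+ 2 * dotp (y - p i) (y - p i)) => //.
    by apply: cvgr_gt (cont _ (p i)) _ _; exact: sep_r.
  exact: (filter_forall _ H).
near=> y; rewrite /eta /cutoff_at (bigD1 j0) //=.
rewrite cutoff_in; last by have := near n1 y _; rewrite subr0 => /(_ _)/ltW; apply.
rewrite cutoff_in; last by apply: ltW; exact: (near n2 y _).
rewrite big1 ?addr0 ?subrr // => i ij; apply: cutoff_out; apply: ltW.
by apply: (near n3 y _).
Unshelve. all: by end_near. Qed.

Let P := pohozaev U dU X0 l0 S b.
Let dP := dpohozaev U dU ddU X0 l0 S b.

Lemma C1_eta_pohozaev i : C1 setT (fun x => eta x * P i x)
  (fun m x => deta m x * P i x + eta x * dP i m x).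
Proof. exact: C1_ext0 (C1_pohozaev hn CU CdU U0 X0 l0 S b i) C1_eta eta_near. Qed.

Lemma eta_pohozaev_bsupp i : bsupp (fun x => eta x * P i x).
Proof.
pose K := 2 * s + 2 * r + \sum_j \sum_m `|p j 0 m|.
apply: (@continuous_bsupp _ _ _ K); first by move=> x; exact: C1_cont (C1_eta_pohozaev i) Logic.I.
move=> x m hx; have K0 : 0 <= \sum_j \sum_m `|p j 0 m|.
  by apply: sumr_ge0 => j _; apply: sumr_ge0.
have out (t : R) (q : V) : 0 < t -> 2 * t + `|q 0 m| <= `|x 0 m| -> cutoff_at t (x - q) = 0.
  move=> t0 h; apply: cutoff_out; rewrite exprVn mulrC ler_pdivlMr ?exprn_gt0 //.
  apply: le_trans (coord_sqr_le (x - q) m).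
  rewrite -[(x - q) 0 m ^+ 2]real_normK ?num_real // (_ : 4 * _ = (2 * t) ^+ 2); last by ring.
  apply: lerXn2r; rewrite ?nnegrE ?mulr_ge0 ?(ltW t0) //.
  rewrite !mxE; have := ler_distD 0 (x 0 m) (q 0 m); rewrite subr0 sub0r normrN.
  have := lerB_dist (x 0 m) (q 0 m); move: h; lra.
have -> : eta x = cutoff_at s (x - 0) - \sum_j cutoff_at r (x - p j) by rewrite subr0.
rewrite out //; last first.
  rewrite mxE normr0 addr0; apply: le_trans hx; rewrite /K.
  by move: K0 (ltW r0); move: (\sum_j _) => z; lra.
rewrite big1 ?subrr ?mul0r // => j _; apply: out => //.
apply: le_trans hx; rewrite /K; apply: lerD; first by rewrite lerDr mulr_ge0 // ltW.
apply: le_trans (_ : \sum_m `|p j 0 m| <= _).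
  by rewrite (bigD1 m) //= lerDl sumr_ge0.
by rewrite (bigD1 j) //= lerDl sumr_ge0 // => j' _; apply: sumr_ge0.
Qed.

Hypothesis Dr : forall j y, shell y -> D (p j + r *: y).
Hypothesis Ds : forall y, shell y -> D (0 + s *: y).

(** The divergence of eta P integrates to zero. Its part eta div P vanishes pointwise, off the
    singular points by the equation and at them because eta is 0; its part P . D eta is the
    combination of averaged fluxes. *)
Lemma flux_balance : \sum_j r^-1 ^+ 2 * I (cflux U dU X0 l0 S b r (p j)) =
  s^-1 ^+ 2 * I (cflux U dU X0 l0 S b s 0).
Proof.
have HJ := ibp_functional_id HI.
have Z := fctn_sum HJ (fun i => C1_bsupp i (C1_eta_pohozaev i) (eta_pohozaev_bsupp i)).
rewrite big1 in Z; last first.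
  by move=> i _; exact: (fctn_ibp HJ i (C1_eta_pohozaev i) (eta_pohozaev_bsupp i)).
(* Bounded support does not depend on the normalisation, so it is obtained with k = 1 and coupling
   t^2. *)
have one (t : R) : 0 < t -> t ^+ 2 * critical_pow n 1 = 1 * t ^+ 2.
  by move=> t0; rewrite /critical_pow powR1 mulrC.
have bs : bsupp (cflux U dU X0 l0 S b s 0).
  exact: (cflux_bsupp hn X0 l0 S b ltr01 s0 (one s s0) CU U0 Ds).
have br j : bsupp (cflux U dU X0 l0 S b r (p j)).
  exact: (cflux_bsupp hn X0 l0 S b ltr01 r0 (one r r0) CU U0 (@Dr j)).
have E x : \sum_i (deta i x * P i x + eta x * dP i i x) =
    2 * (- s^-1 ^+ 2 * cflux U dU X0 l0 S b s 0 x +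
     \sum_j r^-1 ^+ 2 * cflux U dU X0 l0 S b r (p j) x).
  rewrite big_split /= -mulr_sumr.
  have -> : eta x * \sum_i dP i i x = 0.
    have [Dx|nDx] := pselect (D x); last by rewrite (nbhs_singleton (eta_near nDx)) mul0r.
    by rewrite (div_pohozaev hn regular_open CU CdU U0 yamabe X0 l0 b skewS Dx) mulr0.
  rewrite addr0 /deta.
  rewrite (eq_bigr (fun i => - (2 * s^-1 ^+ 2) * bump (s^-1 ^+ 2 * dotp x x) * (P i x * x 0 i) +
    \sum_j 2 * r^-1 ^+ 2 * bump (r^-1 ^+ 2 * dotp (x - p j) (x - p j)) * (P i x * (x - p j) 0 i))); last first.
    move=> i _; rewrite mulrBl; congr (_ + _); first by ring.
    rewrite mulr_suml -sumrN; apply: eq_bigr => j _; ring.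
  rewrite big_split /= -mulr_sumr (pohozaev_flux _ _ _ _ _ _ x x) exchange_big /=.
  rewrite [RHS]mulrDr; congr (_ + _); first by rewrite /cflux subr0; ring.
  rewrite mulr_sumr; apply: eq_bigr => j _; rewrite -mulr_sumr pohozaev_flux /cflux; ring.
move: Z; rewrite (funext E) => Z.
have bsum : bsupp (fun x => \sum_j r^-1 ^+ 2 * cflux U dU X0 l0 S b r (p j) x).
  by apply: bsupp_sum => j; exact: bsupp_scale.
rewrite (fctnZ HJ) in Z; last exact: bsupp_scale_add.
have [lin _ _ _] := HI; rewrite lin // (fctn_sum HJ) in Z; last by move=> j; exact: bsupp_scale.
rewrite (eq_bigr (fun j => r^-1 ^+ 2 * I (cflux U dU X0 l0 S b r (p j)))) in Z; last first.
  by move=> j _; rewrite (fctnZ HJ).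
by move: Z; move: (\sum_j _) (I _) => z w; lra.
Qed.

End Cutoff.

Variables (eps : 'I_k -> R) (a : 'I_k -> V).
Hypothesis Hpar : forall j, fowler_parameters U (p j) (eps j) (a j).
Variable A0 : R.
Hypothesis A00 : 0 < A0.
Hypothesis Uoo : forall e : R, 0 < e -> \forall s \near +oo, forall y : V, shell y ->
  `|s `^ (n%:R - 2) * U (0 + s *: y) - A0 * dotp y y `^ ((2 - n%:R) / 2)| <= e.

(** For a fixed large s the flux at radius s equals the sum of local fluxes at every small r, hence
    their limit as r tends to 0; letting s tend to infinity then shows that this limit is 0. *)
Theorem pohozaev_balance :
  \sum_j fowlerH n (eps j) * (dotp (cfield X0 l0 S b (p j)) (a j) + cdiv l0 b (p j) / 2) = 0.
Proof.
have Q0 : 0 <= \sum_j dotp (p j) (p j) by apply: sumr_ge0 => j _; exact: dotp_ge0.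
have dotp_gt0 (x : V) : x != 0 -> 0 < dotp x x.
  move=> x0; rewrite lt_def dotp_ge0 andbT; apply: contraNneq x0 => h.
  apply/eqP/rowP => i; rewrite mxE; apply/eqP; rewrite -sqrf_eq0; apply/eqP/le_anti.
  by rewrite sqr_ge0 andbT -h coord_sqr_le.
have ins : \forall s \near +oo, forall j, s^-1 ^+ 2 * dotp (p j) (p j) < 1.
  apply: filterS sqr_points_near => s [s0 hs] j.
  rewrite exprVn mulrC ltr_pdivrMr ?exprn_gt0 // mul1r; apply: le_lt_trans (dotp_points_le j) _.
  by move: hs Q0; move: (\sum_j _) (s ^+ 2) => z w; lra.
(* 5 is the outer bound of |y|^2 on the shell and exceeds the value 4 beyond which the cutoffs
   vanish; one condition serves both purposes. *)
have sep i j : i != j -> \forall r \near 0^'+, 5 * r ^+ 2 < dotp (p j - p i) (p j - p i).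
  move=> ij; have d0 : 0 < dotp (p j - p i) (p j - p i).
    apply: dotp_gt0; rewrite subr_eq0; apply: contraNneq ij => /p_inj ->; exact: eqxx.
  near=> r; have r0 : 0 < r by near: r; exact: nbhs_right_gt.
  have r1 : r < 1 by near: r; exact: nbhs_right_lt.
  have rd : r < dotp (p j - p i) (p j - p i) / 5 by near: r; apply: nbhs_right_lt; rewrite divr_gt0.
  rewrite mulrC -ltr_pdivlMr //; apply: lt_trans rd.
  by rewrite expr2 gtr_pMl.
have sepr : \forall r \near 0^'+, forall i j, i != j -> 5 * r ^+ 2 < dotp (p j - p i) (p j - p i).
  have H i j : \forall r \near 0^'+, i != j -> 5 * r ^+ 2 < dotp (p j - p i) (p j - p i).
    have [->|ij] := eqVneq i j; first by near=> r.
    by apply: filterS (sep i j ij).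
  exact: (filter_forall _ (fun i => filter_forall _ (H i))).
have Dr : \forall r \near 0^'+, forall j y, shell y -> D (p j + r *: y).
  near=> r; have r0 : 0 < r by near: r; exact: nbhs_right_gt.
  have hs : forall i j, i != j -> 5 * r ^+ 2 < dotp (p j - p i) (p j - p i) by near: r.
  move=> j y /andP[y1 y5] [i _ pi].
  have E : dotp (p i - p j) (p i - p j) = r ^+ 2 * dotp y y by rewrite pi addrAC subrr add0r dotp_affine0.
  have [ij|ij] := eqVneq j i.
    move: E; rewrite ij subrr dotp0l => /esym/eqP; rewrite mulf_eq0 expf_eq0 /= gt_eqF //= => /eqP y0.
    by move: y1; rewrite y0; lra.
  have := hs _ _ ij; rewrite E mulrC ltr_pM2l ?exprn_gt0 //; lra.
have sepr4 : \forall r \near 0^'+, forall i j, i != j -> 4 < r^-1 ^+ 2 * dotp (p j - p i) (p j - p i).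
  near=> r; have r0 : 0 < r by near: r; exact: nbhs_right_gt.
  have hs : forall i j, i != j -> 5 * r ^+ 2 < dotp (p j - p i) (p j - p i) by near: r.
  move=> i j /hs.
  rewrite exprVn [in X in _ -> X]mulrC ltr_pdivlMr ?exprn_gt0 //; apply: le_lt_trans.
  by rewrite ler_wpM2r ?sqr_ge0 // ler_nat.
set T := \sum_j _.
have lim0 : (fun r => \sum_j r^-1 ^+ 2 * I (cflux U dU X0 l0 S b r (p j))) @ 0^'+ -->
   I (@newton_weight R n) * T.
  rewrite /T mulr_sumr; apply: cvg_big => [|j _]; first exact: add_continuous.
  apply: (local_flux hn HI CU CdU U0 yamabe skewS (Hpar j)).
  by apply: filterS Dr => r; apply.
have bal : \forall s \near +oo, s^-1 ^+ 2 * I (cflux U dU X0 l0 S b s 0) = I (@newton_weight R n) * T.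
  near=> s; have s0 : 0 < s by near: s; exact: nbhs_pinfty_gt.
  have hin : forall j, s^-1 ^+ 2 * dotp (p j) (p j) < 1 by near: s.
  have Dss : forall y, shell y -> D (0 + s *: y) by near: s; exact: regular_far.
  refine (@cvg_unique _ (@Rhausdorff R) _ _ _ _ _ lim0); apply: cvg_near_cst.
  near=> r; have r0 : 0 < r by near: r; exact: nbhs_right_gt.
  have h4 : forall i j, i != j -> 4 < r^-1 ^+ 2 * dotp (p j - p i) (p j - p i) by near: r.
  have h5 : forall j y, shell y -> D (p j + r *: y) by near: r.
  exact: (flux_balance r0 s0 hin h4 h5 Dss).
have limoo := infinity_flux hn HI CU CdU U0 yamabe X0 l0 b skewS regular_far A00 Uoo.
have WT : I (@newton_weight R n) * T = 0.
  refine (@cvg_unique _ (@Rhausdorff R) _ _ _ _ _ limoo).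
  by apply: cvg_near_cst; apply: filterS bal => s ->.
by move/eqP: WT; rewrite mulf_eq0 gt_eqF ?(newton_weight_pos hn HI) //= => /eqP.
Unshelve. all: by end_near. Qed.

End Global.

(** * Stereographic projection *)

Section Stereographic.
Variables (R : realType) (n : nat).
Notation V := 'rV[R]_n.
Notation W := 'rV[R]_n.+1.

Lemma dotp_mulmx m (x y : 'rV[R]_m) : x *m y^T = (dotp x y)%:M.
Proof.
apply/matrixP => i j; rewrite !mxE !ord1 eqxx mulr1n.
by apply: eq_bigr => l _; rewrite !mxE.
Qed.

Lemma scalar_mx1_inj (a b : R) : a%:M = b%:M :> 'M[R]_1 -> a = b.
Proof. by move=> /matrixP/(_ 0 0); rewrite !mxE eqxx !mulr1n. Qed.

Section Frame.
Variables (N : W) (E : 'M[R]_(n, n.+1)).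
Hypothesis frameNE : stereo_frame N E.

Lemma frame_NN : dotp N N = 1. Proof. by case: frameNE. Qed.

Lemma frame_EE (x y : V) : dotp (x *m E) (y *m E) = dotp x y.
Proof.
case: frameNE => _ EE _; apply: scalar_mx1_inj.
by rewrite -!dotp_mulmx trmx_mul mulmxA -(mulmxA x) EE mulmx1.
Qed.

Lemma frame_EN (x : V) : dotp (x *m E) N = 0.
Proof.
case: frameNE => _ _ EN; apply: scalar_mx1_inj.
by rewrite -dotp_mulmx -mulmxA EN mulmx0 raddf0.
Qed.

(** [N] and the rows of [E] form a square matrix with orthonormal rows, hence also with orthonormal
    columns. *)
Lemma frame_complete (z : W) : z = dotp z N *: N + z *m E^T *m E.
Proof.
case: frameNE => NN EE EN.
have NE : N *m E^T = 0 by rewrite -(trmxK N) -trmx_mul EN trmx0.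
have Q1 : col_mx N E *m (col_mx N E)^T = 1%:M :> 'M[R]_(1 + n).
  rewrite tr_col_mx mul_col_row dotp_mulmx NN EE EN NE; exact: esym (scalar_mx_block _ _ _).
have := mulmx1C Q1; rewrite tr_col_mx mul_row_col => Q2.
rewrite -{1}(mulmx1 z) -[X in z *m X]Q2 mulmxDr !mulmxA; congr (_ + _).
by rewrite dotp_mulmx mul_scalar_mx.
Qed.

Lemma rho1_gt0 (x : V) : 0 < 1 + dotp x x.
Proof. by rewrite ltr_pwDl // dotp_ge0. Qed.

Lemma stereo_inv_sphere (x : V) : sphere (stereo_inv N E x).
Proof.
rewrite /sphere /= /stereo_inv.
rewrite !(dotpZl, dotpZr, dotpDl, dotpDr) (dotpC N) !frame_EE !frame_EN frame_NN.
by field; rewrite gt_eqF // rho1_gt0.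
Qed.

Lemma stereoK (z : W) : sphere z -> z <> N -> stereo_inv N E (stereo N E z) = z.
Proof.
rewrite /sphere /= => zz zN; set t := dotp z N.
have t1 : 1 - t != 0.
  apply: contra_notN zN => /eqP h.
  have d0 : dotp (z - N) (z - N) = 0.
    rewrite dotpDl !dotpDr !dotpNl !dotpNr (dotpC N z) zz frame_NN -/t; move: h; lra.
  apply/eqP; rewrite -subr_eq0; apply/eqP/rowP => i; rewrite [RHS]mxE.
  apply/eqP; rewrite -sqrf_eq0; apply/eqP/le_anti.
  by rewrite sqr_ge0 andbT -d0 coord_sqr_le.
have zE := frame_complete z; rewrite -/t in zE.
have zEE : dotp (z *m E^T) (z *m E^T) = 1 - t ^+ 2.
  have := zz; rewrite {1 2}zE dotpDl !dotpDr !dotpZl !dotpZr (dotpC N) frame_EE frame_EN frame_NN.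
  by rewrite expr2; lra.
rewrite /stereo_inv /stereo -/t dotpZl dotpZr zEE -scalemxAl.
have h1 : 1 + (1 - t)^-1 * ((1 - t)^-1 * (1 - t ^+ 2)) = 2 / (1 - t) by field.
have h2 : (1 - t)^-1 * ((1 - t)^-1 * (1 - t ^+ 2)) - 1 = 2 * t / (1 - t) by field.
rewrite h1 h2 scalerDr !scalerA [in RHS]zE [RHS]addrC; congr (_ + _ *: _).
  by rewrite -[RHS]scale1r; congr (_ *: _); field.
by field.
Qed.

Lemma stereo_invK (x : V) : stereo N E (stereo_inv N E x) = x.
Proof.
case: frameNE => NN EE EN.
have NE : N *m E^T = 0 by rewrite -(trmxK N) -trmx_mul EN trmx0.
have r0 := rho1_gt0 x.
rewrite /stereo /stereo_inv -scalemxAl mulmxDl -!scalemxAl -mulmxA EE mulmx1 NE scaler0 addr0.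
rewrite dotpZl dotpDl !dotpZl frame_EN NN !scalerA -[RHS]scale1r; congr (_ *: _).
by field; rewrite gt_eqF //= (_ : _ - _ = 2) ?pnatr_eq0 //; ring.
Qed.

(** In stereographic coordinates the round metric is [conf_factor ^+ 2] times the Euclidean one. *)
Definition conf_factor (x : V) : R := 2 / (1 + dotp x x).

Lemma conf_factor_gt0 x : 0 < conf_factor x.
Proof. by rewrite divr_gt0 // rho1_gt0. Qed.

Lemma stereo_invE (x : V) : stereo_inv N E x = N + conf_factor x *: (x *m E - N).
Proof.
apply/rowP => i; rewrite /stereo_inv /conf_factor !mxE; move: (\sum_j _) => z.
by field; rewrite gt_eqF // rho1_gt0.
Qed.

Lemma C1_conf_factor : C1 setT conf_factor (fun i x => - conf_factor x ^+ 2 * x 0 i).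
Proof.
have D (s : R) : 1 + s != 0 -> is_derive s 1 (fun t => 2 * (1 + t)^-1) (- 2^-1 * (2 * (1 + s)^-1) ^+ 2).
  move=> s0; have D1 := is_derive_add (is_derive_cst (1 : R) s 1) (is_derive_id s 1).
  have D2 := is_deriveV s0 D1.
  apply: is_derive_ext (is_derive_mul (is_derive_cst (2 : R) s 1) D2) => //.
  by rewrite /GRing.scale /=; field.
refine (C1_eq (@C1_comp R n setT (fun t => 2 * (1 + t)^-1)
  (fun t => - 2^-1 * (2 * (1 + t)^-1) ^+ 2) _ _ (@C1_rho R n setT) _) _ _) => //.
- move=> x _; have r0 : 1 + dotp x x != 0 by rewrite gt_eqF // rho1_gt0.
  split; first exact: D.
  have c := is_derive_continuous (D _ r0).
  apply: continuousM; first exact: cst_continuous.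
  apply: (@continuous_comp _ _ _ (fun t : R => 2 * (1 + t)^-1) (fun y => y ^+ 2)) => //.
  exact: exprn_continuous.
- by move=> i x; rewrite /conf_factor; field; rewrite gt_eqF // rho1_gt0.
Qed.

Lemma stereo_inv_coord (x : V) m :
  stereo_inv N E x 0 m = N 0 m + conf_factor x * (\sum_j x 0 j * E j m - N 0 m).
Proof. by rewrite stereo_invE !mxE. Qed.

Lemma C1_stereo_inv m : C1 setT (fun x => stereo_inv N E x 0 m)
  (fun i x => conf_factor x * E i m - conf_factor x ^+ 2 * x 0 i * (\sum_j x 0 j * E j m - N 0 m)).
Proof.
refine (C1_eq (C1_add (@C1_cst R n setT (N 0 m)) (C1_mul C1_conf_factor
  (C1_sub_fun (C1_sum (fun j => C1_mul (@C1_coord R n setT j) (@C1_cst R n setT (E j m))))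
    (@C1_cst R n setT (N 0 m))))) _ _).
  by move=> x; rewrite stereo_inv_coord.
move=> i x; have -> : \sum_j ((i == j)%:R * E j m + x 0 j * 0) = E i m.
  rewrite (bigD1 i) //= big1 => [|j ji]; first by rewrite eqxx mul1r mulr0 !addr0.
  by rewrite eq_sym (negbTE ji) mul0r mulr0 addr0.
by move: (\sum_j _) => z; ring.
Qed.

Lemma partial_stereo_inv (x : V) i : partial i (stereo_inv N E) x =
  conf_factor x *: (delta_mx 0 i *m E) - (conf_factor x ^+ 2 * x 0 i) *: (x *m E - N).
Proof.
have D m := C1_der i (C1_stereo_inv m) (Logic.I : setT x).
have d : derivable (stereo_inv N E) x (delta_mx 0 i).
  by apply/derivable_mxP => a m; rewrite ord1; case: (D m).
rewrite /partial derive_mx //; apply/rowP => m; rewrite mxE (@derive_val _ _ _ _ _ _ _ (D m)).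
by rewrite -rowE !mxE.
Qed.

Lemma pullback_round x i j :
  round_metric (stereo_inv N E x) (partial i (stereo_inv N E) x) (partial j (stereo_inv N E) x) =
  conf_factor x ^+ 2 * (i == j)%:R.
Proof.
rewrite /round_metric !partial_stereo_inv.
rewrite dotpDl !dotpDr !dotpNl !dotpNr !dotpZl !dotpZr.
rewrite !(dotpDl, dotpDr, dotpNl, dotpNr) ![dotp N (_ *m E)]dotpC !frame_EE !frame_EN frame_NN.
have D1 (a : 'I_n) (y : V) : dotp (delta_mx 0 a) y = y 0 a.
  rewrite /dotp (bigD1 a) //= big1 => [|m ma]; first by rewrite mxE !eqxx mul1r addr0.
  by rewrite mxE (negbTE ma) andbF mul0r.
have -> : dotp (delta_mx 0 i) (delta_mx 0 j : V) = (i == j)%:R by rewrite D1 mxE eqxx.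
rewrite (dotpC x (delta_mx 0 j)) !D1.
have w : conf_factor x * (1 + dotp x x) = 2 by rewrite divfK // gt_eqF // rho1_gt0.
move: (conf_factor x) (dotp x x) w => w r wr; move: (x 0 i) (x 0 j) (_%:R) => a b dl.
have -> : r = 1 * r by rewrite mul1r.
apply/eqP; rewrite -subr_eq0; apply/eqP.
transitivity (w ^+ 3 * a * b * (w * (1 + r) - 2)); first by ring.
by rewrite wr subrr mulr0.
Qed.

End Frame.

Lemma stereo_frameN (N : W) (E : 'M[R]_(n, n.+1)) : stereo_frame N E -> stereo_frame (- N) E.
Proof.
case=> NN EE EN; split=> //; first by rewrite dotpNl dotpNr opprK.
by rewrite linearN /= mulmxN EN oppr0.
Qed.

(** Projections from antipodal points differ by the inversion x / |x|^2, which carries a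
    neighbourhood of infinity to one of the origin in the chart from [- N]. *)
Lemma stereo_inv_inversion (N : W) (E : 'M[R]_(n, n.+1)) (x : V) : dotp x x != 0 ->
  stereo_inv N E x = stereo_inv (- N) E ((dotp x x)^-1 *: x).
Proof.
move=> x0; have r0 : 1 + dotp x x != 0 by rewrite gt_eqF // rho1_gt0.
apply/rowP => i; rewrite /stereo_inv !dotpZl !dotpZr -scalemxAl !mxE.
by move: (\sum_j _) x0 r0; move: (dotp x x) => r z x0 r0; field; rewrite x0 /= addrC r0.
Qed.

Lemma stereo_inv0 (N : W) (E : 'M[R]_(n, n.+1)) : stereo_inv (- N) E 0 = N.
Proof.
by rewrite /stereo_inv dotp0l addr0 invr1 scale1r mul0mx scaler0 add0r sub0r scaleN1r opprK.
Qed.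

End Stereographic.

(** * Scalar curvature of a conformally flat metric *)

Section ConformallyFlat.
Variables (R : realType) (n : nat).
Notation V := 'rV[R]_n.

Lemma sum_delta (i : 'I_n) (f : 'I_n -> R) : \sum_l f l * (i == l)%:R = f i.
Proof.
rewrite (bigD1 i) //= big1 => [|l li]; first by rewrite eqxx mulr1 addr0.
by rewrite eq_sym (negbTE li) mulr0.
Qed.

Lemma sum_delta1 (i : 'I_n) : \sum_l (i == l)%:R = 1 :> R.
Proof. by rewrite -[RHS](sum_delta i (fun=> 1)); apply: eq_bigr => l _; rewrite mul1r. Qed.

(** [a], [b], [c] will be the Kronecker deltas of (i, l), (i, s) and (l, s) in the quadratic part of
    the Ricci tensor; the two sides differ by multiples of a^2 - a, b^2 - b and c^2 - c. *)
Lemma christoffel_product (fi fs fl a b c : R) : a * a = a -> b * b = b -> c * c = c ->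
  (fl * c + fs * 1 - fl * c) * (fi * b + fi * b - fs * 1) -
    (fi * c + fs * a - fl * b) * (fi * c + fl * b - fs * a) =
  (2 * fi - 2 * fl * a) * (fs * b) + (a - 1) * fs ^+ 2 + (- fi ^+ 2 * c + fl ^+ 2 * b).
Proof.
move=> ha hb hc; apply/eqP; rewrite -subr_eq0; apply/eqP.
transitivity (- fi ^+ 2 * (c * c - c) + fs ^+ 2 * (a * a - a) + fl ^+ 2 * (b * b - b)); first by ring.
by rewrite ha hb hc !subrr !mulr0 !addr0.
Qed.

Lemma natr_bool_sqr (t : bool) : t%:R * t%:R = t%:R :> R.
Proof. by case: t; rewrite ?mulr1 ?mulr0. Qed.

(* phi = exp (2 f) and F = grad f *)
Variables (D : set V) (g : V -> 'M[R]_n) (phi : V -> R) (F : 'I_n -> V -> R)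
  (FF : 'I_n -> 'I_n -> V -> R).
Hypothesis oD : open D.
Hypothesis gE : forall x, D x -> g x = (phi x)%:M.
Hypothesis phi0 : forall x, D x -> 0 < phi x.
Hypothesis Dphi : forall x i, D x -> is_derive x (delta_mx 0 i) phi (2 * F i x * phi x).
Hypothesis CF : forall i, C1 D (F i) (FF i).

Lemma partial_near (f h : V -> R) (x : V) (i : 'I_n) (df : R) : D x ->
  (forall y, D y -> f y = h y) -> is_derive x (delta_mx 0 i) h df -> partial i f x = df.
Proof.
move=> Dx E Dh; rewrite /partial (near_eq_derive (g := h)); first exact: derive_val.
exact: open_near_eq oD Dx E.
Qed.

Lemma partial_metric (x : V) i j s : D x ->
  partial i (fun y => g y j s) x = 2 * F i x * phi x * (j == s)%:R.
Proof.
move=> Dx; apply: (partial_near (h := fun y => phi y * (j == s)%:R)) => //.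
  by move=> y Dy; rewrite gE // mxE mulr_natr.
apply: is_derive_ext (is_derive_mul (Dphi i Dx) (is_derive_cst ((j == s)%:R : R) _ _)) => //.
by rewrite mulr0 addr0.
Qed.

Lemma christoffelE l i j (x : V) : D x -> christoffel g l i j x =
  F i x * (j == l)%:R + F j x * (i == l)%:R - F l x * (i == j)%:R.
Proof.
move=> Dx; rewrite /christoffel gE // invmx_scalar.
rewrite (eq_bigr (fun s => ((phi x)^-1 * (partial i (fun y => g y j s) x +
   partial j (fun y => g y i s) x - partial s (fun y => g y i j) x)) * (l == s)%:R)); last first.
  by move=> s _; rewrite mxE -mulr_natr; ring.
rewrite sum_delta !partial_metric //; have := phi0 Dx.
by move: (phi x) => z z0; field; rewrite gt_eqF.
Qed.

Lemma partial_christoffel l i j m (x : V) : D x -> partial m (christoffel g l i j) x =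
  FF i m x * (j == l)%:R + FF j m x * (i == l)%:R - FF l m x * (i == j)%:R.
Proof.
move=> Dx.
have C (a : 'I_n) (t : bool) : C1 D (fun y => F a y * t%:R) (fun m y => FF a m y * t%:R).
  by refine (C1_eq (C1_mul (@CF a) (@C1_cst R n D t%:R)) _ _) => // k y; rewrite mulr0 addr0.
have CC := C1_sub_fun (C1_add (C i (j == l)) (C j (i == l))) (C l (i == j)).
apply: partial_near Dx _ (C1_der m CC Dx) => y Dy; exact: christoffelE.
Qed.

(** The diagonal suffices for the scalar curvature, because the inverse of a conformally flat metric
    is a multiple of the identity. *)
Lemma ricci_diag i (x : V) : D x -> ricci g i i x =
  (2 - n%:R) * FF i i x - \sum_l FF l l x + (n%:R - 2) * F i x ^+ 2 + (2 - n%:R) * \sum_l F l x ^+ 2.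
Proof.
move=> Dx; rewrite /ricci; set Q := \sum_l F l x ^+ 2; set La := \sum_l FF l l x.
have S (l : 'I_n) : \sum_s (christoffel g l l s x * christoffel g s i i x -
    christoffel g l i s x * christoffel g s i l x) =
    F i x ^+ 2 - Q + (Q - 2 * F i x * F l x) * (i == l)%:R + F l x ^+ 2.
  rewrite (eq_bigr (fun s => (2 * F i x - 2 * F l x * (i == l)%:R) * (F s x * (i == s)%:R) +
     ((i == l)%:R - 1) * F s x ^+ 2 + (- F i x ^+ 2 * (l == s)%:R + F l x ^+ 2 * (i == s)%:R))); last first.
    move=> s _; rewrite !christoffelE // !eqxx [s == l]eq_sym.
    by apply: christoffel_product; exact: natr_bool_sqr.
  rewrite !big_split /= -!mulr_sumr sum_delta !sum_delta1 -/Q; ring.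
rewrite (eq_bigr (fun l => (2 * FF i l x + Q - 2 * F i x * F l x) * (i == l)%:R + - FF l l x
  + (F i x ^+ 2 - Q - FF i i x) + F l x ^+ 2)); last first.
  by move=> l _; rewrite S !partial_christoffel // !eqxx /=; ring.
have [t tE] : exists t, F i x ^+ 2 - Q - FF i i x = t by eexists.
by rewrite tE !big_split /= sum_delta sumrN sumr_const card_ord -/Q -/La -(mulr_natl t) -tE; ring.
Qed.

Lemma scalar_curvature_conformal (x : V) : D x -> scalar_curvature g x =
  (phi x)^-1 * (- (2 * (n%:R - 1)) * \sum_i FF i i x - (n%:R - 1) * (n%:R - 2) * \sum_i F i x ^+ 2).
Proof.
move=> Dx; rewrite /scalar_curvature gE // invmx_scalar.
rewrite (eq_bigr (fun i => (phi x)^-1 * ricci g i i x)); last first.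
  move=> i _; rewrite (eq_bigr (fun j => (phi x)^-1 * ricci g i j x * (i == j)%:R)) ?sum_delta //.
  by move=> j _; rewrite mxE -mulr_natr; ring.
rewrite -mulr_sumr; congr (_ * _).
rewrite (eq_bigr (fun i => (2 - n%:R) * FF i i x + (n%:R - 2) * F i x ^+ 2 +
  (- (\sum_l FF l l x) + (2 - n%:R) * \sum_l F l x ^+ 2))); last first.
  by move=> i _; rewrite ricci_diag //; ring.
have [t tE] : exists t, - \sum_l FF l l x + (2 - n%:R) * \sum_l F l x ^+ 2 = t by eexists.
rewrite tE !big_split /= -!mulr_sumr sumr_const card_ord -(mulr_natl t) -tE.
by move: (\sum_i _) (\sum_i _) => z w; ring.
Qed.

End ConformallyFlat.

(** * The equation for the conformal factor *)

Section C2.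
Variables (R : realType) (n : nat).
Notation V := 'rV[R]_n.
Implicit Types (D : set V) (f h : V -> R).

Definition C2 D f := exists (df : 'I_n -> V -> R) (ddf : 'I_n -> 'I_n -> V -> R),
  C1 D f df /\ forall i, C1 D (df i) (ddf i).

Lemma smooth_on_C2 D f : smooth_on D f -> C2 D f.
Proof.
move=> H; exists (fun i => partial i f), (fun i j => partial j (partial i f)).
split=> [|i] x Dx.
  split; first by case: (H [::] x Dx).
  move=> i; split; first by have [_ /(_ i) d] := H [::] x Dx; exact: derivableP.
  by case: (H [:: i] x Dx).
split; first by case: (H [:: i] x Dx).
move=> j; split; first by have [_ /(_ j) d] := H [:: i] x Dx; exact: derivableP.
by case: (H [:: j; i] x Dx).
Qed.

Lemma C2_sub D D' f : D' `<=` D -> C2 D f -> C2 D' f.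
Proof.
move=> sD [df [ddf [C Cd]]]; exists df, ddf; split; first exact: C1_sub sD C.
by move=> i; exact: C1_sub sD (Cd i).
Qed.

Lemma C2_mul D f h : C2 D f -> C2 D h -> C2 D (fun x => f x * h x).
Proof.
move=> [df [ddf [C Cd]]] [dh [ddh [K Kd]]].
exists (fun i x => df i x * h x + f x * dh i x), (fun i j x =>
  ddf i j x * h x + df i x * dh j x + (df j x * dh i x + f x * ddh i j x)).
split; first exact: C1_mul.
by move=> i; exact: C1_add (C1_mul (Cd i) K) (C1_mul C (Kd i)).
Qed.

Lemma C2_eq_on D f h : open D -> C2 D f -> (forall x, D x -> f x = h x) -> C2 D h.
Proof.
move=> oD [df [ddf [C Cd]]] E; exists df, ddf; split=> //.
exact: C1_eq_on oD C E _.
Qed.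

Lemma C2_conf_factor (r : R) : C2 setT (fun x : V => conf_factor x `^ r).
Proof.
have CP (t : R) : C1 setT (fun x : V => conf_factor x `^ t)
    (fun i x => t * conf_factor x `^ (t - 1) * (- conf_factor x ^+ 2 * x 0 i)).
  refine (@C1_comp _ _ setT (fun s => s `^ t) (fun s => t * s `^ (t - 1)) _ _ (@C1_conf_factor R n) _) => x _.
  have w0 := conf_factor_gt0 x.
  split; first exact: is_derive1_powR.
  apply: continuousM; first exact: cst_continuous.
  exact: is_derive_continuous (is_derive1_powR _ w0).
have CX : C1 setT (fun x : V => - conf_factor x ^+ 2) _ :=
  C1_eq (C1_scale (-1) (C1_mul (@C1_conf_factor R n) (@C1_conf_factor R n)))
   (fun x => mulN1r _) (fun i x => erefl).
eexists; eexists; split; first exact: CP.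
by move=> i; exact: (C1_mul (C1_scale r (CP (r - 1))) (C1_mul CX (@C1_coord R n setT i))).
Qed.

End C2.

Section Yamabe.
Variables (R : realType) (n : nat).
Hypothesis hn : (3 <= n)%N.
Notation V := 'rV[R]_n.
Let c : R := n%:R * (n%:R - 2) / 4.
Variables (D : set V) (g : V -> 'M[R]_n) (U : V -> R) (dU : 'I_n -> V -> R) (ddU : 'I_n -> 'I_n -> V -> R).
Hypotheses (oD : open D) (CU : C1 D U dU) (CdU : forall i, C1 D (dU i) (ddU i)).
Hypothesis U0 : forall x, D x -> 0 < U x.
Hypothesis gE : forall x, D x -> g x = (U x `^ (4 / (n%:R - 2)))%:M.

(** [L] and [G] stand for Delta U and |DU|^2; the exponent 4/(n-2) of the conformal factor is the
    one for which the terms in [G] cancel. *)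
Lemma yamabe_arith (m u L G phi : R) : 1 <= m - 2 -> 0 < u -> 0 < phi ->
  phi^-1 * (- (2 * (m - 1)) * (2 / (m - 2) * u^-1 * L - 2 / (m - 2) * u^-1 ^+ 2 * G)
     - (m - 1) * (m - 2) * ((2 / (m - 2)) ^+ 2 * u^-1 ^+ 2 * G)) = m * (m - 1) ->
  L = - (m * (m - 2) / 4) * (u * phi).
Proof.
move=> m2 u0 p0; have d0 : m - 2 != 0 by rewrite gt_eqF // (lt_le_trans _ m2).
have m1 : m - 1 != 0 by rewrite gt_eqF //; lra.
have un : u != 0 by rewrite gt_eqF.
have pn : phi != 0 by rewrite gt_eqF.
rewrite (_ : _ - (m - 1) * (m - 2) * _ = - (4 * (m - 1)) / (m - 2) * u^-1 * L); last first.
  by field; rewrite un d0.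
move=> h; apply: (mulfI (x := - (4 * (m - 1)) / (m - 2) * u^-1)).
  by rewrite !mulf_neq0 ?invr_eq0 // oppr_eq0 mulf_neq0 // pnatr_eq0.
move/(canRL (mulKf _)): h; rewrite invr_eq0 pn => /(_ isT) ->; rewrite invrK.
by field; rewrite un d0.
Qed.

Lemma yamabe_equation : (forall x, D x -> scalar_curvature g x = n%:R * (n%:R - 1)) ->
  forall x, D x -> \sum_i ddU i i x = - c * critical_pow n (U x).
Proof.
move=> hs x Dx; have [h3 h1 c0 p1] := dim_facts R hn.
have d0 : n%:R - 2 != 0 :> R by rewrite gt_eqF // (lt_le_trans _ h1).
(* [F] has to be half the gradient of ln phi with phi = U^(4/(n-2)), which gives the factor
   2/(n-2). *)
pose kp : R := 2 / (n%:R - 2).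
have CV : C1 D (fun x => (U x)^-1) (fun i x => - (U x)^-1 ^+ 2 * dU i x).
  refine (@C1_comp _ _ D (fun s => s^-1) (fun s => - s^-1 ^+ 2) _ _ CU _) => y Dy.
  have un : U y != 0 by rewrite gt_eqF // U0.
  have DV : is_derive (U y) 1 (fun s : R => s^-1) (- (U y)^-1 ^+ 2).
    have := is_deriveV un (is_derive_id (U y) 1); apply: is_derive_ext => //.
    by rewrite /GRing.scale /= mulr1 exprVn.
  split=> //; apply: continuousN.
  apply: (@continuous_comp _ _ _ (fun s : R => s^-1) (fun s => s ^+ 2)); last exact: exprn_continuous.
  exact: is_derive_continuous DV.
pose F i y := kp * dU i y * (U y)^-1.
pose FF i j y := kp * ddU i j y * (U y)^-1 + kp * dU i y * (- (U y)^-1 ^+ 2 * dU j y).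
have CF i : C1 D (F i) (FF i) by exact: C1_mul (C1_scale kp (CdU i)) CV.
pose phi y := U y `^ (4 / (n%:R - 2)).
have phi0 y : D y -> 0 < phi y by move=> Dy; rewrite powR_gt0 // U0.
have Dphi y i : D y -> is_derive y (delta_mx 0 i) phi (2 * F i y * phi y).
  move=> Dy; have := is_derive_comp1 (C1_der i CU Dy) (is_derive1_powR (4 / (n%:R - 2)) (U0 Dy)).
  apply: is_derive_ext => //.
  have -> : phi y = U y * U y `^ (4 / (n%:R - 2) - 1).
    by rewrite mul_powR ?U0 //; congr (_ `^ _); ring.
  have := U0 Dy; rewrite /F /kp; move: (U y) (_ `^ _) => u z u0.
  by field; rewrite (gt_eqF u0) d0.
have := hs x Dx; rewrite (scalar_curvature_conformal oD gE phi0 Dphi CF Dx).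
have -> : critical_pow n (U x) = U x * phi x.
  rewrite mul_powR ?U0 // /critical_pow; congr (_ `^ _); field; exact: d0.
have -> : \sum_i FF i i x = kp * (U x)^-1 * (\sum_i ddU i i x) - kp * (U x)^-1 ^+ 2 * \sum_i dU i x ^+ 2.
  by rewrite !mulr_sumr -sumrB; apply: eq_bigr => i _; rewrite /FF; ring.
have -> : \sum_i F i x ^+ 2 = kp ^+ 2 * (U x)^-1 ^+ 2 * \sum_i dU i x ^+ 2.
  by rewrite mulr_sumr; apply: eq_bigr => i _; rewrite /F; ring.
by apply: yamabe_arith => //; [exact: U0|exact: phi0].
Qed.

End Yamabe.

(** * Proof of the theorem *)

Section Transfer.
Variables (R : realType) (n k : nat).
Hypothesis hn : (3 <= n)%N.
Notation V := 'rV[R]_n.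
Notation W := 'rV[R]_n.+1.
Let d : R := n%:R - 2.
Let c : R := n%:R * (n%:R - 2) / 4.

Variables (q : 'I_k -> W).
Hypotheses (q_sphere : forall j, sphere (q j)) (q_inj : injective q).
Variable u : W -> R.
Hypothesis u_pos : forall z, punctured_sphere q z -> 0 < u z.
Hypothesis u_smooth : sphere_smooth (punctured_sphere q) u.
Hypothesis g_scal : constant_scalar_curvature (punctured_sphere q) (conformal_metric u) (n%:R * (n%:R - 1)).
Variables (N : W) (E : 'M[R]_(n, n.+1)).
Hypotheses (frameNE : stereo_frame N E) (N_regular : ~ range q N).
Variable p : 'I_k -> V.
Hypothesis p_def : forall j, p j = stereo N E (q j).
Variable U : V -> R.
Hypothesis U_pos : forall x, ~ range p x -> 0 < U x.
Hypothesis U_metric : forall x, ~ range p x ->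
  pullback (conformal_metric u) (stereo_inv N E) x = (U x `^ (4 / (n%:R - 2)))%:M.

Let D : set V := [set x | ~ range p x].

Lemma stereo_inv_p j : stereo_inv N E (p j) = q j.
Proof. by rewrite p_def stereoK // => h; apply: N_regular; exists j. Qed.

Lemma p_injective : injective p.
Proof. by move=> i j /(congr1 (stereo_inv N E)); rewrite !stereo_inv_p => /q_inj. Qed.

Lemma regular_punctured x : D x -> punctured_sphere q (stereo_inv N E x).
Proof.
move=> Dx; split; first exact: stereo_inv_sphere.
by move=> [j _ h]; apply: Dx; exists j => //; rewrite p_def h stereo_invK.
Qed.

(** A diagonal entry of [U_metric] equates U^(4/(n-2)) with u^(4/(n-2)) times the square of
    [conf_factor]; raising to the power (n-2)/4 gives the formula. *)
Lemma conformal_factorE x : D x ->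
  U x = u (stereo_inv N E x) * conf_factor x `^ ((n%:R - 2) / 2).
Proof.
move=> Dx; have [h3 h1 _ _] := dim_facts R hn.
have d0 : n%:R - 2 != 0 :> R by rewrite gt_eqF // (lt_le_trans _ h1).
have n0 : (0 < n)%N by apply: leq_trans hn.
have := U_metric Dx => /matrixP/(_ (Ordinal n0) (Ordinal n0)).
rewrite /pullback !mxE eqxx mulr1n /conformal_metric (pullback_round frameNE) eqxx mulr1.
have u0 := u_pos (regular_punctured Dx); have w0 := conf_factor_gt0 x; have U0 := U_pos Dx.
move=> h; have e0 : 4 / (n%:R - 2) * ((n%:R - 2) / 4) = 1 :> R by field.
rewrite -[LHS](powRr1 (ltW U0)) -e0 powRrM -h powRM ?powR_ge0 ?sqr_ge0 // -powRrM e0.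
rewrite powRr1 ?(ltW u0) //; congr (_ * _).
by rewrite -powR_mulrn ?(ltW w0) // -powRrM; congr (_ `^ _); field.
Qed.

Lemma conformal_factor_C2 : C2 D U.
Proof.
have C : C2 D (u \o stereo_inv N E).
  by apply: C2_sub (smooth_on_C2 (u_smooth frameNE)) => x; exact: regular_punctured.
have Cw : C2 D (fun x => conf_factor x `^ ((n%:R - 2) / 2)).
  by apply: C2_sub (@C2_conf_factor R n _).
apply: C2_eq_on (@regular_open R n k p) (C2_mul C Cw) _ => x Dx.
by rewrite conformal_factorE.
Qed.

Lemma powR_near1 (r e : R) : 0 < e -> exists2 dl, 0 < dl & forall h : R, `|h| < dl ->
  `|(1 + h) `^ r - 1| <= e.
Proof.
move=> e0; have := is_derive_continuous (is_derive1_powR r (ltr01 : 0 < 1 :> R)).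
move=> /cvgrPdist_le/(_ e e0)/nbhs_ballP[dl /= d0 H]; exists dl => // h hd.
have := H (1 + h); rewrite powR1 distrC; apply.
by rewrite /ball /= opprD addrA subrr sub0r normrN.
Qed.

(** The limit of |x|^(n-2) U(x) at infinity. *)
Let A0 := u N * 2 `^ ((n%:R - 2) / 2).

Lemma N_punctured : punctured_sphere q N.
Proof. by split=> //; exact: frame_NN frameNE. Qed.

(** In the chart from [- N] the point s y becomes y / (s |y|^2), which tends to 0, where [u] takes
    the value u(N) continuously; the power of the conformal factor supplies |y|^(2-n). *)
Lemma conformal_factor_infinity (e : R) : 0 < e -> \forall s \near +oo, forall y : V, shell y ->
  `|s `^ (n%:R - 2) * U (0 + s *: y) - A0 * dotp y y `^ ((2 - n%:R) / 2)| <= e.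
Proof.
move=> e0; have [h3 h1 _ _] := dim_facts R hn.
set r : R := (n%:R - 2) / 2; have r0 : 0 <= r by rewrite divr_ge0 // (le_trans _ h1).
pose v := u \o stereo_inv (- N) E.
have uN := u_pos N_punctured.
have v0 : v 0 = u N by rewrite /v /= stereo_inv0.
(* Two errors are added, one from [u] with weight 1 and one from the conformal factor with weight
   u(N), and both are multiplied by a power bounded by 4^r. *)
pose e1 := e / (4 `^ r * (1 + u N)).
have K0 : 0 < 4 `^ r * (1 + u N) by rewrite mulr_gt0 ?powR_gt0 // addr_gt0.
have e10 : 0 < e1 by rewrite divr_gt0.
have [d1 d10 H1] : exists2 d1, 0 < d1 & forall z, `|z| < d1 -> `|v z - u N| <= e1.
  have M0 : (stereo_inv (- N) E @^-1` punctured_sphere q) (0 : V).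
    by rewrite /= stereo_inv0; exact: N_punctured.
  have [cv _] := u_smooth (stereo_frameN frameNE) [::] M0.
  move: cv => /= /cvgrPdist_le/(_ _ e10)/nbhs_ballP[d1 /= d10 H]; exists d1 => // z zd.
  by have := H z; rewrite -/v distrC /= -v0; apply; rewrite -ball_normE /ball_ /= sub0r normrN.
have [d2 d20 H2] := powR_near1 r e10.
near=> s.
have s1 : 1 < s by near: s; exact: nbhs_pinfty_gt.
have s0 : 0 < s by exact: lt_trans s1.
have sd1 : 7 / d1 < s by near: s; apply: nbhs_pinfty_gt; exact: num_real.
have sd2 : 3 / d2 < s by near: s; apply: nbhs_pinfty_gt; exact: num_real.
have Ds : forall y, shell y -> D (0 + s *: y) by near: s; exact: regular_far.
move=> y Sy; have Dy := Ds y Sy; rewrite add0r in Dy *.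
have /andP[y1 y5] := Sy; set rho := dotp y y in y1 y5 *.
have rho0 : 0 < rho by apply: lt_trans y1; rewrite divr_gt0.
have ss0 : 0 < s ^+ 2 by exact: exprn_gt0.
have sn : s != 0 by rewrite gt_eqF.
have rn : rho != 0 by rewrite gt_eqF.
have E1 : dotp (s *: y) (s *: y) = s ^+ 2 * rho by exact: dotp_affine0.
rewrite conformal_factorE // stereo_inv_inversion; last by rewrite E1 mulf_neq0 // gt_eqF.
set z := (_^-1 *: (s *: y)).
(* [m] is s^2 times the conformal factor at s y. *)
pose m := 2 / (s ^- 2 + rho).
have t0 : 0 < s ^- 2 by rewrite invr_gt0.
have m0 : 0 < m by rewrite divr_gt0 // addr_gt0.
have E2 : s `^ (n%:R - 2) * conf_factor (s *: y) `^ r = m `^ r.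
  have -> : s `^ (n%:R - 2) = (s ^+ 2) `^ r.
    by rewrite -powR_mulrn ?(ltW s0) // -powRrM; congr (_ `^ _); rewrite /r; field.
  rewrite -powRM ?(ltW ss0) ?(ltW (conf_factor_gt0 _)) //; congr (_ `^ _).
  by rewrite /conf_factor E1 /m; field; rewrite sn gt_eqF ?addr_gt0 ?mulr_gt0 //.
have m4 : m `^ r <= 4 `^ r.
  apply: ge0_ler_powR; rewrite ?nnegrE ?(ltW m0) //.
  rewrite ler_pdivrMr ?addr_gt0 //; move: y1 t0; lra.
(* Since m (1 + h) = 2 / rho, the limiting value differs from the actual factor [m] raised to [r]
   only by the power (1 + h)^r, which is close to 1. *)
pose h := s ^- 2 / rho.
have h0 : 0 <= h by rewrite divr_ge0 // ltW.
have E3 : A0 * rho `^ ((2 - n%:R) / 2) = u N * (m `^ r * (1 + h) `^ r).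
  rewrite -powRM ?(ltW m0) ?addr_ge0 // /A0 -mulrA; congr (_ * _).
  have -> : m * (1 + h) = 2 * rho^-1.
    by rewrite /m /h; field; rewrite rn sn gt_eqF ?addr_gt0 ?mulr_gt0 // ltr_wpDl // mulr_ge0 ?ltW.
  rewrite powRM ?invr_ge0 ?(ltW rho0) //; congr (_ * _).
  have -> : (2 - n%:R) / 2 = - r by rewrite /r; field.
  rewrite powRN; apply: (mulIf (x := rho `^ r)); first by rewrite gt_eqF // powR_gt0.
  rewrite mulVf; last by rewrite gt_eqF // powR_gt0.
  by rewrite -powRM ?invr_ge0 ?(ltW rho0) // mulVf // powR1.
have zd : `|z| < d1.
  have zle : `|z| <= 6 / s.
    apply/norm_leP; first by rewrite divr_ge0 // ltW.
    move=> i; rewrite /z E1 scalerA mxE normrM.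
    have -> : (s ^+ 2 * rho)^-1 * s = rho^-1 / s by field; rewrite sn rn.
    rewrite gtr0_norm ?divr_gt0 ?invr_gt0 // mulrAC ler_wpM2r ?invr_ge0 ?(ltW s0) //.
    rewrite mulrC ler_pdivrMr //; apply: le_trans (shell_coord i Sy) _.
    by move: y1; lra.
  apply: le_lt_trans zle _; rewrite ltr_pdivrMr // mulrC -ltr_pdivrMr //.
  by apply: lt_trans sd1; rewrite ltr_pM2r ?invr_gt0 // ltr_nat.
have hd : `|h| < d2.
  rewrite ger0_norm // /h ltr_pdivrMr //.
  have sd : 3 < s * d2 by rewrite -ltr_pdivrMr.
  have s2 : s ^- 2 * s < 1 by rewrite (_ : _ * s = s^-1) ?invf_lt1 //; field.
  have : s ^- 2 * 3 < s ^- 2 * (s * d2) by rewrite ltr_pM2l.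
  have : s ^- 2 * s * d2 < 1 * d2 by rewrite ltr_pM2r.
  have : d2 * (1 / 2) < d2 * rho by rewrite ltr_pM2l.
  by move: t0; rewrite mulrA; lra.
rewrite mulrCA E2 E3.
have -> : u (stereo_inv (- N) E z) * m `^ r - u N * (m `^ r * (1 + h) `^ r) =
  m `^ r * ((v z - u N) - u N * ((1 + h) `^ r - 1)) by rewrite /v /=; ring.
have B1 := H1 z zd; have B2 := H2 h hd.
have B3 : `|u N * ((1 + h) `^ r - 1)| <= u N * e1.
  by apply: normM_le => //; rewrite gtr0_norm.
have m4' : `|m `^ r| <= 4 `^ r by rewrite ger0_norm ?powR_ge0.
apply: le_trans (normM_le m4' (normB_le B1 B3)) _.
rewrite (_ : _ * _ = 4 `^ r * (1 + u N) * e1); last by ring.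
by rewrite /e1 mulrC divfK // gt_eqF.
Unshelve. all: by end_near. Qed.

Variables (eps : 'I_k -> R) (a : 'I_k -> V).
Hypothesis U_params : forall j, fowler_parameters U (p j) (eps j) (a j).

Lemma conformal_balance (X0 : V) (l0 : R) (S : 'M[R]_n) (b : V) : S^T = - S ->
  \sum_j fowlerH n (eps j) * (dotp (cfield X0 l0 S b (p j)) (a j) + cdiv l0 b (p j) / 2) = 0.
Proof.
move=> skewS; have [I HI] := exists_integral_like R n.
have [dU [ddU [CU CdU]]] := conformal_factor_C2.
have oD := @regular_open R n k p.
have PDE := yamabe_equation hn oD CU CdU U_pos U_metric
  (fun x Dx => g_scal frameNE (regular_punctured Dx)).
have A00 : 0 < A0 by rewrite mulr_gt0 ?powR_gt0 // u_pos //; exact: N_punctured.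
exact: (pohozaev_balance hn HI p_injective CU CdU U_pos PDE X0 l0 b skewS U_params A00
  conformal_factor_infinity).
Qed.

End Transfer.

Theorem mainTheorem2 (R : realType) (n k : nat) (hn : (3 <= n)%N)
  (hk : (2 <= k)%N)
  (q : 'I_k -> 'rV[R]_n.+1) (q_sphere : forall j, sphere (q j))
  (q_inj : injective q)
  (u : 'rV[R]_n.+1 -> R)
  (u_pos : forall z, punctured_sphere q z -> 0 < u z)
  (u_smooth : sphere_smooth (punctured_sphere q) u)
  (g_complete : complete_metric (punctured_sphere q) (conformal_metric u))
  (g_scal : constant_scalar_curvature (punctured_sphere q)
              (conformal_metric u) (n%:R * (n%:R - 1)))
  (N : 'rV[R]_n.+1) (E : 'M[R]_(n, n.+1)) (frameNE : stereo_frame N E)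
  (N_regular : ~ range q N)
  (p : 'I_k -> 'rV[R]_n) (p_def : forall j, p j = stereo N E (q j))
  (U : 'rV[R]_n -> R)
  (U_pos : forall x, ~ range p x -> 0 < U x)
  (U_metric : forall x, ~ range p x ->
     pullback (conformal_metric u) (stereo_inv N E) x
       = (U x `^ (4 / (n%:R - 2)))%:M)
  (eps : 'I_k -> R) (a : 'I_k -> 'rV[R]_n)
  (U_params : forall j, fowler_parameters U (p j) (eps j) (a j)) :
  [/\ \sum_(j < k) fowlerH n (eps j) *: a j = 0,
      \sum_(j < k) fowlerH n (eps j) * (dotp (p j) (a j) + 1 / 2) = 0,
      forall b c : 'rV[R]_n,
        \sum_(j < k) fowlerH n (eps j) *
          (dotp b (p j) * dotp c (a j) - dotp c (p j) * dotp b (a j)) = 0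
    & forall b : 'rV[R]_n,
        \sum_(j < k) fowlerH n (eps j) *
          (dotp b (p j) * (dotp (a j) (p j) + 1 / 2)
           - 1 / 2 * enorm (p j) ^+ 2 * dotp b (a j)) = 0].
Proof.
have B := conformal_balance hn q_sphere q_inj u_pos u_smooth g_scal frameNE N_regular
  p_def U_pos U_metric U_params.
have skew0 : (0 : 'M[R]_n)^T = - 0 by rewrite trmx0 oppr0.
split.
(* Translations: the constant field e_i selects the i-th coordinate. *)
- apply/rowP => i; rewrite summxE mxE -[RHS](B (delta_mx 0 i) 0 0 0 skew0).
  apply: eq_bigr => j _; rewrite mxE; congr (_ * _).
  rewrite /cfield /cdiv !dotp0l !(scale0r, mulmx0, scaler0, addr0, add0r, subr0, mul0r).
  rewrite /dotp (bigD1 i) //= big1 => [|m mi]; first by rewrite mxE !eqxx mul1r addr0.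
  by rewrite mxE (negbTE mi) andbF mul0r.
(* The dilation field X = y with lam = 1. *)
- rewrite -[RHS](B 0 1 0 0 skew0); apply: eq_bigr => j _; congr (_ * _).
  by rewrite /cfield /cdiv !dotp0l !(scale0r, mulmx0, scaler0, scale1r, addr0, add0r, subr0).
(* Rotations: the skew matrix sends y to (b . y) c - (c . y) b. *)
- move=> b c; have skewS : (b^T *m c - c^T *m b)^T = - (b^T *m c - c^T *m b).
    by rewrite raddfB /= !trmx_mul !trmxK opprB.
  rewrite -[RHS](B 0 0 _ 0 skewS); apply: eq_bigr => j _; congr (_ * _).
  rewrite /cfield /cdiv !dotp0l !(scale0r, scaler0, addr0, add0r, subr0, mul0r).
  rewrite mulmxBr !mulmxA !dotp_mulmx !mul_scalar_mx dotpDl dotpNl !dotpZl.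
  by rewrite (dotpC (p j) b) (dotpC (p j) c).
(* Special conformal fields: X = (b . y) y - |y|^2 b / 2 with lam = b . y. *)
move=> b; rewrite -[RHS](B 0 0 0 b skew0); apply: eq_bigr => j _; congr (_ * _).
rewrite /cfield /cdiv !(scale0r, mulmx0, add0r) dotpDl dotpNl !dotpZl /enorm sqr_sqrtr ?dotp_ge0 //.
by rewrite (dotpC (a j)); field.
Qed.
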